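(* Assume that the terminal data satisfy $$\|f_0^\varepsilon-f_0\|_{H^1(\Omega)}+\|f_1^\varepsilon-f_1\|\le\varepsilon .$$ Suppose that $$3C_1T<2\qquad\text{and}\qquad \lim_{\varepsilon\to0}\gamma^2(\varepsilon)\,\varepsilon\le K ,$$ where $K$ is a constant. Assume that the original system $$u_{tt}+u_t-\Delta u-\Delta u_t=0\ \text{ in }\Omega\times(0,T),\qquad u=0\ \text{ on }\partial\Omega\times(0,T),\qquad u(\cdot,T)=f_0,\ u_t(\cdot,T)=f_1\ \text{ in }\Omega$$ admits a unique solution $u$ such that $u\in C([0,T];\mathbb{W})$ and $u_t\in L^2(0,T;\mathbb{W})$, where $\mathbb{W}$ is the function space associated with the perturbing operator $\mathbf{Q}_\varepsilon$. Let $M>0$ be such that $$\|u\|^2_{C([0,T];\mathbb{W})}+\|u_t\|^2_{L^2(0,T;\mathbb{W})}\le M .$$ Let $u^\varepsilon$ be the unique weak solution of the regularized system $$u^\varepsilon_{tt}+u^\varepsilon_t+\Delta u^\varepsilon+\Delta u^\varepsilon_t=\mathbf{P}_\varepsilon u^\varepsilon+\mathbf{P}_\varepsilon u^\varepsilon_t\ \text{ in }\Omega\times(0,T),$$ $$u^\varepsilon=0\ \text{ on }\partial\Omega\times(0,T),\qquad u^\varepsilon(\cdot,T)=f_0^\varepsilon,\ u^\varepsilon_t(\cdot,T)=f_1^\varepsilon\ \text{ in }\Omega ,$$ with $\mathbf{P}_\varepsilon=2\Delta+\mathbf{Q}_\varepsilon$. If one chooses $\gamma(\varepsilon)=\varepsilon^{-1/2}$,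 then for any $\varepsilon\in(0,1)$ with $\varepsilon\le e^{-4/C_1}$ (that is, $\gamma(\varepsilon)\ge e^{2/C_1}$) and for $0\le t\le T$ the following error estimates hold: $$\|u^\varepsilon(t)-u(t)\|^2\le C\left(\varepsilon+(\log(\varepsilon^{-1/2}))^{-1}\varepsilon^{1-3C_1(T-t)/2}\right),$$ $$\|\nabla u^\varepsilon(t)-\nabla u(t)\|^2\le C\left(\log(\varepsilon^{-1/2})\,\varepsilon+\varepsilon^{1-3C_1(T-t)/2}\right),$$ $$\|u^\varepsilon_t(t)-u_t(t)\|^2+\int_t^T\|\nabla u^\varepsilon_t(s)-\nabla u_t(s)\|^2\,ds\le C\left((\log(\varepsilon^{-1/2}))^2\varepsilon+\log(\varepsilon^{-1/2})\,\varepsilon^{1-3C_1(T-t)/2}\right),$$ where $C=C(M,C_0,C_1)>0$ is independent of $\varepsilon$.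
   Context: $T>0$ and $\Omega\subset\mathbb{R}^d$ ($d=1,2,3$) is a regular bounded domain with sufficiently smooth boundary. $\langle\cdot,\cdot\rangle$ and $\|\cdot\|$ denote the inner product and norm of $L^2(\Omega)$; $\langle\cdot,\cdot\rangle_{H^{-1},H^1_0}$ is the duality pairing. $\varepsilon\in(0,1)$ is the noise level; $f_0,f_0^\varepsilon\in H^1(\Omega)$ and $f_1,f_1^\varepsilon\in L^2(\Omega)$. $\gamma=\gamma(\varepsilon)\ge1$ is a function of $\varepsilon$ with $\lim_{\varepsilon\to0}\gamma(\varepsilon)=\infty$, here chosen as $\gamma(\varepsilon)=\varepsilon^{-1/2}$. Perturbing operator: a family of $\varepsilon$-dependent linear mappings $\mathbf{Q}_\varepsilon:L^2(\Omega)\to L^2(\Omega)$ for which there exist a function space $\mathbb{W}\subset L^2(\Omega)$ and a constant $C_0>0$ independent of $\varepsilon$ with $\|\mathbf{Q}_\varepsilon h\|\le C_0\|h\|_{\mathbb{W}}/\gamma(\varepsilon)$ for any $h\in\mathbb{W}$. Stabilized operator: a family of $\varepsilon$-dependent linear mappings $\mathbf{P}_\varepsilon:L^2(\Omega)\to L^2(\Omega)$ for which there is a constant $C_1>0$ independent of $\varepsilon$ with $\|\mathbf{P}_\varepsilon h\|\le C_1\log(\gamma(\varepsilon))\|h\|$ for any $h\in L^2(\Omega)$. Both operators act in the variable $x$ only. Throughout, $\mathbf{Q}_\varepsilon$ is a perturbing operator (with space $\mathbb{W}$ and constant $C_0$) and $\mathbf{P}_\varepsilon=2\Delta+\mathbf{Q}_\varepsilon$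 is a stabilized operator (with constant $C_1$). Weak solution of the regularized system: it is obtained through the equivalent system for $v^\varepsilon(x,t)=e^{\rho(t-T)}u^\varepsilon(x,t)$, where $\rho>1$ is a constant. Here $v=v^\varepsilon\in L^2(0,T;H^1_0(\Omega))$ with $v_t\in L^2(0,T;H^1(\Omega))$ and $v_{tt}\in L^2(0,T;H^{-1}(\Omega))$ satisfies, for every $\varphi\in H^1_0(\Omega)$ and a.e. $t\in(0,T)$, $$\langle v_{tt}(t),\varphi\rangle_{H^{-1},H^1_0}+(1-2\rho)\langle v_t(t),\varphi\rangle+(\rho^2-\rho)\langle v(t),\varphi\rangle+(\rho-1)\langle\nabla v(t),\nabla\varphi\rangle-\langle\nabla v_t(t),\nabla\varphi\rangle=(1-\rho)\langle\mathbf{P}_\varepsilon v(t),\varphi\rangle+\langle\mathbf{P}_\varepsilon v_t(t),\varphi\rangle,$$ together with $v(x,T)=f_0^\varepsilon(x)$ and $v_t(x,T)=\rho f_0^\varepsilon(x)+f_1^\varepsilon(x)$ in $\Omega$. *)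

(* Defs.v *)
From HB Require Import structures.
From mathcomp Require Import all_boot all_order all_algebra.
From mathcomp Require Import generic_quotient ring_quotient.
From mathcomp Require Import all_classical all_reals all_analysis.
From mathcomp Require Import measurable_realfun.

Set Implicit Arguments.
Unset Strict Implicit.
Unset Printing Implicit Defensive.
Import Order.TTheory GRing.Theory Num.Theory.
Import numFieldNormedType.Exports.
Local Open Scope classical_set_scope.
Local Open Scope ring_scope.

Lemma pushforward_sigma_additive d1 d2 (T1 : measurableType d1)
    (T2 : measurableType d2) (R : realType) (m : {measure set T1 -> \bar R})
    (f : T1 -> T2) :
  measurable_fun setT f -> semi_sigma_additive (pushforward m f).
Proof.
move=> mf F mF tF mUF; rewrite /pushforward preimage_bigcup.
have mpre A : measurable A -> measurable (f @^-1` A).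
  by move=> mA; rewrite -[X in measurable X]setTI; exact: mf.
apply: measure_semi_sigma_additive => [k||].
- exact: mpre.
- apply/trivIsetP => /= i j _ _ ij; rewrite -preimage_setI.
  by move/trivIsetP : tF => /(_ _ _ _ _ ij) ->//; rewrite preimage_set0.
- by rewrite -preimage_bigcup; exact: mpre.
Qed.

Section lebesgue_tuple.
Variable R : realType.
Local Notation mR := (measurableTypeR R).

Definition tcons n (p : mR * n.-tuple mR) : n.+1.-tuple mR :=
  [tuple of p.1 :: p.2].
Definition tuncons n (t : n.+1.-tuple mR) : mR * n.-tuple mR :=
  (thead t, [tuple of behead t]).

Lemma tconsK n : cancel (@tcons n) (@tuncons n).
Proof. by case=> x t; congr pair; apply/val_inj. Qed.

Lemma measurable_tcons n : measurable_fun setT (@tcons n).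
Proof. exact: measurable_cons. Qed.

Lemma measurable_tuncons n : measurable_fun setT (@tuncons n).
Proof.
apply: measurable_fun_pair; last exact: measurable_behead.
exact: (measurable_tnth ord0).
Qed.

Section step.
Variables (n : nat) (m : {sigma_finite_measure set (n.-tuple mR) -> \bar R}).

Definition lebesgue_step : set (n.+1.-tuple mR) -> \bar R :=
  pushforward (@lebesgue_measure R \x m)%E (@tcons n).

Let step0 : lebesgue_step set0 = 0%E.
Proof. by rewrite /lebesgue_step /pushforward preimage_set0 measure0. Qed.

Let step_ge0 A : (0 <= lebesgue_step A)%E.
Proof. exact: (measure_ge0 (@lebesgue_measure R \x m)%E). Qed.

Let step_sigma_additive : semi_sigma_additive lebesgue_step.
Proof. by apply: pushforward_sigma_additive; exact: measurable_tcons. Qed.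

HB.instance Definition _ := isMeasure.Build _ _ _ lebesgue_step
  step0 step_ge0 step_sigma_additive.

Let step_sigma_finite : sigma_finite setT lebesgue_step.
Proof.
have /sigma_finiteP[F [FT ndF Foo]] := sigma_finiteT (@lebesgue_measure R).
have /sigma_finiteP[G [GT ndG Goo]] := sigma_finiteT m.
exists (fun k => @tuncons n @^-1` (F k `*` G k)).
  apply/esym; rewrite -preimage_bigcup; apply/seteqP; split=> // t _ /=.
  have [i _ Fi] : (\bigcup_k F k) (tuncons t).1 by rewrite -FT.
  have [j _ Gj] : (\bigcup_k G k) (tuncons t).2 by rewrite -GT.
  exists (maxn i j) => //; split.
  - by move: Fi; exact/subsetPset/ndF/leq_maxl.
  - by move: Gj; exact/subsetPset/ndG/leq_maxr.
move=> k; have [mF Fk] := Foo k; have [mG Gk] := Goo k; split.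
  rewrite -[X in measurable X]setTI; apply: measurable_tuncons => //.
  exact: measurableX.
rewrite /lebesgue_step /pushforward -comp_preimage.
rewrite (_ : _ \o _ = id); last by apply/funext; exact: tconsK.
by rewrite preimage_id product_measure1E// lte_mul_pinfty// ge0_fin_numE.
Qed.

HB.instance Definition _ := Measure_isSigmaFinite.Build _ _ _ lebesgue_step
  step_sigma_finite.

End step.

Fixpoint lebesgue_tuple n : {sigma_finite_measure set (n.-tuple mR) -> \bar R} :=
  match n with
  | 0 => @dirac _ _ ([tuple] : 0.-tuple mR) R
  | n'.+1 => lebesgue_step (lebesgue_tuple n')
  end.

Definition borelRn n := g_sigma_algebraType (@open 'rV[R]_n).

Definition row_of_tuple n (t : n.-tuple mR) : borelRn n := \row_i tnth t i.

Lemma measurable_row_of_tuple n : measurable_fun setT (@row_of_tuple n).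
Proof.
apply: (@measurability _ _ _ _ _ _ (@open 'rV[R]_n : set (set (borelRn n)))) => // _ [U oU <-]; rewrite setTI.
pose c (q : n.-tuple rat) : 'rV[R]_n := \row_i ratr (tnth q i).
pose V (p : n.-tuple rat * nat) :=
  if `[< ball (c p.1) p.2.+1%:R^-1 `<=` U >]
  then @row_of_tuple n @^-1` ball (c p.1) p.2.+1%:R^-1 else set0.
have -> : @row_of_tuple n @^-1` U = \bigcup_p V p.
  apply/seteqP; split=> [t /= tU|t [p _]]; last first.
    by rewrite /V; case: asboolP => // pU; exact: pU.
  have /nbhs_ballP[e /= e0 eU] : nbhs (row_of_tuple t : 'rV[R]_n) U.
    exact: open_nbhs_nbhs.
  have e20 : 0 < e / 2 by rewrite divr_gt0.
  have [k _ /(_ k (leqnn k)) /= ke] := near_infty_natSinv_lt (PosNum e20).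
  have k0 : 0 < k.+1%:R^-1 :> R by rewrite invr_gt0 ltr0n.
  have /choice[q hq] (i : 'I_n) :
      exists q : rat, ball (tnth t i : R) k.+1%:R^-1 (ratr q).
    have b0 : ball (tnth t i : R) k.+1%:R^-1 !=set0.
      by exists (tnth t i); exact: ballxx.
    have [x [bx [r _ rx]]] := dense_rat b0 (ball_open _ _).
    by exists r; rewrite rx.
  exists ([tuple q i | i < n], k) => //; rewrite /V /=.
  have cq : ball (c [tuple q i | i < n]) k.+1%:R^-1 (row_of_tuple t : 'rV[R]_n).
    by split=> // i j; rewrite !mxE tnth_mktuple; exact/ball_sym.
  case: asboolP => // -[] y cy; apply: eU.
  apply: (@ball_split _ _ (c [tuple q i | i < n])).
  - by apply: ball_sym; apply: le_ball cq; exact/ltW.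
  - by apply: le_ball cy; exact/ltW.
apply: countable_bigcupT_measurable => [|p]; first exact: countableP.
rewrite /V; case: asboolP => // _.
rewrite (_ : _ @^-1` _ = \bigcap_(i in [set: 'I_n])
   ((fun t => tnth t i) @^-1` ball (c p.1 ord0 i) p.2.+1%:R^-1)); last first.
  apply/seteqP; split=> t /=.
    by move=> [_ h] i _; have := h ord0 i; rewrite !mxE.
  move=> h; split; first by rewrite invr_gt0 ltr0n.
  by move=> i j; rewrite ord1 !mxE; have := h j I; rewrite !mxE.
apply: fin_bigcap_measurable => [|i _]; first exact: finite_finset.
rewrite -[X in measurable X]setTI; apply: measurable_tnth => //.
by apply: open_measurable; exact: ball_open.
Qed.

Definition lebesgue_Rn n : set (borelRn n) -> \bar R :=
  pushforward (lebesgue_tuple n) (@row_of_tuple n).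

Section lebesgue_Rn_measure.
Variable n : nat.

Let lebesgue_Rn0 : @lebesgue_Rn n set0 = 0%E.
Proof. by rewrite /lebesgue_Rn /pushforward preimage_set0 measure0. Qed.

Let lebesgue_Rn_ge0 A : (0 <= @lebesgue_Rn n A)%E.
Proof. exact: (measure_ge0 (lebesgue_tuple n)). Qed.

Let lebesgue_Rn_sigma_additive : semi_sigma_additive (@lebesgue_Rn n).
Proof. by apply: pushforward_sigma_additive; exact: measurable_row_of_tuple. Qed.

HB.instance Definition _ := isMeasure.Build _ _ _ (@lebesgue_Rn n)
  lebesgue_Rn0 lebesgue_Rn_ge0 lebesgue_Rn_sigma_additive.

End lebesgue_Rn_measure.
End lebesgue_tuple.

Section L2.
Context d (T : measurableType d) (R : realType).
Variable mu : {measure set T -> \bar R}.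

Definition Lfun2 := LfunType mu (lee1n 2).

Definition null_fun : {pred Lfun2} := [pred f : Lfun2 | `[< f = 0 %[ae mu] >]].

Fact null_fun_zmod_closed : zmod_closed null_fun.
Proof.
split=> [|f g]; first by apply/asboolP; exact: nearW.
move=> /asboolP f0 /asboolP g0; apply/asboolP.
apply: filterS2 f0 g0 => x /= f0 g0 _; transitivity (f x - g x) => //.
by rewrite f0// g0// subr0.
Qed.
HB.instance Definition _ := GRing.isZmodClosed.Build Lfun2 null_fun
  null_fun_zmod_closed.

Definition L2 : Type := Quotient.quot null_fun.
HB.instance Definition _ := GRing.Zmodule.on L2.

Local Open Scope quotient_scope.

Fact null_funZ a f : f \in null_fun -> (a *: f : Lfun2) \in null_fun.
Proof.
move=> /asboolP f0; apply/asboolP; apply: filterS f0 => x /= f0 _.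
by transitivity (a * f x) => //; rewrite f0// mulr0.
Qed.

Definition scaleL2 (a : R) (h : L2) : L2 := \pi_(L2) (a *: repr h).

Fact scaleL2_pi a f : scaleL2 a (\pi_(L2) f) = \pi_(L2) (a *: f).
Proof.
apply/eqP; rewrite -Quotient.idealrBE -scalerBr; apply: null_funZ.
by rewrite Quotient.idealrBE reprK.
Qed.

Fact scaleL2A a b h : scaleL2 a (scaleL2 b h) = scaleL2 (a * b) h.
Proof. by elim/quotW: h => f; rewrite (scaleL2_pi b f) !scaleL2_pi scalerA. Qed.

Fact scaleL21 : left_id 1 scaleL2.
Proof. by elim/quotW=> f; rewrite scaleL2_pi scale1r. Qed.

Fact scaleL2Dr : right_distributive scaleL2 +%R.
Proof.
move=> a; elim/quotW=> f; elim/quotW=> g.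
by rewrite -raddfD !scaleL2_pi scalerDr raddfD.
Qed.

Fact scaleL2Dl h : {morph scaleL2^~ h : a b / a + b}.
Proof. by move=> a b; elim/quotW: h => f; rewrite !scaleL2_pi scalerDl raddfD. Qed.

HB.instance Definition _ := GRing.Zmodule_isLmodule.Build R L2
  scaleL2A scaleL21 scaleL2Dr scaleL2Dl.

Definition funL2 (h : L2) : T -> R := repr h.

Definition dotL2 (h k : L2) : R := (\int[mu]_x (funL2 h x * funL2 k x))%R.

Definition normL2 (h : L2) : R := Num.sqrt (dotL2 h h).
End L2.

(** [C^k] functions on a finite-dimensional space, through directional
    derivatives. *)
Fixpoint Ck (R : realType) (V : normedModType R) (k : nat) (f : V -> R^o) : Prop :=
  match k with
  | 0 => continuous f
  | k'.+1 => continuous f /\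
      forall v : V, (forall x, derivable f x v) /\ Ck k' ('D_v f)
  end.

(** [C_c^oo(U)], its elements being extended by zero outside of [U]. *)
Definition testfun (R : realType) (V : normedModType R) (U : set V)
    (phi : V -> R^o) : Prop :=
  (forall k, Ck k phi) /\
  exists2 K : set V, compact K /\ K `<=` U & forall x, ~ K x -> phi x = 0.

(** Bounded domains (open connected sets) of [R^n].  [C^1] regularity of the
    boundary, expressed with local defining functions, is the weakest reading
    of "sufficiently smooth". *)
Record smooth_domain (R : realType) (n : nat) := SmoothDomain {
  domain_set :> set 'rV[R]_n ;
  domain_nonempty : domain_set !=set0 ;
  domain_open : open domain_set ;
  domain_connected : connected domain_set ;
  domain_bounded : bounded_set domain_set ;
  domain_boundary : forall x, closure domain_set x -> ~ domain_set x ->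
    exists (U : set 'rV[R]_n) (psi : 'rV[R]_n -> R^o),
      [/\ open U, U x, Ck 1 psi,
          forall y, U y -> exists v, 'D_v psi y != 0 &
          forall y, U y -> (domain_set y <-> psi y < 0)]
}.

(** A subspace of [V] with its own norm, e.g. [H^1] inside [L^2].  The values
    of the norm outside of the carrier are irrelevant. *)
Record nspace (R : realType) (V : lmodType R) := NSpace {
  carrier : set V ;
  nrm : V -> R
}.

Definition normed_subspace (R : realType) (V : lmodType R) (X : nspace V) : Prop :=
  [/\ carrier X 0,
      forall (a : R) x y, carrier X x -> carrier X y -> carrier X (a *: x + y),
      forall x, carrier X x -> 0 <= nrm X x /\ (nrm X x = 0 -> x = 0),
      forall (a : R) x, carrier X x -> nrm X (a *: x) = `|a| * nrm X x &
      forall x y, carrier X x -> carrier X y -> nrm X (x + y) <= nrm X x + nrm X y].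

Section time_dependent.
Variables (R : realType) (V : lmodType R) (X : nspace V) (T : R).
Local Notation leb := (@lebesgue_measure R).

Definition simple_valued (s : R -> V) : Prop :=
  exists (m : nat) (A : 'I_m -> set (measurableTypeR R)) (c : 'I_m -> V),
    (forall k, measurable (A k) /\ carrier X (c k)) /\
    forall t, s t = \sum_(k < m) (\1_(A k) t : R) *: c k.

Definition strongly_measurable (f : R -> V) : Prop :=
  exists2 s : nat -> R -> V, (forall k, simple_valued (s k)) &
    \forall t \ae leb, 0 < t < T -> nrm X (s k t - f t) @[k --> \oo] --> (0 : R).

Definition sqnorm_L2X (f : R -> V) : \bar R :=
  (\int[leb]_(t in `]0%R, T[) (nrm X (f t) ^+ 2)%:E)%E.

Definition in_L2X (f : R -> V) : Prop :=
  [/\ \forall t \ae leb, 0 < t < T -> carrier X (f t),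
      strongly_measurable f &
      (sqnorm_L2X f < +oo)%E].

Definition in_CX (f : R -> V) : Prop :=
  forall t, 0 <= t <= T -> carrier X (f t) /\
    nrm X (f s - f t) @[s --> within `[0, T]%classic (nbhs t)] --> (0 : R).

Definition norm_CX (f : R -> V) : R := sup [set nrm X (f t) | t in `[0, T]%classic].

End time_dependent.

Definition weak_dt (R : realType) (T : R) (f g : R -> R) : Prop :=
  forall psi : R^o -> R^o, testfun `]0, T[%classic psi ->
    (\int[@lebesgue_measure R]_(t in `]0, T[) (f t * derive1 psi t))%R =
    - (\int[@lebesgue_measure R]_(t in `]0, T[) (g t * psi t))%R.

Section sobolev.
Variables (R : realType) (n : nat) (Omega : smooth_domain R n).

Lemma measurable_domain : measurable (Omega : set (borelRn R n)).
Proof. by apply: sub_sigma_algebra; exact: domain_open. Qed.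

Definition lebesgue_domain : {measure set (borelRn R n) -> \bar R} :=
  mrestr (@lebesgue_Rn R n) measurable_domain.

Definition L2dom : lmodType R := L2 lebesgue_domain.

Definition L2_space : nspace L2dom := NSpace setT (@normL2 _ _ _ lebesgue_domain).

Definition pair_test (h : L2dom) (phi : 'rV[R]_n -> R) : R :=
  (\int[lebesgue_domain]_x (funL2 h x * phi x))%R.

Definition basis_vec (i : 'I_n) : 'rV[R]_n := delta_mx 0 i.

Definition is_partial (i : 'I_n) (h g : L2dom) : Prop :=
  forall phi, testfun Omega phi ->
    pair_test h ('D_(basis_vec i) phi) = - pair_test g phi.

Definition partial (i : 'I_n) (h : L2dom) : L2dom :=
  xget 0 [set g | is_partial i h g].

(** The Laplacian is taken in the sense of distributions. *)
Definition is_laplacian (h g : L2dom) : Prop :=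
  forall phi, testfun Omega phi ->
    pair_test h
      (fun x => \sum_i 'D_(basis_vec i) ('D_(basis_vec i) phi) x) =
    pair_test g phi.

Definition dot (h k : L2dom) : R := @dotL2 _ _ _ lebesgue_domain h k.
Definition norm (h : L2dom) : R := @normL2 _ _ _ lebesgue_domain h.

Definition dot_grad (h k : L2dom) : R := \sum_i dot (partial i h) (partial i k).
Definition sqdist_grad (h k : L2dom) : R :=
  \sum_i norm (partial i h - partial i k) ^+ 2.

Definition H1_set : set L2dom := [set h | forall i, exists g, is_partial i h g].
Definition norm_H1 (h : L2dom) : R := Num.sqrt (norm h ^+ 2 + dot_grad h h).
Definition H1 : nspace L2dom := NSpace H1_set norm_H1.

(** closure of [C_c^oo(Omega)] in [H^1(Omega)] *)
Definition H10_set : set L2dom := [set h | H1_set h /\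
  forall e : R, 0 < e -> exists (g : L2dom) (phi : 'rV[R]_n -> R^o),
    [/\ testfun Omega phi,
        \forall x \ae lebesgue_domain, funL2 g x = phi x &
        norm_H1 (h - g) < e]].
Definition H10 : nspace L2dom := NSpace H10_set norm_H1.

(** [H^{-1}(Omega)]: only the values of a functional on [H10_set] matter. *)
Definition Hm1_set : set (L2dom -> R^o) := [set l |
  (forall (a : R) h k, H10_set h -> H10_set k -> l (a *: h + k) = a * l h + l k) /\
  exists c : R, forall h, H10_set h -> `|l h| <= c * norm_H1 h].
Definition norm_Hm1 (l : L2dom -> R^o) : R :=
  sup [set `|l h| | h in [set h | H10_set h /\ norm_H1 h <= 1]].
Definition Hm1 : nspace (L2dom -> R^o) := NSpace Hm1_set norm_Hm1.

(** [v \in L^2(0,T;H^1_0)], [v_t = v' \in L^2(0,T;H^1)],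
    [v_tt = v'' \in L^2(0,T;H^-1)].  Time derivatives of vector-valued functions
    are tested against the (pre)dual.  [v] and [v'] are the continuous
    representatives, so that their values at every time make sense. *)
Definition energy_class (T : R) (v v' : R -> L2dom) (v'' : R -> L2dom -> R^o) : Prop :=
  [/\ [/\ in_L2X H10 T v, in_L2X H1 T v' & in_L2X Hm1 T v''],
      in_CX H10 T v, in_CX L2_space T v',
      forall phi, weak_dt T (fun t => dot (v t) phi) (fun t => dot (v' t) phi) &
      forall phi, H10_set phi ->
        weak_dt T (fun t => dot (v' t) phi) (fun t => v'' t phi)].

(** Weak solution [u], with time derivative [ut], of
    [u_tt + u_t - Delta u - Delta u_t = 0], [u = 0] on the boundary,
    [u(T) = f0], [u_t(T) = f1]. *)
Definition original_solution (T : R) (f0 f1 : L2dom) (u ut : R -> L2dom) : Prop :=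
  exists utt : R -> L2dom -> R^o,
    [/\ energy_class T u ut utt,
        forall phi, H10_set phi ->
          \forall t \ae @lebesgue_measure R, 0 < t < T ->
            utt t phi + dot (ut t) phi + dot_grad (u t) phi
              + dot_grad (ut t) phi = 0,
        u T = f0 & ut T = f1].

(** Weak solution [u], with time derivative [ut], of
    [u_tt + u_t + Delta u + Delta u_t = P u + P u_t], [u = 0] on the boundary,
    [u(T) = f0], [u_t(T) = f1], obtained through [v = e^(rho (t - T)) u], for
    which [v_t = e^(rho (t - T)) (u_t + rho u)]. *)
Definition regularized_solution (rho T : R) (P : {linear L2dom -> L2dom})
    (f0 f1 : L2dom) (u ut : R -> L2dom) : Prop :=
  exists (v v' : R -> L2dom) (v'' : R -> L2dom -> R^o),
    [/\ energy_class T v v' v'',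
        forall phi, H10_set phi ->
          \forall t \ae @lebesgue_measure R, 0 < t < T ->
            v'' t phi + (1 - 2 * rho) * dot (v' t) phi
              + (rho ^+ 2 - rho) * dot (v t) phi
              + (rho - 1) * dot_grad (v t) phi - dot_grad (v' t) phi
            = (1 - rho) * dot (P (v t)) phi + dot (P (v' t)) phi,
        v T = f0, v' T = rho *: f0 + f1 &
        forall t, 0 <= t <= T ->
          v t = expR (rho * (t - T)) *: u t /\
          v' t = expR (rho * (t - T)) *: (ut t + rho *: u t)].

Definition perturbing (gamma : R -> R) (W : nspace L2dom) (C0 : R)
    (Q : R -> {linear L2dom -> L2dom}) : Prop :=
  forall eps, 0 < eps < 1 -> forall h, carrier W h ->
    norm (Q eps h) <= C0 * nrm W h / gamma eps.

Definition stabilized (gamma : R -> R) (C1 : R)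
    (P : R -> {linear L2dom -> L2dom}) : Prop :=
  forall eps, 0 < eps < 1 -> forall h,
    norm (P eps h) <= C1 * ln (gamma eps) * norm h.

(** [P = 2 Delta + Q].  The Dirichlet Laplacian is unbounded on [L^2], so the
    identity is asserted for [h] in [H^1_0] on its natural domain
    [{Delta h \in L^2}], and on the space [W] on which [Q] is controlled. *)
Definition two_laplacian_plus (W : nspace L2dom) (P Q : {linear L2dom -> L2dom}) : Prop :=
  forall h, H10_set h ->
    carrier W h \/ (exists g, is_laplacian h g) ->
    exists2 g, is_laplacian h g & P h = 2 *: g + Q h.

End sobolev.

(* Main.v *)
Require Import Defs.
From HB Require Import structures.
From mathcomp Require Import all_boot all_order all_algebra.
From mathcomp Require Import all_classical all_reals all_analysis.
From mathcomp Require Import generic_quotient ring_quotient measurable_realfun.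
From mathcomp Require Import ring lra.
Set Implicit Arguments.
Unset Strict Implicit.
Unset Printing Implicit Defensive.
Import Order.TTheory GRing.Theory Num.Theory.
Import numFieldNormedType.Exports.
Local Open Scope classical_set_scope.
Local Open Scope ring_scope.

(** Put [w = u^eps - u] and [z = w + w_t].  Both second-order systems become
    first-order ones for [u + u_t], and [z] solves the backward equation
    [z_t = - Delta z + P z + (P - 2 Delta) (u + u_t)], whose source is
    [Q (u + u_t)], of size [C0 ||u + u_t||_W / gamma].  With [y = e^(t - T) w] and
    [zeta = y_t = e^(t - T) z], testing with [zeta] and absorbing [||P zeta||] by
    [B = C1 log gamma] gives
    [d/dt ||zeta||^2 >= 2 ||grad zeta||^2 - 3 B ||zeta||^2 - ||Q (u + u_t)||^2 / B],
    so that Gronwall's lemma, backwards from [T], yields the factor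
    [e^(3 B (T - t)) = eps^(- 3 C1 (T - t) / 2)].  The bounds on [w] follow by
    integrating [zeta] from [T], those on [w_t] from [w_t = z - w].

    Since [zeta] is only weakly differentiable in time, the estimate is made for the
    Steklov averages [(y (t + h) - y t) / h], which lie in [H^1_0]; then [h -> 0] by
    Fatou's lemma and the lower semicontinuity of the Dirichlet integral.  Tested
    against a function of [C_c^oo], every pairing is [C^1] in time by the lemma of
    du Bois-Reymond, so that no vector-valued integration is needed.  The identity
    [P = 2 Delta + Q] applies to [u + u_t] because [u_t t] is in [H^1_0] for almost
    every [t], as the limit of difference quotients of [u] at Lebesgue points. *)

(** * Smooth functions *)

(** The weak equations hold for almost every time with a null set that depends on the test function,
    so a test function moving with time cannot be inserted. For a fixed function of [C_c^oo], once
    the Laplacian is moved onto it, all terms are continuous in time and the equation holds at every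
    time. Integrated over [[t, t + h]] it extends by density to an inequality for all of [H^1_0] at
    that fixed time, and only then is the Steklov average inserted. The factor [e^(t - T)] is the
    integrating factor of [w + w_t]: it makes [zeta] an exact time derivative. It also removes
    [rho], since [e^((1 - rho) (t - T)) v = e^(t - T) u^eps]. The constant is free of [T] because
    [3 C1 T < 2] bounds [T] by [2 / (3 C1)]. Weighting the source by [1 / B] gives it the size
    [eps / log gamma]; the terminal error, of size [eps^2], obeys the same kind of bound because
    [eps log (1 / eps) <= 1]. Powers of the logarithm can be raised at the cost of a constant
    because [eps <= e^(-4 / C1)] bounds [log gamma] below by [2 / C1]. *)

Section Ck_algebra.
Context {R : realType} {V : normedModType R}.
Implicit Types (f g : V -> R^o) (k : nat).

(** A coinduction principle: closure of a whole family under directional derivatives replaces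
    formulas for the higher derivatives of its members. *)
Lemma Ck_of_class (S : set (V -> R^o)) :
  (forall f, S f -> continuous f /\
    forall v, (forall x, derivable f x v) /\ S ('D_v f)) ->
  forall f, S f -> forall k, Ck k f.
Proof.
move=> HS f Sf k; elim: k f Sf => [|k IH] f Sf; first exact: (HS f Sf).1.
split; first exact: (HS f Sf).1.
by move=> v; have [df SD] := (HS f Sf).2 v; split => //; exact: IH.
Qed.

Lemma CkS k f : Ck k.+1 f -> Ck k f.
Proof.
elim: k f => [|k IH] f; first by case.
move=> [cf df]; split => // v; have [? Dv] := df v; split => //.
exact: IH.
Qed.

Lemma CkD k f g : Ck k f -> Ck k g -> Ck k (fun x => f x + g x).
Proof.
elim: k f g => [|k IH] f g.
  by move=> cf cg x; apply: (@continuousD _ _ _ f g x); [exact: cf|exact: cg].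
move=> [cf df] [cg dg]; split.
  by move=> x; apply: (@continuousD _ _ _ f g x); [exact: cf|exact: cg].
move=> v; have [df1 df2] := df v; have [dg1 dg2] := dg v; split.
  by move=> x; exact: (@derivableD _ _ _ f g x v).
rewrite (_ : 'D_v _ = fun x => 'D_v f x + 'D_v g x); first exact: IH.
by apply/funext => x; exact: (@deriveD _ _ _ f g x v).
Qed.

Lemma CkM k f g : Ck k f -> Ck k g -> Ck k (fun x => f x * g x : R^o).
Proof.
elim: k f g => [|k IH] f g.
  by move=> cf cg x; apply: (@continuousM _ _ (f : V -> R) (g : V -> R) x);
    [exact: cf|exact: cg].
move=> Cf Cg; have [cf df] := Cf; have [cg dg] := Cg; split.
  by move=> x; apply: (@continuousM _ _ (f : V -> R) (g : V -> R) x);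
    [exact: cf|exact: cg].
move=> v; have [df1 df2] := df v; have [dg1 dg2] := dg v; split.
  by move=> x; exact: (@derivableM _ _ f g x v).
rewrite (_ : 'D_v _ = fun x => (f x * 'D_v g x : R^o) + (g x * 'D_v f x : R^o)).
  by apply: CkD; apply: IH => //; exact: CkS.
by apply/funext => x; exact: (@deriveM _ _ f g x v).
Qed.

Lemma Ck_cst k (c : R) : Ck k (fun _ : V => c : R^o).
Proof.
apply: (@Ck_of_class (fun f => exists c : R, f = fun=> c)); last by exists c.
move=> _ [a ->]; split; first exact: cst_continuous.
move=> v; split; first by move=> x; exact: derivable_cst.
by exists 0; apply/funext => x; exact: derive_cst.
Qed.

Lemma CkZ k (c : R) f : Ck k f -> Ck k (fun x => c * f x : R^o).
Proof. by move=> Cf; apply: CkM => //; exact: Ck_cst. Qed.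

Lemma Ck_prod k (I : Type) (r : seq I) (F : I -> V -> R^o) :
  (forall i, Ck k (F i)) -> Ck k (fun x => \prod_(i <- r) (F i x : R) : R^o).
Proof.
move=> CF; elim: r => [|i r IH].
  rewrite (_ : (fun x => _) = fun=> 1); first exact: Ck_cst.
  by apply/funext => x; rewrite big_nil.
rewrite (_ : (fun x => _) = fun x => F i x * \prod_(j <- r) (F j x : R) : R^o).
  exact: CkM.
by apply/funext => x; rewrite big_cons.
Qed.

End Ck_algebra.

(** * Flat functions at the origin *)

Section flat.
Context {R : realType}.
Implicit Types (p : {poly R}) (x y : R).

(* [p (1 / x) e^(- 1 / x)]: a family closed under differentiation. *)
Definition flat p x : R := if 0 < x then p.[x^-1] * expR (- x^-1) else 0.

(** Generalizing over the power [n] lets the induction pass from [p] to [p * 'X + c]: the extra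
    factor [y] is absorbed by raising [n] by one. The constant term relies on [y^n <= n! e^y]. *)
Lemma horner_expR_bound p n :
  exists C, forall y, 0 < y -> `|p.[y]| * y ^+ n * expR (- y) <= C.
Proof.
elim/poly_ind: p n => [|p c IH] n.
  by exists 0 => y y0; rewrite horner0 normr0 !mul0r.
have [C HC] := IH n.+1.
have [E HE] : exists E, forall y, 0 < y -> y ^+ n * expR (- y) <= E.
  case: n {HC} => [|n].
    by exists 1 => y y0; rewrite expr0 mul1r -(expR0 R) ler_expR oppr_le0 ltW.
  exists n.+1`!%:R => y y0; rewrite expRN ler_pdivrMr ?expR_gt0//.
  rewrite -ler_pdivrMl ?ltr0n ?fact_gt0//.
  have := expR_ge1Dxn n (ltW y0); rewrite mulrC; lra.
exists (C + `|c| * E) => y y0; rewrite !hornerE.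
have le1 := HC y y0; have le2 := HE y y0.
have -> : `|p.[y] * y + c| * y ^+ n * expR (- y) =
   `|p.[y] * y + c| * (y ^+ n * expR (- y)) by rewrite mulrA.
have pos : 0 <= y ^+ n * expR (- y) by rewrite mulr_ge0// ?expR_ge0// exprn_ge0// ltW.
apply: (@le_trans _ _ ((`|p.[y]| * y + `|c|) * (y ^+ n * expR (- y)))).
  rewrite ler_wpM2r// (le_trans (ler_normD _ _))// normrM (gtr0_norm y0).
  by [].
rewrite mulrDl lerD//; last by rewrite ler_wpM2l.
by move: le1; rewrite exprS !mulrA.
Qed.

(** A quadratic bound is enough for differentiability at 0 with derivative 0, for the whole family
    at once. *)
Lemma flat_bound p : exists C, forall x, `|flat p x| <= C * `|x| ^+ 2.
Proof.
have [C HC] := horner_expR_bound p 2.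
exists C => x; rewrite /flat; case: ifPn => x0; last first.
  rewrite normr0 mulr_ge0// ?sqr_ge0//.
  by apply: le_trans (HC 1 ltr01); rewrite expr1n mulr1 mulr_ge0// expR_ge0.
have xi0 : 0 < x^-1 by rewrite invr_gt0.
have := HC _ xi0; rewrite normrM (ger0_norm (expR_ge0 _)) (gtr0_norm x0).
rewrite exprVn -ler_pdivrMr ?exprn_gt0//.
by rewrite mulrAC.
Qed.

(** With [y = 1 / x], the chain rule turns [p(y) e^(-y)] into [y^2 (p(y) - p'(y)) e^(-y)]. *)
Definition flat_deriv p : {poly R} := 'X^2 * (p - p^`()).

Lemma is_derive_flat p x : is_derive x 1 (flat p) (flat (flat_deriv p) x).
Proof.
have [x0|x0|->] := ltrgt0P x.
- have := @near_eq_is_derive R R^o R^o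
    (fun x : R^o => p.[x^-1] * expR (- x^-1) : R^o) (flat p) x 1.
  apply.
    near=> z; rewrite /flat ifT//.
    by near: z; exact: lt_nbhsr.
  have xn0 : x != 0 by rewrite gt_eqF.
  have dV : is_derive x (1:R) (fun y : R => y^-1) (- x ^- 2).
    have := @is_deriveV R id x 1 1 xn0 (is_derive_id _ _).
    by rewrite /= scaler1.
  have dp : is_derive x^-1 (1:R) (horner p) (p^`().[x^-1]).
    rewrite derivE derive1E; apply/derivableP; exact: derivable_horner.
  have d1 := is_derive1_comp (f:=horner p) (g:=fun y : R => y^-1) dp dV.
  have d2 := is_derive1_comp (f:=@expR R) (g:=fun y : R => - y^-1) (is_derive_expR _)
     (is_deriveN dV).
  have := is_deriveM d1 d2.
  move=> h; apply: is_derive_eq; rewrite /flat /flat_deriv x0 !hornerE /=.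
  by rewrite /GRing.scale /=; field.
- have -> : flat (flat_deriv p) x = 0 by rewrite /flat ltNge (ltW x0).
  suff nr : \near x, (cst 0 : R^o -> R^o) x = flat p x.
    by apply: (near_eq_is_derive nr); exact: is_derive_cst.
  near=> z; rewrite /flat /= ltNge ltW//.
  by near: z; exact: lt_nbhsl.
(* At the junction point the quadratic bound makes the difference quotient of order [|h|]. *)
- have [C HC] := flat_bound p.
  rewrite {2}/flat ltxx.
  suff cv : h^-1 *: ((flat p \o shift 0) (h *: (1:R)) - flat p 0)
      @[h --> 0^'] --> (0:R).
    by apply: DeriveDef; [apply/cvg_ex; exists 0|exact: cvg_lim].
  apply/cvgr0Pnorm_le => e e0.
  have C0 : 0 <= C by have := HC 1; rewrite normr1 expr1n mulr1; exact: le_trans.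
  have C1 : 0 < C + 1 by rewrite ltr_wpDl.
  near=> h.
  have h0 : h != 0 by near: h; exact: nbhs_dnbhs_neq.
  rewrite /= [flat p 0]/flat ltxx subr0 /shift /= addr0 normrZ normfV.
  rewrite -[h *: 1]/(h * 1) mulr1.
  rewrite ler_pdivrMl ?normr_gt0// (le_trans (HC h))//.
  rewrite expr2 mulrA [leRHS]mulrC ler_wpM2r//.
  apply: (@le_trans _ _ ((C + 1) * `|h|)); first by rewrite ler_wpM2r// lerDl.
  rewrite -ler_pdivlMl// mulrC; near: h; apply: dnbhs0_le.
  by rewrite divr_gt0.
Unshelve. all: by end_near. Qed.

Lemma derive_along (f : R^o -> R^o) (x v d : R) :
  is_derive (x : R^o) (1 : R^o) f d -> is_derive (x : R^o) (v : R^o) f (v * d).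
Proof.
move=> df.
have dif : differentiable f (x : R^o) by apply/derivable1_diffP; case: df.
apply: DeriveDef; first exact: diff_derivable.
rewrite deriveE// -[v in LHS]mulr1 -[v * 1]/(v *: (1 : R^o)) linearZ /=.
by rewrite -deriveE//; case: df => _ ->.
Qed.

Lemma flatZ p (c x : R) : flat (c *: p) x = c * flat p x.
Proof. by rewrite /flat; case: ifP; rewrite ?mulr0// hornerZ mulrA. Qed.

Lemma flat_smooth p k : Ck k (flat p : R^o -> R^o).
Proof.
apply: (@Ck_of_class R R^o [set f | exists p, f = flat p]); last by exists p.
move=> f [q ->]; split.
  move=> x; apply: differentiable_continuous; apply/derivable1_diffP.
  by case: (is_derive_flat q x).
move=> v; split.
  by move=> x; case: (derive_along v (is_derive_flat q x)).
exists (v *: flat_deriv q); apply/funext => x; rewrite flatZ.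
by case: (derive_along v (is_derive_flat q x)).
Qed.

End flat.

Section continuous_fct.
Context {R : realType} {X : topologicalType}.
Implicit Types f g : X -> R.

Lemma continuous_fctD f g : continuous f -> continuous g ->
  continuous (fun x => f x + g x).
Proof. by move=> cf cg x; apply: (@continuousD R R X f g x); [exact: cf|exact: cg]. Qed.

Lemma continuous_fctB f g : continuous f -> continuous g ->
  continuous (fun x => f x - g x).
Proof. by move=> cf cg x; apply: (@continuousB R R X f g x); [exact: cf|exact: cg]. Qed.

Lemma continuous_fctM f g : continuous f -> continuous g ->
  continuous (fun x => f x * g x).
Proof. by move=> cf cg x; apply: (@continuousM R X f g x); [exact: cf|exact: cg]. Qed.

Lemma continuous_fctC (c : R) : continuous (fun _ : X => c).
Proof. exact: cst_continuous. Qed.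

End continuous_fct.

(** * Derivatives and integrals on the real line *)

Section calculus.
Context {R : realType}.
Local Notation mu := (@lebesgue_measure R).
Implicit Types (f g F : R -> R) (a b x : R).

Lemma is_derive_continuous F x d : is_derive x (1 : R) F d ->
  {for x, continuous F}.
Proof.
by move=> [dF _]; apply: differentiable_continuous; exact/derivable1_diffP.
Qed.

Lemma is_derive_add f g x df dg : is_derive x (1 : R) f df ->
  is_derive x (1 : R) g dg -> is_derive x (1 : R) (fun t => f t + g t) (df + dg).
Proof. by move=> hf hg; exact: (@is_deriveD R R R f g x 1 df dg hf hg). Qed.

Lemma is_derive_sub f g x df dg : is_derive x (1 : R) f df ->
  is_derive x (1 : R) g dg -> is_derive x (1 : R) (fun t => f t - g t) (df - dg).
Proof. by move=> hf hg; exact: (@is_deriveB R R R f g x 1 df dg hf hg). Qed.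

Lemma is_derive_mul f g x df dg : is_derive x (1 : R) f df ->
  is_derive x (1 : R) g dg ->
  is_derive x (1 : R) (fun t => f t * g t) (df * g x + f x * dg).
Proof.
move=> hf hg; have := @is_deriveM R R f g x 1 df dg hf hg.
by rewrite /GRing.scale/= addrC (mulrC (g x)).
Qed.

Lemma is_derive_scale (c : R) f x df : is_derive x (1 : R) f df ->
  is_derive x (1 : R) (fun t => c * f t) (c * df).
Proof. by move=> hf; exact: (@is_deriveZ R R R f c x 1 df hf). Qed.

Lemma continuous_integrable_cc f a b :
  {within `[a, b], continuous f} -> mu.-integrable `[a, b] (EFin \o f).
Proof. by move=> cf; apply: continuous_compact_integrable => //; exact: segment_compact. Qed.

Lemma is_derive_primitive g a x : continuous g -> a < x ->
  is_derive x (1 : R) (fun t => \int[mu]_(s in `[a, t]) g s)%R (g x).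
Proof.
move=> cg ax.
have xu : x < x + 1 by rewrite ltrDl.
have ig : mu.-integrable `[a, x + 1] (EFin \o g).
  by apply: continuous_integrable_cc; exact: continuous_subspaceT.
have [d1 d2] := @continuous_FTC1_closed R g a x (x + 1) xu ig ax (cg x).
by apply: DeriveDef => //; rewrite -derive1E d2.
Qed.

Lemma Rintegral_derive f F a b : a <= b ->
  {within `[a, b], continuous f} ->
  (forall x, a <= x <= b -> is_derive x (1 : R) F (f x)) ->
  (\int[mu]_(x in `[a, b]) f x)%R = F b - F a.
Proof.
rewrite le_eqVlt => /predU1P[->|ab] cf dF.
  by rewrite set_itv1 Rintegral_set1 subrr.
rewrite /Rintegral (continuous_FTC2 (F := F))//.
- split.
  + by move=> x /[!in_itv]/= /andP[ax xb]; case: (dF x); rewrite ?ltW.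
  + apply: cvg_at_right_filter; apply: is_derive_continuous (dF a _).
    by rewrite lexx ltW.
  + apply: cvg_at_left_filter; apply: is_derive_continuous (dF b _).
    by rewrite lexx ltW.
- move=> x /[!in_itv]/= /andP[ax xb]; rewrite derive1E.
  by case: (dF x); rewrite ?ltW.
Qed.

Lemma Rintegral_oo_cc f a b : {within `[a, b], continuous f} ->
  (\int[mu]_(x in `]a, b[) f x)%R = (\int[mu]_(x in `[a, b]) f x)%R.
Proof.
move=> /continuous_integrable_cc fi.
rewrite -Rintegral_itv_obnd_cbnd; last first.
  by apply: integrableS fi => //; apply: subset_itvr; rewrite bnd_simp.
rewrite Rintegral_itv_bndo_bndc//.
by apply: integrableS fi => //; apply: subset_itv; rewrite bnd_simp.
Qed.

End calculus.

(** * Smooth transition functions *)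

Section smooth_step.
Context {R : realType}.

Lemma smooth_continuous (f : R^o -> R^o) : (forall k, Ck k f) -> continuous f.
Proof. by move=> /(_ 0%N). Qed.

Lemma smooth_derive (f : R^o -> R^o) : (forall k, Ck k f) ->
  forall x, is_derive (x : R^o) (1 : R^o) f ('D_1 f x).
Proof.
by move=> /(_ 1%N) [_ /(_ 1) [df _]] x; apply: DeriveDef.
Qed.

Lemma smoothD1 (f : R^o -> R^o) : (forall k, Ck k f) -> forall k, Ck k ('D_1 f).
Proof. by move=> sf k; have [_ /(_ 1)[]] := sf k.+1. Qed.

(** [lam] is the linear part of the affine map [l]. Along [v], the difference quotients of the
    composite are those of [g] along [lam v], so composites with smooth [g] form a class closed
    under differentiation. *)
Lemma Ck_comp_affine (V : normedModType R) (l lam : V -> R^o) (g : R^o -> R^o) :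
  continuous l -> (forall (h : R) (v x : V), l (h *: v + x) = h * lam v + l x) ->
  (forall k, Ck k g) -> forall k, Ck k (fun x => g (l x)).
Proof.
move=> cl ll sg.
apply: (@Ck_of_class R V [set f | exists2 g : R^o -> R^o, (forall k, Ck k g) &
   f = fun x => g (l x)]); last by exists g.
move=> f [{}g {}sg ->]; split.
  move=> x; apply: (@continuous_comp _ _ _ l g x); first exact: cl.
  exact: (smooth_continuous sg).
have E v x : (fun h => h^-1 *: ((g \o l \o shift x) (h *: v) - (g \o l) x)) =
    (fun h => h^-1 *: ((g \o shift (l x)) (h *: (lam v : R^o)) - g (l x))).
  by apply/funext => h /=; rewrite ll.
move=> v; split.
  move=> x; rewrite /derivable (E v x).
  by have [_ /(_ (lam v))[+ _]] := sg 1%N; exact.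
exists ('D_(lam v) g).
  by move=> k; have [_ /(_ (lam v))[]] := sg k.+1.
by apply/funext => x; rewrite /derive (E v x).
Qed.

Lemma CkV k (V : normedModType R) (f : V -> R^o) : (forall x, f x != 0) ->
  Ck k f -> Ck k (fun x => (f x)^-1 : R^o).
Proof.
move=> f0; elim: k => [|k IH].
  move=> cf x; apply: (@continuousV _ _ (f : V -> R) x); first exact: f0.
  exact: cf.
move=> Cf; have [cf df] := Cf; split.
  move=> x; apply: (@continuousV _ _ (f : V -> R) x); first exact: f0.
  exact: cf.
move=> v; have [df1 df2] := df v; split.
  by move=> x; exact: (@derivableV _ _ f x v).
have Cfi := IH (CkS Cf).
rewrite (_ : 'D_v _ =
    fun x => (-1 * ((f x)^-1 * (f x)^-1 : R^o) : R^o) * 'D_v f x : R^o).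
  by apply: CkM => //; apply: CkZ; exact: CkM.
apply/funext => x; rewrite (@deriveV _ _ f x v)//.
by rewrite mulN1r -expr2 exprVn.
Qed.

Implicit Types (x : R).

Lemma flat1_ge0 x : 0 <= flat 1 x.
Proof. by rewrite /flat; case: ifP; rewrite // hornerC mul1r expR_ge0. Qed.

Lemma flat1_gt0 x : (0 < flat 1 x) = (0 < x).
Proof.
by rewrite /flat; case: ifP => x0; rewrite ?ltxx// hornerC mul1r expR_gt0.
Qed.

Lemma flat1_le1 x : flat 1 x <= 1.
Proof.
rewrite /flat; case: ifP => // x0; rewrite hornerC mul1r -(expR0 R) ler_expR.
by rewrite oppr_le0 invr_ge0 ltW.
Qed.

(** The usual smooth passage from 0 to 1 across [[0, 1]]; the denominator is positive because [x]
    and [1 - x] are never both nonpositive. *)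
Definition step x : R := flat 1 x / (flat 1 x + flat 1 (1 - x)).

Lemma step_denom_gt0 x : 0 < flat 1 x + flat 1 (1 - x).
Proof.
have [x0|x0] := ltP 0 x.
  by rewrite ltr_wpDr ?flat1_ge0// flat1_gt0.
by rewrite ltr_wpDl ?flat1_ge0// flat1_gt0; lra.
Qed.

Lemma step_le0 x : x <= 0 -> step x = 0.
Proof. by move=> x0; rewrite /step /flat ltNge x0/= mul0r. Qed.

Lemma step_ge1 x : 1 <= x -> step x = 1.
Proof.
move=> x1; have := step_denom_gt0 x.
have f0 : flat 1 (1 - x) = 0 by rewrite /flat ltNge subr_le0 x1.
rewrite /step f0 addr0.
by move=> p; rewrite divff// gt_eqF.
Qed.

Lemma step_smooth k : Ck k (step : R^o -> R^o).
Proof.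
have fs : forall k, Ck k (fun x : R^o => flat 1 (1 - x) : R^o).
  apply: (@Ck_comp_affine R^o (fun x => 1 - x) (fun v => - v)).
  - by move=> x; apply: continuousB; [exact: cst_continuous|].
  - by move=> h v x; rewrite -[h *: v]/(h * v); ring.
  - exact: flat_smooth.
apply: CkM; first exact: flat_smooth.
apply: (@CkV k R^o (fun x => flat 1 x + flat 1 (1 - x) : R^o)).
  by move=> x; rewrite gt_eqF// step_denom_gt0.
by apply: CkD; [exact: flat_smooth|exact: fs].
Qed.

Lemma step_nondecreasing x y : x <= y -> step x <= step y.
Proof.
have mono (u w : R) : u <= w -> flat 1 u <= flat 1 w.
  move=> uw; rewrite /flat; case: ifP => u0; last first.
    by case: ifP => // _; rewrite hornerC mul1r expR_ge0.
  rewrite (lt_le_trans u0 uw) !hornerC !mul1r ler_expR lerN2.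
  by rewrite lef_pV2// posrE (lt_le_trans u0 uw).
move=> xy; rewrite /step ler_pdivrMr ?step_denom_gt0//.
rewrite mulrAC ler_pdivlMr ?step_denom_gt0//.
have := mono _ _ xy; have : flat 1 (1 - y) <= flat 1 (1 - x) by apply: mono; lra.
have := flat1_ge0 x; have := flat1_ge0 y.
have := flat1_ge0 (1 - x); have := flat1_ge0 (1 - y).
set p := flat 1 x; set q := flat 1 y; set r := flat 1 (1 - x); set s := flat 1 (1 - y).
nra.
Qed.

End smooth_step.

(** * The lemma of du Bois-Reymond *)

Section ramp.
Context {R : realType}.
Local Notation mu := (@lebesgue_measure R).
Variable d : R.
Hypothesis d0 : 0 < d.

Definition ramp (a x : R) : R := step ((x - a) / d).

Lemma ramp_smooth a k : Ck k (ramp a : R^o -> R^o).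
Proof.
apply: (@Ck_comp_affine R R^o (fun x => (x - a) / d) (fun v => v / d)).
- move=> x; apply: (@continuousM R R (fun x => x - a) (cst d^-1) x).
    by apply: continuousB; [|exact: cst_continuous].
  exact: cst_continuous.
- by move=> h v x; rewrite -[h *: v]/(h * v); field; rewrite gt_eqF.
- exact: step_smooth.
Qed.

Lemma ramp_le a x : x <= a -> ramp a x = 0.
Proof. by move=> xa; rewrite /ramp step_le0// pmulr_lle0 ?invr_gt0// subr_le0. Qed.

Lemma ramp_ge a x : a + d <= x -> ramp a x = 1.
Proof. by move=> xa; rewrite /ramp step_ge1// ler_pdivlMr// mul1r lerBrDl. Qed.

(** A mollifier: nonnegative, supported in [[a, a + d]], of mass 1. Obtaining it as the derivative
    of a ramp makes the difference of two such kernels the derivative of a test function. *)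
Definition dramp a : R -> R := 'D_1 (ramp a : R^o -> R^o).

Lemma is_derive_ramp (a x : R) : is_derive x (1 : R) (ramp a) (dramp a x).
Proof. exact: (smooth_derive (ramp_smooth a)). Qed.

Lemma dramp_continuous a : continuous (dramp a).
Proof. exact/smooth_continuous/smoothD1/ramp_smooth. Qed.

Lemma dramp_ge0 (a x : R) : 0 <= dramp a x.
Proof.
have [dx _] := is_derive_ramp a x.
have mono (u w : R) : u <= w -> ramp a u <= ramp a w.
  move=> uw; apply: step_nondecreasing.
  by rewrite ler_pM2r ?invr_gt0// lerB.
apply: limr_ge; first exact: dx.
near=> h => /=; rewrite /GRing.scale /= mulr1.
have [h0|h0|->] := ltrgt0P h; last by rewrite invr0 mul0r.
- by rewrite mulr_ge0// ?invr_ge0 ?(ltW h0)// subr_ge0 mono// lerDr ltW.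
- by rewrite mulr_le0// ?invr_le0 ?(ltW h0)// subr_le0 mono// gerDr ltW.
Unshelve. all: by end_near. Qed.

Lemma dramp0 (a x : R) : (x < a) || (a + d < x) -> dramp a x = 0.
Proof.
move=> /orP h.
suff [c nc] : exists c : R, \near x, (cst c : R^o -> R^o) x = ramp a x.
  by rewrite /dramp -(@near_eq_derive R R^o R^o _ _ _ 1 nc) derive_cst.
case: h => [xa|xa].
  by exists 0; near=> y; rewrite ramp_le//=; apply: ltW; near: y; exact: lt_nbhsl.
by exists 1; near=> y; rewrite ramp_ge//=; apply: ltW; near: y; exact: lt_nbhsr.
Unshelve. all: by end_near. Qed.

Lemma Rintegral_dramp T a : 0 < a -> a + d < T ->
  (\int[mu]_(x in `[0%R, T]) dramp a x)%R = 1.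
Proof.
move=> a0 aT; have T0 : 0 <= T by rewrite ltW// (lt_trans _ aT)// addr_gt0.
have cd := continuous_subspaceT (@dramp_continuous a) (A := `[0%R, T]).
rewrite (Rintegral_derive T0 cd (fun x _ => is_derive_ramp a x)).
by rewrite ramp_ge ?ltW// ramp_le ?ltW// subr0.
Qed.

Lemma testfun_rampB T a b : 0 < a -> a < b -> b + d < T ->
  testfun `]0%R, T[%classic (fun x => ramp a x - ramp b x : R^o).
Proof.
move=> a0 ab bT; split.
  move=> k; rewrite (_ : (fun x => _) = fun x : R^o => ramp a x + -1 * ramp b x : R^o).
    apply: CkD; first exact: ramp_smooth.
    by apply: CkZ; exact: ramp_smooth.
  by apply/funext => x; rewrite mulN1r.
exists `[a, b + d]%classic.
  split; first exact: segment_compact.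
  by move=> x /=; rewrite !in_itv/= => /andP[? ?]; apply/andP; split; lra.
move=> x /=; rewrite in_itv/= => /negP; rewrite negb_and -!ltNge => /orP[xa|xb].
  by rewrite !ramp_le ?subrr// ltW// (lt_trans xa).
rewrite !ramp_ge ?subrr//; first exact: ltW.
by apply: ltW; apply: lt_trans xb; rewrite ltrD2r.
Qed.

End ramp.

Section du_bois_reymond.
Context {R : realType}.
Local Notation mu := (@lebesgue_measure R).
Implicit Types (f g F : R -> R) (a b x : R).

Lemma continuous_integrable_ccT f a b : continuous f ->
  mu.-integrable `[a, b] (EFin \o f).
Proof.
by move=> cf; apply: continuous_integrable_cc; exact: continuous_subspaceT.
Qed.

Lemma continuous_integrable_ooT f a b : continuous f ->
  mu.-integrable `]a, b[ (EFin \o f).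
Proof.
move=> cf; apply: integrableS (continuous_integrable_ccT a b cf) => //.
by apply: subset_itv; rewrite bnd_simp.
Qed.

Lemma le_Rintegral_cc f g a b : continuous f -> continuous g ->
  (forall x, a <= x <= b -> f x <= g x) ->
  (\int[mu]_(x in `[a, b]) f x <= \int[mu]_(x in `[a, b]) g x)%R.
Proof.
move=> cf cg fg; apply: le_Rintegral => //; exact: continuous_integrable_ccT.
Qed.

Lemma Rintegral_ccB f g a b : continuous f -> continuous g ->
  (\int[mu]_(x in `[a, b]) (f x - g x) =
   \int[mu]_(x in `[a, b]) f x - \int[mu]_(x in `[a, b]) g x)%R.
Proof. by move=> cf cg; apply: RintegralB => //; exact: continuous_integrable_ccT. Qed.

Lemma Rintegral_ccZ f c a b : continuous f ->
  (\int[mu]_(x in `[a, b]) (c * f x) = c * \int[mu]_(x in `[a, b]) f x)%R.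
Proof. by move=> cf; apply: RintegralZl => //; exact: continuous_integrable_ccT. Qed.

Lemma Rintegral_ooB f g a b : continuous f -> continuous g ->
  (\int[mu]_(x in `]a, b[) (f x - g x) =
   \int[mu]_(x in `]a, b[) f x - \int[mu]_(x in `]a, b[) g x)%R.
Proof. by move=> cf cg; apply: RintegralB => //; exact: continuous_integrable_ooT. Qed.

Lemma Rintegral_ooD f g a b : continuous f -> continuous g ->
  (\int[mu]_(x in `]a, b[) (f x + g x) =
   \int[mu]_(x in `]a, b[) f x + \int[mu]_(x in `]a, b[) g x)%R.
Proof. by move=> cf cg; apply: RintegralD => //; exact: continuous_integrable_ooT. Qed.

Lemma Rintegral_ooZ f c a b : continuous f ->
  (\int[mu]_(x in `]a, b[) (c * f x) = c * \int[mu]_(x in `]a, b[) f x)%R.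
Proof. by move=> cf; apply: RintegralZl => //; exact: continuous_integrable_ooT. Qed.

(** Tested against a difference of two ramps, a vanishing weak derivative says that the mollified
    values of [f] at [a] and [b] coincide. *)
Lemma weak_dt_ramp T f a b d : continuous f ->
  0 < d -> 0 < a -> a < b -> b + d < T ->
  (forall psi : R^o -> R^o, testfun `]0%R, T[%classic psi ->
    (\int[mu]_(t in `]0%R, T[) (f t * derive1 psi t))%R = 0) ->
  (\int[mu]_(t in `[0%R, T]) (f t * dramp d a t))%R =
  (\int[mu]_(t in `[0%R, T]) (f t * dramp d b t))%R.
Proof.
move=> cf d0 a0 ab bT /(_ _ (testfun_rampB d0 a0 ab bT)).
have cfa c : continuous (fun t => f t * dramp d c t).
  exact/continuous_fctM/dramp_continuous.
have -> : (fun t => f t * derive1 (fun x => ramp d a x - ramp d b x : R^o) t) =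
   (fun t => f t * dramp d a t - f t * dramp d b t).
  apply/funext => t; rewrite derive1E.
  have := is_deriveB (is_derive_ramp d0 a t) (is_derive_ramp d0 b t).
  by move=> [_ ->]; rewrite mulrBr.
rewrite Rintegral_oo_cc; last first.
  by apply: continuous_subspaceT; exact: continuous_fctB.
rewrite (Rintegral_ccB _ _ (cfa a) (cfa b)).
by move/eqP; rewrite subr_eq0 => /eqP.
Qed.

Lemma weak_dt0_const T f a b : continuous f -> 0 < a -> a < b -> b < T ->
  (forall psi : R^o -> R^o, testfun `]0%R, T[%classic psi ->
    (\int[mu]_(t in `]0%R, T[) (f t * derive1 psi t))%R = 0) ->
  f a = f b.
Proof.
wlog fab : f / f a < f b.
  move=> H cf a0 ab bT ht; have [lt|gt|//] := ltgtP (f a) (f b); first exact: H.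
  apply: oppr_inj; apply: (H (fun x => - f x)) => //; first by rewrite ltrN2.
    by move=> x; apply: continuousN; exact: cf.
  move=> psi tpsi.
  have [spsi _] := tpsi.
  rewrite (_ : (fun t => _) = (fun t => -1 * (f t * derive1 psi t))); last first.
    by apply/funext => t; rewrite mulrA mulN1r.
    have cc : continuous (fun t => f t * derive1 psi t).
    apply: continuous_fctM => //.
    rewrite (_ : derive1 psi = 'D_1 psi); last by apply/funext => y; rewrite derive1E.
    exact: (smooth_continuous (smoothD1 spsi)).
  by rewrite (Rintegral_ooZ _ _ _ cc) ht// mulr0.
move=> cf a0 ab bT ht; exfalso.
(* Two levels strictly between [f a] and [f b]: a sufficiently concentrated average at [a] stays
   below [c1], one at [b] above [c2], although both averages are equal. *)
pose c1 := (2 * f a + f b) / 3; pose c2 := (f a + 2 * f b) / 3.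
have [/= fac1 c12 c2fb] : [/\ f a < c1, c1 < c2 & c2 < f b].
  by rewrite /c1 /c2; split; lra.
have : \forall e \near 0^'+, (forall x, a <= x <= a + e -> f x <= c1) /\
    (forall x, b <= x <= b + e -> c2 <= f x) /\ (b + e < T).
  have na : \forall x \near a, f x <= c1 by have /cvgr_le := cf a; apply.
  have nb : \forall x \near b, c2 <= f x by have /cvgr_ge := cf b; apply.
  move: na nb => /nbhs_ballP[e1 /= e10 He1] /nbhs_ballP[e2 /= e20 He2].
  near=> e; split; [|split].
  - move=> x /andP[ax xa]; apply: He1; rewrite /ball/=.
    rewrite ler0_norm ?subr_le0// opprB ltrBlDl (le_lt_trans xa)// ltrD2l.
    by near: e; exact: nbhs_right_lt.
  - move=> x /andP[ax xa]; apply: He2; rewrite /ball/=.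
    rewrite ler0_norm ?subr_le0// opprB ltrBlDl (le_lt_trans xa)// ltrD2l.
    by near: e; exact: nbhs_right_lt.
  - by rewrite -ltrBrDl; near: e; apply: nbhs_right_lt; rewrite subr_gt0.
move=> H; near (0:R)^'+ => d.
have d0 : 0 < d by [].
have [ha [hb bdT]] : (forall x, a <= x <= a + d -> f x <= c1) /\
    (forall x, b <= x <= b + d -> c2 <= f x) /\ (b + d < T) by near: d.
have := weak_dt_ramp cf d0 a0 ab bdT ht.
have le1 : (\int[mu]_(t in `[0%R, T]) (f t * dramp d a t) <= c1)%R.
  rewrite -[leRHS]mulr1 -(Rintegral_dramp d0 a0 (T := T)); last first.
    by apply: lt_trans bdT; rewrite ltrD2r.
  rewrite -(Rintegral_ccZ _ _ _ (@dramp_continuous R d d0 _)).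
  apply: le_Rintegral_cc.
  - exact/continuous_fctM/dramp_continuous.
  - by apply: continuous_fctM; [exact: continuous_fctC|exact: dramp_continuous].
  - move=> x _; have [xa|ax] := ltP x a; first by rewrite dramp0 ?xa// !mulr0.
    have [xd|dx] := ltP (a + d) x; first by rewrite dramp0 ?xd ?orbT// !mulr0.
    by rewrite ler_wpM2r ?dramp_ge0// ha// ax dx.
have le2 : (c2 <= \int[mu]_(t in `[0%R, T]) (f t * dramp d b t))%R.
  rewrite -[leLHS]mulr1 -(Rintegral_dramp d0 (lt_trans a0 ab) bdT).
  rewrite -(Rintegral_ccZ _ _ _ (@dramp_continuous R d d0 _)).
  apply: le_Rintegral_cc.
  - by apply: continuous_fctM; [exact: continuous_fctC|exact: dramp_continuous].
  - exact/continuous_fctM/dramp_continuous.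
  - move=> x _; have [xa|ax] := ltP x b; first by rewrite dramp0 ?xa// !mulr0.
    have [xd|dx] := ltP (b + d) x; first by rewrite dramp0 ?xd ?orbT// !mulr0.
    by rewrite ler_wpM2r ?dramp_ge0// hb// ax dx.
by move=> E; move: le2; rewrite -E => /le_trans /(_ le1); rewrite leNgt c12.
Unshelve. all: by end_near. Qed.

(** Subtracting a primitive of [g] from [f] leaves a continuous function with zero weak derivative,
    hence a constant. *)
Lemma weak_dt_is_derive T f g : continuous f -> continuous g -> weak_dt T f g ->
  forall x, 0 < x < T -> is_derive x (1 : R) f (g x).
Proof.
move=> cf cg fg x /andP[x0 xT].
pose G (t : R) := (\int[mu]_(s in `[(-1)%R, t]) g s)%R.
have dG (t : R) : -1 < t -> is_derive t (1 : R) G (g t) by exact: is_derive_primitive.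
(* The primitive is only differentiable on the right of -1; freeze it at 0. *)
pose H (t : R) := G (Num.max 0 t).
have cH : continuous H.
  move=> t; apply: (@continuous_comp R R R (fun t => Num.max 0 t) G t).
    by apply: (@continuous_max R R (cst 0) id); [exact: cst_continuous|].
  apply: is_derive_continuous; apply: dG.
  by rewrite (@lt_le_trans _ _ 0)// ?ltrN10// le_max lexx.
have dH (t : R) : 0 < t -> is_derive t (1 : R) H (g t).
  move=> t0; have := dG t (lt_trans (ltrN10 R) t0).
  apply: near_eq_is_derive; near=> s.
  rewrite /H (@max_idPr _ _ 0 s _)//.
  by apply: ltW; near: s; exact: lt_nbhsr.
pose k (t : R) := f t - H t.
have ck : continuous k by exact: continuous_fctB.
have kx0 psi : testfun `]0%R, T[%classic psi ->
    (\int[mu]_(t in `]0%R, T[) (k t * derive1 psi t))%R = 0.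
  move=> tpsi; have [spsi [K [cK KT] psi0]] := tpsi.
  have dpsi : derive1 psi = 'D_1 psi by apply/funext => y; rewrite derive1E.
  have cdpsi : continuous (derive1 psi).
    by rewrite dpsi; exact: (smooth_continuous (smoothD1 spsi)).
  have cpsi : continuous psi by exact: smooth_continuous.
  have cfp (h q : R -> R) : continuous h -> continuous q -> continuous (fun t => h t * q t).
    exact: continuous_fctM.
  have psi00 : psi 0 = 0 by apply: psi0 => /KT /=; rewrite in_itv/= ltxx.
  have psiT : psi T = 0 by apply: psi0 => /KT /=; rewrite in_itv/= ltxx andbF.
  have E1 := fg _ tpsi.
  have E2 : (\int[mu]_(t in `]0%R, T[) (H t * derive1 psi t))%R =
      - (\int[mu]_(t in `]0%R, T[) (g t * psi t))%R.
    apply/eqP; rewrite -addr_eq0 -(Rintegral_ooD _ _ (cfp _ _ cH cdpsi) (cfp _ _ cg cpsi)).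
    have cs : {within `[0%R, T], continuous (fun t => H t * derive1 psi t + g t * psi t)}.
      apply: continuous_subspaceT.
      by apply: continuous_fctD; exact: cfp.
    rewrite Rintegral_oo_cc//.
    (* [H * psi] is C^1 on R: where [H] is not differentiable, [psi] vanishes. *)
    have dGp (t : R) : 0 <= t <= T -> is_derive t (1 : R) (fun t => G t * psi t)
        (H t * derive1 psi t + g t * psi t).
      move=> /andP[t0 tT].
      have := is_deriveM (dG t (lt_le_trans (ltrN10 R) t0)) (smooth_derive spsi t).
      move=> h; apply: is_derive_eq.
      by rewrite dpsi /H (max_idPr _)// -[psi t *: g t]/(psi t * g t) (mulrC (psi t)).
    have T0 : 0 <= T by rewrite ltW// (lt_trans x0).
    by rewrite (Rintegral_derive T0 cs dGp) psi00 psiT !mulr0 subrr.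
  rewrite (_ : (fun t => _) =
      (fun t => f t * derive1 psi t - H t * derive1 psi t)); last first.
    by apply/funext => t; rewrite /k mulrBl.
  by rewrite (Rintegral_ooB _ _ (cfp _ _ cf cdpsi) (cfp _ _ cH cdpsi)) E1 E2 subrr.
have kc (y : R) : 0 < y < T -> k y = k x.
  move=> /andP[y0 yT]; have [xy|yx|->//] := ltgtP x y.
    by apply/esym; exact: (weak_dt0_const ck x0 xy yT).
  exact: (weak_dt0_const ck y0 yx xT).
have := @is_deriveD _ _ _ H (cst (k x)) x 1 (g x) 0 (dH x x0) (is_derive_cst _ _ _).
rewrite addr0; apply: near_eq_is_derive; near=> y.
rewrite /GRing.add/= -(kc y) /k; first by rewrite addrC subrK.
by apply/andP; split; near: y; [exact: lt_nbhsr|exact: lt_nbhsl].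
Unshelve. all: by end_near. Qed.

End du_bois_reymond.

(** * Lebesgue measure on R^n *)

Section restricted_measure.
Context d (T : measurableType d) (R : realType) (mu : {measure set T -> \bar R}).
Variables (D : set T) (mD : measurable D).

(** [mu] is the sum of its restrictions to [D] and to the complement; the second one lives where [f]
    vanishes. *)
Lemma ge0_integral_mrestr (f : T -> \bar R) : measurable_fun setT f ->
  (forall x, 0 <= f x)%E -> (forall x, ~ D x -> f x = 0%E) ->
  (\int[mrestr mu mD]_x f x = \int[mu]_x f x)%E.
Proof.
move=> mf f0 fD.
have mDc := measurableC mD.
rewrite [RHS](@eq_measure_integral _ _ _ _ (measure_add (mrestr mu mD) (mrestr mu mDc)) mu).
  rewrite ge0_integral_measure_add//.
  rewrite [X in (_ + X)%E](ge0_negligible_integral mD)//.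
    rewrite [X in (_ + X)%E]integral0_eq ?adde0// => x [_ Dx].
    exact: fD.
  by rewrite /= /mrestr setICr measure0.
move=> A mA _; apply: (etrans _ (esym (measure_addE _ _ _))).
rewrite /= /mrestr.
rewrite -measureU//; [|exact: measurableI..|].
  by rewrite -setIUr setUv setIT.
by rewrite setIACA setICr setI0.
Qed.

Lemma integral_mrestr (f : T -> \bar R) : measurable_fun setT f ->
  (forall x, ~ D x -> f x = 0%E) ->
  (\int[mrestr mu mD]_x f x = \int[mu]_x f x)%E.
Proof.
move=> mf fD; rewrite [LHS]integralE [RHS]integralE !ge0_integral_mrestr//.
- exact: measurable_funeneg.
- by move=> x Dx; rewrite funenegE fD// oppe0 maxxx.
- exact: measurable_funepos.
- by move=> x Dx; rewrite funeposE fD// maxxx.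
Qed.

End restricted_measure.

(** * Boxes and lines in spaces of tuples *)

Section tuple_measure.
Variable R : realType.
Local Notation mR := (measurableTypeR R).
Local Notation leb := (@lebesgue_measure R).

Definition tuple_box n (M : R) : set (n.-tuple mR) :=
  \bigcap_(j in [set: 'I_n]) ((fun t : n.-tuple mR => tnth t j) @^-1` `[- M, M]).

Lemma measurable_tuple_box n M : measurable (@tuple_box n M).
Proof.
apply: fin_bigcap_measurable => [|j _]; first exact: finite_finset.
by rewrite -[X in measurable X]setTI; apply: measurable_tnth.
Qed.

Lemma tuple_boxS n M : @tcons R n @^-1` (@tuple_box n.+1 M) =
  `[- M, M]%classic `*` @tuple_box n M.
Proof.
apply/seteqP; split=> [[a t] /= h|[a t] [/= ha ht] j _ /=].
  split=> /=; first by have := h ord0 I; rewrite /= tnth0.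
  by move=> j _; have := h (lift ord0 j) I; rewrite /= tnthS.
have [k ->|->] := unliftP ord0 j; first by rewrite tnthS; exact: ht.
by rewrite tnth0.
Qed.

Lemma lebesgue_tuple_box n M : (lebesgue_tuple R n (@tuple_box n M) < +oo)%E.
Proof.
elim: n => [|n IH] /=; first by rewrite /dirac indicE ltry.
rewrite /lebesgue_step /pushforward tuple_boxS.
rewrite product_measure1E//; last exact: measurable_tuple_box.
apply: lte_mul_pinfty => //.
suff : (leb `[(- M)%R, M]%classic \is a fin_num) by [].
by rewrite lebesgue_measure_itv/= lte_fin; case: ifP.
Qed.

End tuple_measure.

Section tuple_line.
Variable R : realType.
Local Notation mR := (measurableTypeR R).
Local Notation leb := (@lebesgue_measure R).

Definition tuple_set n (i : 'I_n) (a : R) (t : n.-tuple mR) : n.-tuple mR :=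
  [tuple if j == i then a else tnth t j | j < n].

(** Fubini, in the order dictated by [i]. If [i] is the first coordinate, it is integrated first;
    otherwise the first coordinate is frozen and the induction hypothesis applies to the tail.
    Boundedness and support in a box provide the integrability. *)
Lemma integral_tuple_line0 n (i : 'I_n) (F : n.-tuple mR -> R) M B :
  measurable_fun setT F -> (forall t, `|F t| <= B) ->
  (forall t, ~ @tuple_box R n M t -> F t = 0) ->
  (forall t, \int[leb]_a (F (tuple_set i a t))%:E = 0)%E ->
  (\int[lebesgue_tuple R n]_t (F t)%:E = 0)%E.
Proof.
elim: n i F => [[]//|n IH] i F mF FB F0 Fi.
have mFc : measurable_fun setT (F \o @tcons R n).
  by apply: measurableT_comp => //; exact: measurable_tcons.
have box_finite : ((leb \x lebesgue_tuple R n) (@tcons R n @^-1` (@tuple_box R n.+1 M)) < +oo)%E.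
  exact: (lebesgue_tuple_box n.+1 M).
have mbox : measurable (@tcons R n @^-1` (@tuple_box R n.+1 M)).
  by rewrite -[X in measurable X]setTI; apply: measurable_tcons => //;
    exact: measurable_tuple_box.
have iF : (leb \x lebesgue_tuple R n)%E.-integrable setT (EFin \o (F \o @tcons R n)).
  apply/(integrable_mkcond _ measurableT).
  rewrite (_ : _ \_ _ = (EFin \o (F \o @tcons R n)) \_ (@tcons R n @^-1` (@tuple_box R n.+1 M))).
    apply/(integrable_mkcond _ mbox).
    apply: measurable_bounded_integrable => //.
      exact: measurable_funTS.
    exists B; split; first exact: num_real.
    by move=> y By x _ /=; rewrite (le_trans (FB _))// ltW.
  apply/funext => x; rewrite !patchE in_setT; case: ifPn => //.
  by rewrite notin_setE /= => /F0 ->.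
rewrite /= /lebesgue_step integral_pushforward//.
- rewrite preimage_setT.
  have [j ij|i0] := unliftP ord0 i.
    rewrite -(integral12_prod_meas1 iF)/=.
    apply: integral0_eq => a _; rewrite /fubini_F /=.
    apply: (IH j (fun t => F (tcons (a, t)))).
    + apply: measurableT_comp => //; apply: measurableT_comp => //.
      exact: measurable_tcons.
    + by move=> t; exact: FB.
    + move=> t nt; apply: F0 => bt; apply: nt => k _ /=.
      by have := bt (lift ord0 k) I; rewrite /= tnthS.
    + move=> t; rewrite -[RHS](Fi (tcons (a, t))).
      apply: eq_integral => b _; congr (F _)%:E.
      apply: eq_from_tnth => k.
      have [l ->|->] := unliftP ord0 k.
        by rewrite tnthS !tnth_mktuple ij (inj_eq lift_inj) tnthS.
      by rewrite tnth0 tnth_mktuple ij tnth0.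
  rewrite -(integral21_prod_meas1 iF)/=.
  apply: integral0_eq => t _; rewrite /fubini_G /=.
  rewrite -[RHS](Fi (tcons (0, t))).
  apply: eq_integral => b _; congr (F _)%:E.
  apply: eq_from_tnth => k.
  have [l ->|->] := unliftP ord0 k.
    by rewrite tnthS tnth_mktuple i0 tnthS.
  by rewrite tnth0 tnth_mktuple i0 eqxx.
- exact: measurable_tcons.
- exact/measurable_EFinP.
Qed.

End tuple_line.

(** * Integration of test functions over a bounded domain *)

Section euclidean_measure.
Variables (R : realType) (n : nat).
Local Notation leb := (@lebesgue_measure R).
Local Notation borel := (borelRn R n).

Lemma continuous_measurable_Rn (f : 'rV[R]_n -> R) : continuous f ->
  measurable_fun setT (f : borel -> R).
Proof.
move=> /continuousP cf; apply: (measurability _ (RGenOpens.measurableE R)).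
move=> _ [_ [a [b ->] <-]]; rewrite setTI.
by apply: sub_sigma_algebra; exact/cf/interval_open.
Qed.

Lemma is_derive_line (phi : 'rV[R]_n -> R^o) (v x0 : 'rV[R]_n) (a : R) :
  derivable phi (a *: v + x0) v ->
  is_derive a (1 : R) (fun b : R => phi (b *: v + x0) : R) ('D_v phi (a *: v + x0)).
Proof.
move=> dphi.
have E : (fun h : R => h^-1 *: (((fun b : R => phi (b *: v + x0)) \o shift a) (h *: (1 : R)) -
    phi (a *: v + x0))) = (fun h => h^-1 *: ((phi \o shift (a *: v + x0)) (h *: v) -
     phi (a *: v + x0))).
  apply/funext => h /=; congr (_ *: (phi _ - _)).
  by rewrite -[h *: 1]/(h * 1) mulr1 addrA -scalerDl.
by apply: DeriveDef; [rewrite /derivable E|rewrite /derive E].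
Qed.

Variable Omega : smooth_domain R n.
Local Notation mu := (lebesgue_domain Omega).
Local Notation D := (domain_set Omega).

Lemma domain_box : exists2 M : R, 0 < M &
  forall x, D x -> forall j, `|x ord0 j| <= M.
Proof.
have [M [_ HM]] := domain_bounded Omega.
exists (`|M| + 2); first by rewrite ltr_wpDl.
move=> x Ox j; have xM : `|x| <= `|M| + 1.
  by apply: HM => //; rewrite ltr_pwDr// ler_norm.
have : ball (0 : 'rV[R]_n) (`|M| + 2) x.
  by rewrite mx_norm_ball /ball_/= sub0r normrN (le_lt_trans xM)// ltrD2l ltr1n.
by move=> [_ /(_ ord0 j)]; rewrite mxE /ball/= sub0r normrN => /ltW.
Qed.

Lemma lebesgue_domain_finite : (mu setT < +oo)%E.
Proof.
have [M M0 HM] := domain_box.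
rewrite /lebesgue_domain /= /mrestr setTI /lebesgue_Rn /pushforward.
apply: (@le_lt_trans _ _ (lebesgue_tuple R n (@tuple_box R n M))); last exact: lebesgue_tuple_box.
apply: le_measure; rewrite ?inE.
- rewrite -[X in measurable X]setTI; apply: measurable_row_of_tuple => //.
  exact: measurable_domain.
- exact: measurable_tuple_box.
- move=> t /= /HM h j _ /=; have := h j.
  by rewrite mxE in_itv/= ler_norml.
Qed.

Lemma testfun_continuous (U : set 'rV[R]_n) phi : testfun U phi -> continuous phi.
Proof. by move=> [/(_ 0%N)]. Qed.

Lemma testfun_bounded (U : set 'rV[R]_n) phi : testfun U phi ->
  exists B : R, forall x, `|phi x : R| <= B.
Proof.
move=> tphi; have cphi := testfun_continuous tphi.
have [_ [K [cK KU] K0]] := tphi.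
have : compact (phi @` K).
  by apply: continuous_compact => //; exact: continuous_subspaceT.
move=> /compact_bounded [M [_ HM]]; exists (`|M| + 1) => x.
have [Kx|/K0 ->] := pselect (K x); last by rewrite normr0 addr_ge0.
by apply: HM; [rewrite ltr_pwDr// ler_norm|exists x].
Qed.

Lemma testfunD1 (U : set 'rV[R]_n) (phi : 'rV[R]_n -> R^o) v :
  testfun U phi -> testfun U ('D_v phi).
Proof.
move=> [sphi [K [cK KU] K0]]; split.
  by move=> k; have [_ /(_ v)[]] := sphi k.+1.
exists K => // x Kx.
have nK : \near x, (cst 0 : 'rV[R]_n -> R^o) x = phi x.
  have oK : open (~` K).
    by apply: closed_openC; apply: compact_closed => //; exact: norm_hausdorff.
  have : nbhs x (~` K) by apply: open_nbhs_nbhs.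
  by apply: filterS => y /K0 ->.
by rewrite -(near_eq_derive v nK) derive_cst.
Qed.

Lemma testfun_derivable (U : set 'rV[R]_n) (phi : 'rV[R]_n -> R^o) v x :
  testfun U phi -> derivable phi x v.
Proof. by move=> [/(_ 1%N)[_ /(_ v)[]]]. Qed.

(** The fundamental theorem of calculus on every line parallel to the [i]-th axis, followed by
    Fubini. Applied to a product, this is integration by parts. *)
Lemma testfun_integral_derive (phi : 'rV[R]_n -> R^o) (i : 'I_n) :
  testfun D phi ->
  (\int[mu]_x ('D_(basis_vec R i) phi x)%:E = 0)%E.
Proof.
move=> tphi; have tD := testfunD1 (basis_vec R i) tphi.
have cD := testfun_continuous tD.
have [B HB] := testfun_bounded tD.
have [M M0 HM] := domain_box.
have zero (psi : 'rV[R]_n -> R^o) x : testfun D psi ->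
    ~ D x -> psi x = 0.
  by move=> [_ [K [_ KU] K0]] nx; apply: K0 => /KU.
have mD := continuous_measurable_Rn cD.
have mDE : measurable_fun setT (fun x : borel => ('D_(basis_vec R i) phi x)%:E).
  exact/measurable_EFinP.
have z0 x : ~ D x -> ('D_(basis_vec R i) phi x)%:E = 0%E by move=> nx; rewrite (zero _ _ tD).
rewrite (integral_mrestr _ _ mDE z0).
have mDr : measurable_fun setT (fun t => 'D_(basis_vec R i) phi (@row_of_tuple R n t)).
  by apply: (measurableT_comp mD); exact: measurable_row_of_tuple.
have out t : ~ tuple_box M t -> 'D_(basis_vec R i) phi (@row_of_tuple R n t) = 0.
  move=> nt; apply: (zero _ _ tD) => /HM h; apply: nt => j _ /=.
  by have := h j; rewrite mxE in_itv/= ler_norml.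
rewrite /lebesgue_Rn integral_pushforward//.
- rewrite preimage_setT.
  apply: (@integral_tuple_line0 R n i (fun t => 'D_(basis_vec R i) phi (@row_of_tuple R n t) : R) M B) => //.
  move=> t; pose x0 : 'rV[R]_n := row_of_tuple (tuple_set i 0 t).
  have E a : row_of_tuple (tuple_set i a t) = a *: basis_vec R i + x0 :> 'rV[R]_n.
    apply/rowP => j; rewrite !mxE !tnth_mktuple.
    by case: (j == i); rewrite ?andbF ?eqxx/= ?mulr1 ?mulr0 ?addr0 ?add0r.
  under eq_integral do rewrite E.
  pose k (a : R) : R := phi (a *: basis_vec R i + x0).
  have dk (a : R) : is_derive a (1 : R) k ('D_(basis_vec R i) phi (a *: basis_vec R i + x0)).
    by apply: is_derive_line; exact: testfun_derivable tphi.
  have cl : continuous (fun a : R => a *: basis_vec R i + x0).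
    move=> a; apply: (@continuousD R _ _ (fun a : R => a *: basis_vec R i) (cst x0) a).
      exact: scalel_continuous.
    exact: cst_continuous.
  have cdk : continuous (fun a : R => 'D_(basis_vec R i) phi (a *: basis_vec R i + x0) : R).
    by move=> a; apply: (@continuous_comp R 'rV[R]_n R _ ('D_(basis_vec R i) phi) a);
      [exact: cl|exact: cD].
  have far (a : R) : ~ (- M <= a <= M) -> ~ D (a *: basis_vec R i + x0).
    move=> na /HM /(_ i); rewrite !mxE tnth_mktuple !eqxx/= mulr1 addr0.
    by rewrite ler_norml => /na.
  (* The endpoints exceed the box of half-width [M] containing the domain, so [phi] vanishes at
     both. *)
  have MM : - (M + 1) <= M + 1 by lra.
  have := Rintegral_derive MM (continuous_subspaceT cdk) (fun a _ => dk a).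
  rewrite /k !(zero _ _ tphi); [|by apply: far; lra..].
  rewrite subrr => R0.
  have i0 : leb.-integrable `[(- (M + 1))%R, (M + 1)%R]
      (fun a => ('D_(basis_vec R i) phi (a *: basis_vec R i + x0))%:E).
    exact: continuous_integrable_ccT cdk.
  transitivity (\int[leb]_(a in `[(- (M + 1))%R, (M + 1)%R])
      ('D_(basis_vec R i) phi (a *: basis_vec R i + x0))%:E)%E; last first.
    rewrite -[LHS]fineK; last exact: integrable_fin_num i0.
    by congr EFin; exact: R0.
  rewrite [RHS]integral_mkcond; apply: eq_integral => a _.
  rewrite patchE; case: ifPn => //; rewrite notin_setE /= in_itv/= => /negP na.
  by rewrite (zero _ _ tD)//; apply: far => aM; apply: (negP na); lra.
- exact: measurable_row_of_tuple.
- rewrite preimage_setT.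
  pose G (t : n.-tuple (measurableTypeR R)) : R := 'D_(basis_vec R i) phi (@row_of_tuple R n t).
  have iG : (lebesgue_tuple R n).-integrable (@tuple_box R n M) (EFin \o G).
    apply: measurable_bounded_integrable => //.
    + exact: measurable_tuple_box.
    + exact: lebesgue_tuple_box.
    + exact: measurable_funTS.
    + exists B; split; first exact: num_real.
      by move=> y By x _ /=; rewrite (le_trans (HB _))// ltW.
  have mb : measurable (@tuple_box R n M) by exact: measurable_tuple_box.
  have := (integrable_mkcond (EFin \o G) mb).1 iG.
  congr (_.-integrable _ _); apply/funext => x; rewrite patchE; case: ifPn => //=.
  by rewrite notin_setE => /out h; rewrite /= h.
Qed.

End euclidean_measure.

(** * Density of test functions in L^2 *)

Section L2_theory.
Context d (T : measurableType d) (R : realType) (mu : {measure set T -> \bar R}).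
Local Notation L2 := (@L2 d T R mu).
Local Notation Lfun2 := (Lfun2 mu).
Local Open Scope quotient_scope.
Implicit Types (h k l : L2) (f g : T -> R).

Definition mkL2 f (fP : f \in Lfun mu 2%:E) : L2 := \pi_(L2) (Lfun_Sub (lee1n 2) fP).

Lemma null_funP (f : Lfun2) : f \in @Defs.null_fun _ _ _ mu <-> \forall x \ae mu, f x = 0.
Proof.
split=> [/asboolP h|h]; first by apply: filterS h => x; exact.
by apply/asboolP; apply: filterS h => x /= -> _.
Qed.

Lemma eq_pi (f g : Lfun2) : \pi_(L2) f = \pi_(L2) g <-> \forall x \ae mu, f x = g x.
Proof.
have -> : (\pi_(L2) f = \pi_(L2) g) <-> (f - g \in @Defs.null_fun _ _ _ mu).
  by rewrite Quotient.idealrBE; split=> [->|/eqP].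
rewrite null_funP; split; apply: filterS => x.
  by move=> /eqP; rewrite [X in X == _]/(f x - g x) subr_eq0 => /eqP.
by move=> /= E; rewrite -[LHS]/(f x - g x) E subrr.
Qed.

Lemma funL2_pi (f : Lfun2) : \forall x \ae mu, funL2 (\pi_(L2) f) x = f x.
Proof. by apply/eq_pi; rewrite reprK. Qed.

Lemma funL2_mk f fP : \forall x \ae mu, funL2 (@mkL2 f fP) x = f x.
Proof. exact: funL2_pi. Qed.

Lemma eqL2P h k : (\forall x \ae mu, funL2 h x = funL2 k x) -> h = k.
Proof. by move=> /eq_pi; rewrite !reprK. Qed.

Lemma funL2_Lfun h : funL2 h \in Lfun mu 2%:E.
Proof. exact: LfunP. Qed.

Lemma measurable_funL2 h : measurable_fun setT (funL2 h).
Proof. by have := funL2_Lfun h; rewrite inE => /andP[/[!inE]]. Qed.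

Lemma funL2D h k : \forall x \ae mu, funL2 (h + k) x = funL2 h x + funL2 k x.
Proof.
have -> : h + k = \pi_(L2) (repr h + repr k) by rewrite -{1}[h]reprK -{1}[k]reprK -raddfD.
exact: funL2_pi.
Qed.

Lemma funL2Z (a : R) h : \forall x \ae mu, funL2 (a *: h) x = a * funL2 h x.
Proof. exact: funL2_pi. Qed.

Lemma integrable_mulL2 f g : f \in Lfun mu 2%:E -> g \in Lfun mu 2%:E ->
  mu.-integrable setT (fun x => (f x * g x)%:E).
Proof. by move=> fL gL; apply/Lfun1_integrable; exact: Lfun2_mul_Lfun1. Qed.

Lemma measurable_Lfun f : f \in Lfun mu 2%:E -> measurable_fun setT f.
Proof. by rewrite inE => /andP[/[!inE]]. Qed.

Lemma eq_ae_Rintegral f g : measurable_fun setT f -> measurable_fun setT g ->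
  (\forall x \ae mu, f x = g x) -> (\int[mu]_x f x = \int[mu]_x g x)%R.
Proof.
move=> mf mg fg; congr fine; apply: ae_eq_integral => //.
- exact/measurable_EFinP.
- exact/measurable_EFinP.
- by apply: filterS fg => x /= ->.
Qed.

Lemma dotL2_mk f fP h : dotL2 (@mkL2 f fP) h = (\int[mu]_x (f x * funL2 h x))%R.
Proof.
apply: eq_ae_Rintegral.
- by apply: measurable_funM; exact: measurable_funL2.
- by apply: measurable_funM; [exact: measurable_Lfun|exact: measurable_funL2].
- by apply: filterS (funL2_mk fP) => x ->.
Qed.

Lemma dotL2C h k : dotL2 h k = dotL2 k h.
Proof. by apply: eq_Rintegral => x _; rewrite mulrC. Qed.

Lemma dotL2_linear (a : R) h k l : dotL2 (a *: h + k) l = a * dotL2 h l + dotL2 k l.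
Proof.
have ih := integrable_mulL2 (funL2_Lfun h) (funL2_Lfun l).
have ik := integrable_mulL2 (funL2_Lfun k) (funL2_Lfun l).
have iah : mu.-integrable setT (fun x => (a * (funL2 h x * funL2 l x))%:E).
  by under eq_fun do rewrite EFinM; exact: integrableZl.
rewrite /dotL2 -RintegralZl// -RintegralD//.
apply: eq_ae_Rintegral.
- by apply: measurable_funM; exact: measurable_funL2.
- apply: measurable_funD; last by apply: measurable_funM; exact: measurable_funL2.
  apply: measurable_funM; first exact: measurable_cst.
  by apply: measurable_funM; exact: measurable_funL2.
- apply: filterS2 (funL2D (a *: h) k) (funL2Z a h) => x -> ->.
  by rewrite mulrDl mulrA.
Qed.

Lemma dotL2_ge0 h : 0 <= dotL2 h h.
Proof. by apply: Rintegral_ge0 => x _; rewrite -expr2 sqr_ge0. Qed.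

Lemma dotL2_eq0 h : dotL2 h h = 0 -> h = 0.
Proof.
move=> h0; have ih := integrable_mulL2 (funL2_Lfun h) (funL2_Lfun h).
have : (\int[mu]_x (funL2 h x * funL2 h x)%:E = 0)%E.
  by rewrite -[LHS]fineK ?integrable_fin_num//; congr EFin.
have -> : (\int[mu]_x (funL2 h x * funL2 h x)%:E)%E =
    (\int[mu]_x `|(funL2 h x * funL2 h x)%:E|)%E.
  by apply: eq_integral => x _; rewrite gee0_abs// lee_fin -expr2 sqr_ge0.
have mh : measurable_fun setT (fun x => (funL2 h x * funL2 h x)%:E).
  exact: measurable_int ih.
move=> /(ae_eq_integral_abs mu measurableT mh) hae.
rewrite -[0](@reprK _ L2) -[h]reprK; apply/eq_pi.
have z0 : \forall x \ae mu, funL2 (0 : L2) x = 0.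
  have := funL2_pi (0 : Lfun2); rewrite raddf0; exact.
apply: filterS2 hae z0 => x /= + z; move=> /(_ I) [] /eqP.
by rewrite mulf_eq0 orbb => /eqP E; rewrite [LHS]E; rewrite [RHS]z.
Qed.

End L2_theory.

(** * Estimates in the mean and in the square mean *)

Section small_integrals.
Context d (T : measurableType d) (R : realType) (mu : {measure set T -> \bar R}).
Implicit Types f g h : T -> R.

Lemma dominated_small (f_ : nat -> T -> R) f g :
  (forall n, measurable_fun setT (f_ n)) -> measurable_fun setT f ->
  (forall x, f_ n x @[n --> \oo] --> f x) ->
  mu.-integrable setT (EFin \o g) -> (forall n x, `|f_ n x| <= g x) ->
  forall e : R, 0 < e -> exists n, (\int[mu]_x `|f_ n x - f x|%:E < e%:E)%E.
Proof.
move=> mf_ mf ff ig fg e e0.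
have mEf_ n : measurable_fun setT (fun x => (f_ n x)%:E) by exact/measurable_EFinP.
have mEf : measurable_fun setT (EFin \o f) by exact/measurable_EFinP.
have cv : {ae mu, forall x, setT x -> (fun n => (f_ n x)%:E) @ \oo --> (EFin \o f) x}.
  by apply: aeW => x _; apply: cvg_EFin; [exact: nearW|exact: ff].
have dom : {ae mu, forall x n, setT x -> (`|(f_ n x)%:E| <= (EFin \o g) x)%E}.
  by apply: aeW => x n _; rewrite /= lee_fin.
have [_ + _] := dominated_convergence measurableT mEf_ mEf cv ig dom.
move=> /(_ [set x | (x < e%:E)%E]) [].
  by apply: open_nbhs_nbhs; split; [exact: open_ereal_lt_ereal|rewrite /= lte_fin].
by move=> n _ /(_ n (leqnn n)) /= h; exists n.
Qed.

Lemma integral_norm_triangle f g h :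
  measurable_fun setT f -> measurable_fun setT g -> measurable_fun setT h ->
  (\int[mu]_x `|f x - h x|%:E <= \int[mu]_x `|f x - g x|%:E + \int[mu]_x `|g x - h x|%:E)%E.
Proof.
move=> mf mg mh.
have m f1 f2 : measurable_fun setT f1 -> measurable_fun setT f2 ->
    measurable_fun setT (fun x => `|f1 x - f2 x|%:E).
  move=> m1 m2; apply/measurable_EFinP; apply: measurableT_comp => //.
  exact: measurable_funB.
rewrite -ge0_integralD//; [|exact: m..].
apply: ge0_le_integral => //.
- exact: m.
- by apply: emeasurable_funD; exact: m.
- move=> x _; rewrite -EFinD lee_fin.
  by rewrite (le_trans _ (ler_normD _ _))// addrA subrK.
Qed.

(** A substitute for the triangle inequality that avoids square roots of integrals. *)
Lemma integral_sqrD f g : measurable_fun setT f -> measurable_fun setT g ->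
  (\int[mu]_x ((f x + g x) ^+ 2)%:E <=
   2%:E * \int[mu]_x (f x ^+ 2)%:E + 2%:E * \int[mu]_x (g x ^+ 2)%:E)%E.
Proof.
move=> mf mg.
have msq f1 : measurable_fun setT f1 -> measurable_fun setT (fun x => (f1 x ^+ 2)%:E).
  by move=> m1; apply/measurable_EFinP; exact: measurable_funX.
have mz f1 : measurable_fun setT f1 -> measurable_fun setT (fun x => (2%:E * (f1 x ^+ 2)%:E)%E).
  by move=> m1; apply: measurable_funeM; exact: msq.
have sq0 f1 : forall x, [set: T] x -> (0 <= (f1 x ^+ 2)%:E)%E.
  by move=> x _; rewrite lee_fin sqr_ge0.
have sq20 f1 : forall x, [set: T] x -> (0 <= 2%:E * (f1 x ^+ 2)%:E)%E.
  by move=> x _; rewrite mule_ge0// lee_fin sqr_ge0.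
rewrite -(ge0_integralZl _ measurableT (msq _ mf) (sq0 f))//.
rewrite -(ge0_integralZl _ measurableT (msq _ mg) (sq0 g))//.
rewrite -(ge0_integralD _ measurableT (sq20 f) (mz _ mf) (sq20 g) (mz _ mg)).
apply: ge0_le_integral => //.
- exact: (sq0 (fun x => f x + g x)).
- by apply: msq; exact: measurable_funD.
- by apply: emeasurable_funD; exact: mz.
- move=> x _; rewrite -!EFinM -EFinD lee_fin.
  by have := sqr_ge0 (f x - g x); rewrite !expr2; nra.
Qed.

End small_integrals.

(** * Bump functions on cubes *)

Section cube_bump.
Variables (R : realType) (n : nat).
Implicit Types (c x : 'rV[R]_n) (r : R).

(** Balls of the sup norm are cubes, so a product of one-dimensional bumps is positive exactly on
    the ball of centre [c] and radius [r]. *)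
Definition cube_bump c r x : R :=
  \prod_(j < n) (flat 1 (r - (x ord0 j - c ord0 j)) * flat 1 (r + (x ord0 j - c ord0 j))).

Lemma cube_bump_smooth c r k : Ck k (cube_bump c r : 'rV[R]_n -> R^o).
Proof.
have coord (j : 'I_n) (s t : R) i :
    Ck i (fun x : 'rV[R]_n => flat 1 (s + t * (x ord0 j)) : R^o).
  apply: (@Ck_comp_affine R 'rV[R]_n (fun x => s + t * x ord0 j) (fun v => t * v ord0 j)
     (flat 1)).
  - apply: continuous_fctD; first exact: continuous_fctC.
    by apply: continuous_fctM; [exact: continuous_fctC|exact: coord_continuous].
  - by move=> h v x; rewrite !mxE; ring.
  - exact: flat_smooth.
apply: (@Ck_prod R 'rV[R]_n k _ _ (fun j x =>
   flat 1 (r - (x ord0 j - c ord0 j)) * flat 1 (r + (x ord0 j - c ord0 j)))) => j.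
apply: CkM.
- rewrite (_ : (fun x => _) = fun x => flat 1 ((r + c ord0 j) + -1 * (x ord0 j))).
    exact: coord.
  by apply/funext => x; congr flat; ring.
- rewrite (_ : (fun x => _) = fun x => flat 1 ((r - c ord0 j) + 1 * (x ord0 j))).
    exact: coord.
  by apply/funext => x; congr flat; ring.
Qed.

Lemma cube_bump_ge0 c r x : 0 <= cube_bump c r x.
Proof. by apply: prodr_ge0 => j _; rewrite mulr_ge0// flat1_ge0. Qed.

Lemma cube_bump_le1 c r x : cube_bump c r x <= 1.
Proof.
apply: prodr_ile1 => j _; rewrite mulr_ge0 ?flat1_ge0//=.
by rewrite -[leRHS]mul1r ler_pM ?flat1_ge0 ?flat1_le1.
Qed.

Lemma cube_bump_gt0 c r x : 0 < r -> (0 < cube_bump c r x) <-> ball c r x.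
Proof.
move=> r0; split.
  move=> b0; split => // i j; rewrite (ord1 i) /ball/= distrC ltr_norml.
  have : flat 1 (r - (x ord0 j - c ord0 j)) * flat 1 (r + (x ord0 j - c ord0 j)) != 0.
    apply: contraTneq b0 => E.
    by rewrite /cube_bump (bigD1 j)//= E mul0r ltxx.
  rewrite mulf_eq0 negb_or => /andP[].
  rewrite !neq_lt !flat1_gt0 !ltNge !flat1_ge0/= -!ltNge => ? ?.
  by apply/andP; split; lra.
move=> [_ h]; apply: prodr_gt0 => j _; have := h ord0 j.
rewrite /ball/= distrC ltr_norml => /andP[? ?].
by rewrite mulr_gt0// flat1_gt0; lra.
Qed.

Lemma cube_bump_eq0 c r x : 0 < r -> ~ ball c r x -> cube_bump c r x = 0.
Proof.
move=> r0 /(cube_bump_gt0 c x r0) /negP; rewrite -leNgt => b0.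
by apply/eqP; rewrite eq_le b0 cube_bump_ge0.
Qed.

(** Stated for every smooth function vanishing with the bump, because it serves for functions of the
    bump rather than the bump itself. The margin between [r] and [s] keeps the closed cube of
    half-side [r] inside [U]. *)
Lemma testfun_cube_bump (U : set 'rV[R]_n) c r s : 0 < r -> r < s -> ball c s `<=` U ->
  forall psi : 'rV[R]_n -> R^o, (forall k, Ck k psi) ->
  (forall x, cube_bump c r x = 0 -> psi x = 0) -> testfun U psi.
Proof.
move=> r0 rs cU psi spsi psi0; split => //.
exists [set x : 'rV[R]_n | forall j, `[c ord0 j - r, c ord0 j + r]%classic (x ord0 j)].
  split; first by apply: (@rV_compact R n (fun j => `[c ord0 j - r, c ord0 j + r]%classic)) => j;
    exact: segment_compact.
  move=> x h; apply: cU; split; first exact: lt_trans rs.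
  move=> i j; rewrite (ord1 i) /ball/= distrC ltr_norml.
  by have := h j; rewrite /= in_itv/= => /andP[? ?]; apply/andP; split; lra.
move=> x nx; apply: psi0; apply: cube_bump_eq0 => // -[_ h]; apply: nx => j.
have := h ord0 j; rewrite /ball/= distrC ltr_norml => /andP[? ?].
by rewrite in_itv/=; apply/andP; split; lra.
Qed.

End cube_bump.

Section test_algebra.
Variables (R : realType) (n : nat) (U : set 'rV[R]_n).
Implicit Types phi psi : 'rV[R]_n -> R^o.

Lemma testfun0 : testfun U (fun=> 0 : R^o).
Proof.
split; first by move=> k; exact: Ck_cst.
by exists set0 => //; split; [exact: compact0|exact: sub0set].
Qed.

Lemma testfunD phi psi : testfun U phi -> testfun U psi ->
  testfun U (fun x => phi x + psi x).
Proof.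
move=> [sphi [K [cK KU] K0]] [spsi [L [cL LU] L0]]; split.
  by move=> k; exact: CkD.
exists (K `|` L); first by split; [exact: compactU|move=> x [/KU|/LU]].
by move=> x /not_orP[/K0 -> /L0 ->]; rewrite addr0.
Qed.

Lemma testfunM phi psi : testfun U phi -> (forall k, Ck k psi) ->
  testfun U (fun x => phi x * psi x : R^o).
Proof.
move=> [sphi [K [cK KU] K0]] spsi; split; first by move=> k; exact: CkM.
by exists K => // x /K0 ->; rewrite mul0r.
Qed.

Lemma testfunZ (a : R) phi : testfun U phi -> testfun U (fun x => a * phi x : R^o).
Proof.
move=> tphi; rewrite (_ : (fun x => _) = fun x => phi x * a : R^o).
  by apply: testfunM => // k; exact: Ck_cst.
by apply/funext => x; rewrite mulrC.
Qed.

Lemma testfunB phi psi : testfun U phi -> testfun U psi ->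
  testfun U (fun x => phi x - psi x).
Proof.
move=> tphi tpsi; rewrite (_ : (fun x => _) = fun x => phi x + -1 * psi x : R^o).
  by apply: testfunD => //; exact: testfunZ.
by apply/funext => x; rewrite mulN1r.
Qed.

End test_algebra.

(** * Approximation of indicator functions by test functions in the mean *)

Section set_approximation.
Variables (R : realType) (n : nat) (Omega : smooth_domain R n).
Local Notation mu := (lebesgue_domain Omega).
Local Notation D := (domain_set Omega).
Local Notation borel := (borelRn R n).

(** Requiring values in [[0, 1]] makes the property stable under Boolean operations and later turns
    closeness in [L^1] into closeness in [L^2]. *)
Definition test_approx (A : set borel) : Prop := forall e : R, 0 < e ->
  exists phi : 'rV[R]_n -> R^o, [/\ testfun D phi, forall x, 0 <= (phi x : R) <= 1 &
    (\int[mu]_x `|(\1_A x : R) - phi x|%:E < e%:E)%E].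

Lemma testfun_measurable (U : set 'rV[R]_n) (phi : 'rV[R]_n -> R^o) : testfun U phi ->
  measurable_fun setT (phi : borel -> R).
Proof. by move=> /testfun_continuous; exact: continuous_measurable_Rn. Qed.

Lemma measurable_indicR (A : set borel) : measurable A ->
  measurable_fun setT (\1_A : borel -> R).
Proof. by move=> mA; exact: measurable_indic. Qed.

Lemma integrable_cst_domain (c : R) : mu.-integrable setT (EFin \o cst c).
Proof.
apply: measurable_bounded_integrable => //.
  exact: lebesgue_domain_finite.
by exists `|c|; split; [exact: num_real|move=> y cy x _ /=; exact: ltW].
Qed.

(* [g] interpolates the indicators: e.g. [a + b - a * b] for the union. *)
Lemma test_approx_op (A B C : set borel) (g : R -> R -> R) :
  measurable A -> measurable B -> measurable C ->
  (forall a b, 0 <= a <= 1 -> 0 <= b <= 1 -> 0 <= g a b <= 1) ->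
  (forall a b a' b', 0 <= a <= 1 -> 0 <= b <= 1 -> 0 <= a' <= 1 -> 0 <= b' <= 1 ->
    `|g a b - g a' b'| <= `|a - a'| + `|b - b'|) ->
  (forall x, \1_C x = g (\1_A x) (\1_B x)) ->
  (forall phi psi : 'rV[R]_n -> R^o, testfun D phi -> testfun D psi ->
    testfun D (fun x => g (phi x) (psi x) : R^o)) ->
  test_approx A -> test_approx B -> test_approx C.
Proof.
move=> mA mB mC g01 gL gC tg hA hB e e0.
have e20 : 0 < e / 2 by rewrite divr_gt0.
have [phi [tphi phi01 hphi]] := hA _ e20.
have [psi [tpsi psi01 hpsi]] := hB _ e20.
exists (fun x => g (phi x) (psi x)); split.
- exact: tg.
- by move=> x; exact: g01.
have m F phi' : measurable F -> testfun D phi' ->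
    measurable_fun setT (fun x : borel => `|(\1_F x : R) - phi' x|%:E).
  move=> mF tphi'; apply/measurable_EFinP; apply: measurableT_comp => //.
  by apply: measurable_funB; [exact: measurable_indicR|exact: testfun_measurable tphi'].
have i01 (F : set borel) x : 0 <= (\1_F x : R) <= 1.
  by rewrite indicE; case: (_ \in _); rewrite /= ?lexx ?ler01.
rewrite (splitr e) EFinD; apply: le_lt_trans; last exact: lteD hphi hpsi.
rewrite -ge0_integralD//; [|exact: m..].
apply: ge0_le_integral => //.
- by apply: m => //; exact: tg.
- by apply: emeasurable_funD; exact: m.
- by move=> x _; rewrite -EFinD lee_fin gC; exact: gL.
Qed.

Lemma test_approxU (A B : set borel) : measurable A -> measurable B ->
  test_approx A -> test_approx B -> test_approx (A `|` B).
Proof.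
move=> mA mB; apply: (@test_approx_op _ _ _ (fun a b => a + b - a * b)) => //.
- exact: measurableU.
- by move=> a b /andP[? ?] /andP[? ?]; apply/andP; split; nra.
- move=> a b a' b' /andP[a0 a1] /andP[b0 b1] /andP[a'0 a'1] /andP[b'0 b'1].
  have -> : a + b - a * b - (a' + b' - a' * b') = (a - a') * (1 - b) + (b - b') * (1 - a').
    by ring.
  rewrite (le_trans (ler_normD _ _))// !normrM lerD//.
    by rewrite ler_piMr// ger0_norm; lra.
  by rewrite ler_piMr// ger0_norm; lra.
- move=> x; rewrite !indicE in_setU.
  by case: (x \in A); case: (x \in B); rewrite /=; ring.
- move=> phi psi tphi tpsi; apply: testfunB; first exact: testfunD.
  by apply: testfunM => //; case: tpsi.
Qed.

Lemma test_approxD (A B : set borel) : measurable A -> measurable B ->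
  test_approx A -> test_approx B -> test_approx (A `\` B).
Proof.
move=> mA mB; apply: (@test_approx_op _ _ _ (fun a b => a - a * b)) => //.
- exact: measurableD.
- by move=> a b /andP[? ?] /andP[? ?]; apply/andP; split; nra.
- move=> a b a' b' /andP[a0 a1] /andP[b0 b1] /andP[a'0 a'1] /andP[b'0 b'1].
  have -> : a - a * b - (a' - a' * b') = (a - a') * (1 - b) + (b' - b) * a' by ring.
  rewrite (le_trans (ler_normD _ _))// !normrM lerD//.
    by rewrite ler_piMr// ger0_norm; lra.
  by rewrite distrC ler_piMr// ger0_norm; lra.
- move=> x; rewrite !indicE in_setD.
  by case: (x \in A); case: (x \in B); rewrite /=; ring.
- move=> phi psi tphi tpsi; apply: testfunB => //.
  by apply: testfunM => //; case: tpsi.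
Qed.

Lemma test_approx0 : test_approx set0.
Proof.
move=> e e0; exists (fun=> 0); split; first exact: testfun0.
- by move=> x; rewrite lexx ler01.
- rewrite integral0_eq ?lte_fin// => x _.
  by rewrite indicE in_set0 subrr normr0.
Qed.

(** Bounded convergence: the domain has finite measure, so the constant 1 is an integrable
    majorant. *)
Lemma test_approx_lim (A : set borel) (F : nat -> set borel) :
  measurable A -> (forall k, measurable (F k)) -> (forall k, test_approx (F k)) ->
  (forall x, (\1_(F k) x : R) @[k --> \oo] --> (\1_A x : R)) -> test_approx A.
Proof.
move=> mA mF hF FA e e0; have e20 : 0 < e / 2 by rewrite divr_gt0.
have i1 (E : set borel) x : `|\1_E x : R| <= cst 1 x.
  by rewrite indicE; case: (_ \in _); rewrite /= ?normr1 ?normr0.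
have [k hk] := dominated_small (fun k => measurable_indicR (mF k)) (measurable_indicR mA)
  FA (integrable_cst_domain 1) (fun k x => i1 (F k) x) e20.
have [phi [tphi phi01 hphi]] := hF k _ e20.
exists phi; split => //; rewrite (splitr e) EFinD.
apply: le_lt_trans; last exact: lteD hk hphi.
apply: le_trans.
  apply: (integral_norm_triangle mu (measurable_indicR mA) (measurable_indicR (mF k))
    (testfun_measurable tphi)).
by under eq_integral do rewrite distrC.
Qed.

Lemma test_approx_bigcup (F : nat -> set borel) : (forall k, measurable (F k)) ->
  (forall k, test_approx (F k)) -> test_approx (\bigcup_k F k).
Proof.
move=> mF hF; pose G k := \big[setU/set0]_(i < k) F i.
have mG k : measurable (G k) by apply: bigsetU_measurable => i _; exact: mF.
have hG k : test_approx (G k).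
  rewrite /G; elim: k => [|k IH]; first by rewrite big_ord0; exact: test_approx0.
  by rewrite big_ord_recr/=; apply: test_approxU => //; exact: (mG k).
apply: (test_approx_lim _ mG hG); first exact: bigcup_measurable.
move=> x; rewrite [\1_(\bigcup_k F k) x]indicE.
have [/set_mem [i _ Fix]|nFx] := boolP (x \in \bigcup_k F k).
  apply: cvg_near_cst; exists i.+1 => // k /= ik.
  rewrite indicE mem_set// /G -bigcup_mkord; by exists i.
apply: cvg_near_cst; apply: nearW => k; rewrite indicE memNset//.
rewrite /G -bigcup_mkord => -[i /= _ Fix]; move: nFx; rewrite notin_setE; apply.
by exists i.
Qed.

(** With [b] the bump, [1 - (1 - b)^(k+1)] tends to 1 exactly where [b] is positive and is 0
    elsewhere, so these test functions converge to the indicator of the ball. *)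
Lemma test_approx_ball (c : 'rV[R]_n) (r s : R) : 0 < r -> r < s -> ball c s `<=` D ->
  test_approx (ball c r : set borel).
Proof.
move=> r0 rs cD; pose f k (x : 'rV[R]_n) : R^o := 1 - (1 - cube_bump c r x) ^+ k.+1.
have f01 k x : 0 <= (f k x : R) <= 1.
  have b0 := cube_bump_ge0 c r x; have b1 := cube_bump_le1 c r x.
  have : 0 <= 1 - cube_bump c r x <= 1 by apply/andP; split; lra.
  move=> /andP[u0 u1]; have := exprn_ile1 k.+1 u0 u1; have := exprn_ge0 k.+1 u0.
  by rewrite /f => ? ?; apply/andP; split; lra.
have sf k i : Ck i (f k).
  have s1 j : Ck j (fun x : 'rV[R]_n => 1 + -1 * cube_bump c r x : R^o).
    by apply: CkD; [exact: Ck_cst|apply: CkZ; exact: cube_bump_smooth].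
  have sX j m : Ck j (fun x : 'rV[R]_n => (1 + -1 * cube_bump c r x) ^+ m : R^o).
    elim: m => [|m IH].
      by rewrite (_ : (fun x => _) = fun=> 1); [exact: Ck_cst|exact/funext].
    rewrite (_ : (fun x => _) =
       fun x => (1 + -1 * cube_bump c r x : R^o) * (1 + -1 * cube_bump c r x) ^+ m : R^o).
      exact: CkM.
    by apply/funext => x; rewrite exprS.
  rewrite (_ : f k = fun x => (1 : R^o) + -1 * (1 + -1 * cube_bump c r x) ^+ k.+1 : R^o).
    by apply: CkD; [exact: Ck_cst|exact: CkZ].
  by apply/funext => x; rewrite /f !mulN1r.
have tf k : testfun D (f k).
  apply: (@testfun_cube_bump R n D c r s r0 rs cD) => // x b0.
  by rewrite /f b0 subr0 expr1n subrr.
have mb : measurable (ball c r : set borel).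
  by apply: sub_sigma_algebra; exact: ball_open.
have cv x : (f k x : R) @[k --> \oo] --> (\1_(ball c r : set borel) x : R).
  rewrite indicE; have [/set_mem bx|nbx] := boolP (x \in _).
    have b0 := (cube_bump_gt0 c x r0).2 bx.
    rewrite -[X in _ --> X]subr0; apply: cvgB; first exact: cvg_cst.
    have := @cvg_expr R (1 - cube_bump c r x).
    rewrite -(cvg_shiftS (fun k => (1 - cube_bump c r x) ^+ k)); apply.
    by have b1 := cube_bump_le1 c r x; rewrite ger0_norm; lra.
  apply: cvg_near_cst; apply: nearW => k.
  by rewrite /f cube_bump_eq0 ?subr0 ?expr1n ?subrr//; move: nbx; rewrite notin_setE.
have fb k x : `|(f k x : R)| <= cst 1 x.
  by have /andP[? ?] := f01 k x; rewrite /= ger0_norm.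
move=> e e0; have [k hk] := dominated_small (fun k => testfun_measurable (tf k))
  (measurable_indicR mb) cv (integrable_cst_domain 1) fb e0.
by exists (f k); split => //; under eq_integral do rewrite distrC.
Qed.

Lemma test_approx_open (U : set 'rV[R]_n) : open U -> U `<=` D ->
  test_approx (U : set borel).
Proof.
move=> oU UD.
pose c (q : n.-tuple rat) : 'rV[R]_n := \row_i ratr (tnth q i).
(* Asking for the doubled ball to lie in [U] supplies the margin that [test_approx_ball] needs;
   balls with rational centre and inverse integer radius still exhaust [U]. *)
pose V (p : n.-tuple rat * nat) : set borel :=
  if `[< ball (c p.1) (2 * p.2.+1%:R^-1) `<=` U >]
  then ball (c p.1) p.2.+1%:R^-1 else set0.
pose W k : set borel := if @unpickle (n.-tuple rat * nat)%type k is Some p then V p else set0.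
have mV p : measurable (V p).
  rewrite /V; case: ifP => // _.
  by apply: sub_sigma_algebra; exact: ball_open.
have hV p : test_approx (V p).
  rewrite /V; case: asboolP => [pU|_]; last exact: test_approx0.
  have k0 : 0 < p.2.+1%:R^-1 :> R by rewrite invr_gt0 ltr0n.
  apply: (@test_approx_ball _ _ (2 * p.2.+1%:R^-1)) => //.
    by rewrite ltr_pMl// ltr1n.
  by apply: subset_trans UD.
have -> : (U : set borel) = \bigcup_k W k.
  apply/seteqP; split=> [x Ux|x [k _]]; last first.
    rewrite /W; case: unpickle => // p; rewrite /V; case: asboolP => // pU.
    move=> bx; apply: pU; apply: le_ball bx.
    have : 0 < p.2.+1%:R^-1 :> R by rewrite invr_gt0 ltr0n.
    by move=> k0; rewrite ler_peMl ?ltW// ltr1n.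
  have /nbhs_ballP[e /= e0 eU] : nbhs x U by exact: open_nbhs_nbhs.
  have e30 : 0 < e / 3 by rewrite divr_gt0.
  have [k _ /(_ k (leqnn k)) /= ke] := near_infty_natSinv_lt (PosNum e30).
  have k0 : 0 < k.+1%:R^-1 :> R by rewrite invr_gt0 ltr0n.
  have /choice[q hq] (i : 'I_n) :
      exists q : rat, ball (x ord0 i) k.+1%:R^-1 (ratr q).
    have b0 : ball (x ord0 i) k.+1%:R^-1 !=set0 by exists (x ord0 i); exact: ballxx.
    have [y [by_ [r _ ry]]] := dense_rat b0 (ball_open _ _).
    by exists r; rewrite ry.
  pose p : n.-tuple rat * nat := ([tuple q i | i < n], k).
  have cx : ball (c p.1) k.+1%:R^-1 x.
    by split=> // i j; rewrite !mxE tnth_mktuple ord1; exact/ball_sym.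
  exists (pickle p) => //; rewrite /W pickleK /V /=.
  case: asboolP => // -[] y cy; apply: eU.
  apply: (@le_ball _ _ _ (k.+1%:R^-1 + 2 * k.+1%:R^-1)).
    rewrite -[X in X + _]mul1r -mulrDl (_ : 1 + 2 = 3); last by ring.
    by rewrite -ler_pdivlMl// mulrC ltW.
  by apply: ball_triangle cy; exact: ball_sym.
apply: test_approx_bigcup => k; rewrite /W; case: unpickle => //.
exact: test_approx0.
Qed.

(** The sets whose trace on the domain is approximable form a sigma-algebra containing the open
    sets. Intersecting with [D] is essential for complements, as test functions vanish outside the
    domain. *)
Lemma test_approx_measurable (A : set borel) : measurable A -> test_approx (A `&` D).
Proof.
have mD : measurable (D : set borel) by exact: measurable_domain.
suff H : @measurable _ borel `<=` [set A : set borel | measurable A /\ test_approx (A `&` D)].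
  by move=> /H[].
apply: smallest_sub; last first.
  move=> U oU; split; first exact: sub_sigma_algebra.
  by apply: test_approx_open; [apply: openI => //; exact: domain_open|exact: subIsetr].
split.
- by split; [exact: measurable0|rewrite set0I; exact: test_approx0].
- move=> B [mB hB]; split; first exact: measurableD.
  have -> : (setT `\` B) `&` D = D `\` (B `&` D).
    by rewrite setTD setDIr setDv setU0 setDE setIC.
  apply: test_approxD => //; first exact: measurableI.
  by apply: test_approx_open => //; exact: domain_open.
- move=> F hF; split; first by apply: bigcup_measurable => k _; exact: (hF k).1.
  rewrite setI_bigcupl; apply: test_approx_bigcup => k; last exact: (hF k).2.
  by apply: measurableI => //; exact: (hF k).1.
Qed.

End set_approximation.

(** * From indicator functions to square-integrable functions *)

Section density.
Import HBSimple HBNNSimple.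
Variables (R : realType) (n : nat) (Omega : smooth_domain R n).
Local Notation mu := (lebesgue_domain Omega).
Local Notation D := (domain_set Omega).
Local Notation borel := (borelRn R n).
Local Notation V := (L2dom Omega).
Implicit Types (f g : borel -> R).

Definition L2_approx f : Prop := forall e : R, 0 < e ->
  exists2 phi : 'rV[R]_n -> R^o, testfun D phi &
    (\int[mu]_x ((f x - phi x) ^+ 2)%:E < e%:E)%E.

Let msq f g : measurable_fun setT f -> measurable_fun setT g ->
  measurable_fun setT (fun x => ((f x - g x) ^+ 2)%:E).
Proof.
by move=> mf mg; apply/measurable_EFinP; apply: measurable_funX; exact: measurable_funB.
Qed.

(** Both functions take values in [[0, 1]], so the square of their difference is at most its
    absolute value. The complement of [D] is null for the restricted measure, so [A] may be replaced
    by its trace on [D]. *)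
Lemma L2_approx_indic (A : set borel) : measurable A -> L2_approx (\1_A).
Proof.
move=> mA e e0; have [phi [tphi phi01 hphi]] := test_approx_measurable Omega mA e0.
have mphi := testfun_measurable tphi.
have mD : measurable (D : set borel) by exact: measurable_domain.
exists phi => //; apply: le_lt_trans hphi; apply: ae_ge0_le_integral => //.
- by move=> x _; rewrite lee_fin sqr_ge0.
- by apply: msq => //; exact: measurable_indicR.
- apply/measurable_EFinP; apply: measurableT_comp => //.
  by apply: measurable_funB => //; apply: measurable_indicR; exact: measurableI.
- exists (~` D); split.
  + exact: measurableC.
  + by rewrite /= /lebesgue_domain /= /mrestr setICl measure0.
  + move=> x /= nx Dx; apply: nx => _; rewrite lee_fin.
    have -> : \1_(A `&` D) x = \1_A x :> R.
      by rewrite !indicE in_setI (mem_set Dx) andbT.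
    have /andP[? ?] := phi01 x.
    rewrite -real_normK ?num_real// expr2 ler_piMr//.
    rewrite indicE; case: (_ \in _) => /=; rewrite ler_norml; apply/andP; split; lra.
Qed.

Lemma L2_approxD f g : measurable_fun setT f -> measurable_fun setT g ->
  L2_approx f -> L2_approx g -> L2_approx (fun x => f x + g x).
Proof.
move=> mf mg hf hg e e0; have e40 : 0 < e / 4 by rewrite divr_gt0.
have [phi tphi hphi] := hf _ e40; have [psi tpsi hpsi] := hg _ e40.
have mphi := testfun_measurable tphi; have mpsi := testfun_measurable tpsi.
exists (fun x => phi x + psi x); first exact: testfunD.
apply: (@le_lt_trans _ _ (2%:E * \int[mu]_x ((f x - phi x) ^+ 2)%:E +
   2%:E * \int[mu]_x ((g x - psi x) ^+ 2)%:E)%E).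
  have := integral_sqrD mu (measurable_funB mf mphi) (measurable_funB mg mpsi).
  by under eq_integral do rewrite addrACA -opprD.
have -> : (e%:E = 2%:E * (e / 4)%:E + 2%:E * (e / 4)%:E)%E.
  by rewrite -!EFinM -EFinD; congr EFin; field.
by rewrite lteD// lte_pmul2l.
Qed.

Lemma L2_approxZ (a : R) f : measurable_fun setT f ->
  L2_approx f -> L2_approx (fun x => a * f x).
Proof.
move=> mf hf e e0.
have c0 : 0 < 1 + a ^+ 2 by rewrite ltr_wpDr// sqr_ge0.
have [phi tphi hphi] := hf _ (divr_gt0 e0 c0).
have mphi := testfun_measurable tphi.
exists (fun x => a * phi x); first exact: testfunZ.
apply: (@le_lt_trans _ _ ((1 + a ^+ 2)%:E * \int[mu]_x ((f x - phi x) ^+ 2)%:E)%E).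
  rewrite -ge0_integralZl//; try by [exact: msq|rewrite lee_fin ltW|move=> x _; rewrite lee_fin sqr_ge0].
  apply: ge0_le_integral => //.
  - by move=> x _; rewrite lee_fin sqr_ge0.
  - by apply: msq; apply: measurable_funM.
  - by apply: measurable_funeM; exact: msq.
  - move=> x _; rewrite -EFinM lee_fin -mulrBr exprMn ler_wpM2r ?sqr_ge0//.
    by rewrite lerDr.
by rewrite -lte_pdivlMl// -EFinM mulrC.
Qed.

(** The last hypothesis is the domination; it holds when [0 <= g k <= f], as for the simple
    functions approximating a nonnegative [f] from below. *)
Lemma L2_approx_lim f (g : nat -> borel -> R) :
  measurable_fun setT f -> (forall k, measurable_fun setT (g k)) ->
  (forall k, L2_approx (g k)) -> (forall x, g k x @[k --> \oo] --> f x) ->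
  mu.-integrable setT (fun x => (f x ^+ 2)%:E) ->
  (forall k x, (f x - g k x) ^+ 2 <= f x ^+ 2) -> L2_approx f.
Proof.
move=> mf mg hg gf if2 dom e e0; have e40 : 0 < e / 4 by rewrite divr_gt0.
have mh k : measurable_fun setT (fun x => (f x - g k x) ^+ 2).
  by apply: measurable_funX; exact: measurable_funB.
have cv x : ((f x - g k x) ^+ 2) @[k --> \oo] --> (0 : R).
  have h : (f x - g k x) @[k --> \oo] --> (0 : R).
    by rewrite -(subrr (f x)); apply: cvgB; [exact: cvg_cst|exact: gf].
  under eq_fun do rewrite expr2.
  by rewrite -(mulr0 (0 : R)); exact: (cvgM h h).
have dm k x : `|(f x - g k x) ^+ 2| <= f x ^+ 2 by rewrite ger0_norm ?sqr_ge0.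
have m0 : measurable_fun setT (cst 0 : borel -> R) by exact: measurable_cst.
have [k hk] := dominated_small mh m0 cv if2 dm e40.
have [phi tphi hphi] := hg k _ e40; have mphi := testfun_measurable tphi.
exists phi => //.
apply: (@le_lt_trans _ _ (2%:E * \int[mu]_x ((f x - g k x) ^+ 2)%:E +
   2%:E * \int[mu]_x ((g k x - phi x) ^+ 2)%:E)%E).
  have := integral_sqrD mu (measurable_funB mf (mg k)) (measurable_funB (mg k) mphi).
  by under eq_integral do rewrite addrA subrK.
have -> : (e%:E = 2%:E * (e / 4)%:E + 2%:E * (e / 4)%:E)%E.
  by rewrite -!EFinM -EFinD; congr EFin; field.
rewrite lteD// lte_pmul2l//; apply: le_lt_trans hk.
by under [leRHS]eq_integral do rewrite subr0 ger0_norm ?sqr_ge0//.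
Qed.

Lemma L2_approx_nnsfun (f : {nnsfun borel >-> R}) : L2_approx (f : borel -> R).
Proof.
have mI y : measurable (f @^-1` [set y]) by exact: measurable_sfunP.
pose s := fset_set (range f).
have E : (f : borel -> R) =
   fun x => \sum_(y <- finmap.enum_fset s) (y * \1_(f @^-1` [set y]) x).
  apply/funext => x; rewrite fimfunE fsbig_finite//.
rewrite E; elim: (finmap.enum_fset s) => [|y r IH].
  rewrite (_ : (fun x => _) = fun x => 0 * \1_set0 x).
    by apply: L2_approxZ; [exact: measurable_indicR|exact: L2_approx_indic].
  by apply/funext => x; rewrite big_nil mul0r.
rewrite (_ : (fun x => _) = fun x => y * \1_(f @^-1` [set y]) x +
   \sum_(y <- r) (y * \1_(f @^-1` [set y]) x)); last first.
  by apply/funext => x; rewrite big_cons.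
have my z : measurable_fun setT (fun x : borel => z * (\1_(f @^-1` [set z]) x : R)).
  by apply: measurable_funM => //; exact: measurable_indicR.
apply: L2_approxD => //.
- by apply: measurable_sum => z; exact: my.
- by apply: L2_approxZ; [exact: measurable_indicR|exact: L2_approx_indic].
Qed.

Lemma L2_approx_nneg f : measurable_fun setT f -> (forall x, 0 <= f x) ->
  mu.-integrable setT (fun x => (f x ^+ 2)%:E) -> L2_approx f.
Proof.
move=> mf f0 if2.
have mEf : measurable_fun setT (EFin \o f) by exact/measurable_EFinP.
pose g := nnsfun_approx measurableT mEf.
have gf x : g k x @[k --> \oo] --> f x.
  have /fine_cvgP[] // : (g k x)%:E @[k --> \oo] --> (f x)%:E.
  by apply: cvg_nnsfun_approx => // y _; rewrite lee_fin.
have gle k x : g k x <= f x.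
  rewrite -lee_fin /g nnsfun_approxE; apply: (le_approx (f := EFin \o f)) => //.
  by move=> y _; rewrite lee_fin.
apply: (L2_approx_lim mf _ _ gf if2) => [k|k|k x].
- exact: measurable_funP.
- exact: L2_approx_nnsfun.
- have := gle k x; have : 0 <= g k x by [].
  move=> g0 gk; rewrite !expr2; nra.
Qed.

Lemma L2_approx_Lfun f : f \in Lfun mu 2%:E -> L2_approx f.
Proof.
move=> fL; have mf := measurable_Lfun fL.
have if2 := Lfun2_integrable_sqr fL.
have mp (h : borel -> R) : measurable_fun setT h -> measurable_fun setT (fun x : borel => Num.max (h x) 0).
  by move=> mh; apply: measurable_maxr.
have ip (h : borel -> R) : measurable_fun setT h -> (forall x, `|h x| = `|f x|) ->
    mu.-integrable setT (fun x => (Num.max (h x) 0 ^+ 2)%:E).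
  move=> mh hf; apply: le_integrable if2 => //.
    by apply/measurable_EFinP; apply: measurable_funX; exact: mp.
  move=> x _; rewrite /= lee_fin !normrX lerXn2r ?nnegrE//.
  rewrite -hf; case: (leP 0 (h x)) => // h0.
  by rewrite normr0.
have mN : measurable_fun setT (fun x : borel => - f x) by exact: measurable_funN.
rewrite (_ : f = fun x => Num.max (f x) 0 + -1 * Num.max (- f x) 0).
  apply: L2_approxD.
  - exact: mp.
  - by apply: measurable_funM => //; exact: mp.
  - apply: L2_approx_nneg; [exact: mp| |exact: ip].
    by move=> x; rewrite le_max lexx orbT.
  - apply: L2_approxZ; first exact: mp.
    apply: L2_approx_nneg; [exact: mp| |].
      by move=> x; rewrite le_max lexx orbT.
    by apply: ip => // x; rewrite normrN.
apply/funext => x; case: (leP 0 (f x)) => f0.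
  by rewrite max_r ?oppr_le0// mulr0 addr0.
by rewrite max_l ?oppr_ge0 ?ltW// mulN1r opprK add0r.
Qed.

Lemma testfun_Lfun (phi : 'rV[R]_n -> R^o) : testfun D phi ->
  (phi : borel -> R) \in Lfun mu 2%:E.
Proof.
move=> tphi; have mphi := testfun_measurable tphi.
rewrite inE; apply/andP; split; rewrite inE//=.
have [B HB] := testfun_bounded tphi.
rewrite /finite_norm unlock poweR_lty//.
have -> : (\int[mu]_x (`|(phi x : R)| `^ 2)%:E = \int[mu]_x (phi x ^+ 2)%:E)%E.
  by apply: eq_integral => x _; rewrite powR_mulrn// real_normK ?num_real.
apply: integrable_lty => //.
apply: (@measurable_bounded_integrable _ _ _ mu (fun x => phi x ^+ 2 : R)) => //.
- exact: lebesgue_domain_finite.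
- exact: measurable_funX.
- exists (B ^+ 2); split; first exact: num_real.
  move=> y By x _ /=; rewrite normrX (le_trans _ (ltW By))//.
  by rewrite lerXn2r ?nnegrE// (le_trans _ (HB x)).
Qed.

Definition test_vec (phi : 'rV[R]_n -> R^o) (tphi : testfun D phi) : V :=
  mkL2 (testfun_Lfun tphi).

Lemma dot_test_vec phi (tphi : testfun D phi) (h : V) :
  dot (test_vec tphi) h = pair_test h phi.
Proof.
rewrite /dot dotL2_mk /pair_test.
by apply: eq_Rintegral => x _; rewrite mulrC.
Qed.

Lemma test_vec_dense (h : V) (e : R) : 0 < e ->
  exists phi (tphi : testfun D phi), dot (h - test_vec tphi) (h - test_vec tphi) < e.
Proof.
move=> e0; have [phi tphi hphi] := L2_approx_Lfun (funL2_Lfun h) e0.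
exists phi, tphi.
have mphi := testfun_measurable tphi; have mh := measurable_funL2 h.
have -> : dot (h - test_vec tphi) (h - test_vec tphi) =
    (\int[mu]_x ((funL2 h x - phi x) ^+ 2))%R.
  apply: eq_ae_Rintegral.
  - by apply: measurable_funM; exact: measurable_funL2.
  - by apply: measurable_funX; exact: measurable_funB.
  - have ae1 := funL2D h (- test_vec tphi).
    have ae2 := funL2Z (-1) (test_vec tphi).
    have ae3 := funL2_mk (testfun_Lfun tphi).
    rewrite scaleN1r in ae2.
    apply: filterS3 ae1 ae2 ae3 => x -> -> ->.
    by rewrite mulN1r expr2.
rewrite -lte_fin /Rintegral fineK//.
rewrite ge0_fin_numE; last by apply: integral_ge0 => x _; rewrite lee_fin sqr_ge0.
by apply: lt_trans hphi _; rewrite ltry.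
Qed.

End density.

(** * Sobolev spaces *)

(* The values of [b] outside of [S] are junk. *)
Record semi_ip (R : realType) (V : lmodType R) (S : set V) (b : V -> V -> R) := SemiIp {
  sip0 : S 0 ;
  sipL : forall (a : R) x y, S x -> S y -> S (a *: x + y) ;
  sip_sym : forall x y, b x y = b y x ;
  sip_lin : forall (a : R) x y z, S x -> S y -> S z ->
    b (a *: x + y) z = a * b x z + b y z ;
  sip_ge0 : forall x, S x -> 0 <= b x x }.

(** * Semi-inner products on a subspace *)

Section semi_inner_product.
Variables (R : realType) (V : lmodType R) (S : set V) (b : V -> V -> R).
Hypothesis B : semi_ip S b.
Implicit Types (x y z : V) (a : R).
Local Notation nb x := (Num.sqrt (b x x)).

Lemma sipD x y : S x -> S y -> S (x + y).
Proof. by move=> Sx Sy; have := sipL B 1 Sx Sy; rewrite scale1r. Qed.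

Lemma sipZ a x : S x -> S (a *: x).
Proof. by move=> Sx; have := sipL B a Sx (sip0 B); rewrite addr0. Qed.

Lemma sipN x : S x -> S (- x).
Proof. by move=> Sx; rewrite -scaleN1r; exact: sipZ. Qed.

Lemma sipB x y : S x -> S y -> S (x - y).
Proof. by move=> Sx Sy; apply: sipD => //; exact: sipN. Qed.

Lemma sip_Dl x y z : S x -> S y -> S z -> b (x + y) z = b x z + b y z.
Proof. by move=> Sx Sy Sz; have := sip_lin B 1 Sx Sy Sz; rewrite scale1r mul1r. Qed.

Lemma sip_0l z : S z -> b 0 z = 0.
Proof.
move=> Sz; have := sip_Dl (sip0 B) (sip0 B) Sz; rewrite addr0 => /eqP.
by rewrite -subr_eq0 opprD addrA subrr sub0r oppr_eq0 => /eqP.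
Qed.

Lemma sip_Zl a x z : S x -> S z -> b (a *: x) z = a * b x z.
Proof.
move=> Sx Sz; have := sip_lin B a Sx (sip0 B) Sz.
by rewrite addr0 sip_0l// addr0.
Qed.

Lemma sip_Nl x z : S x -> S z -> b (- x) z = - b x z.
Proof. by move=> Sx Sz; rewrite -scaleN1r sip_Zl// mulN1r. Qed.

Lemma sip_Bl x y z : S x -> S y -> S z -> b (x - y) z = b x z - b y z.
Proof. by move=> Sx Sy Sz; rewrite sip_Dl ?sip_Nl//; exact: sipN. Qed.

Lemma sip_Dr x y z : S x -> S y -> S z -> b z (x + y) = b z x + b z y.
Proof. by move=> *; rewrite (sip_sym B z) sip_Dl// !(sip_sym B _ z). Qed.

Lemma sip_Zr a x z : S x -> S z -> b z (a *: x) = a * b z x.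
Proof. by move=> *; rewrite (sip_sym B z) sip_Zl// (sip_sym B _ z). Qed.

Lemma sip_Nr x z : S x -> S z -> b z (- x) = - b z x.
Proof. by move=> *; rewrite (sip_sym B z) sip_Nl// (sip_sym B _ z). Qed.

Lemma sip_Br x y z : S x -> S y -> S z -> b z (x - y) = b z x - b z y.
Proof. by move=> *; rewrite (sip_sym B z) sip_Bl// !(sip_sym B _ z). Qed.

Lemma sip_sqrD x y : S x -> S y -> b (x + y) (x + y) = b x x + 2 * b x y + b y y.
Proof.
move=> Sx Sy; have Sxy := sipD Sx Sy.
by rewrite sip_Dl// !sip_Dr// (sip_sym B y x); ring.
Qed.

Lemma sip_sqrB x y : S x -> S y -> b (x - y) (x - y) = b x x - 2 * b x y + b y y.
Proof.
move=> Sx Sy; have Sxy := sipB Sx Sy.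
by rewrite sip_Bl// !sip_Br// (sip_sym B y x); ring.
Qed.

Lemma sip_sqrZ a x : S x -> b (a *: x) (a *: x) = a ^+ 2 * b x x.
Proof. by move=> Sx; rewrite sip_Zl ?sip_Zr ?mulrA -?expr2//; exact: sipZ. Qed.

Lemma sip_sqrN x : S x -> b (- x) (- x) = b x x.
Proof. by move=> Sx; rewrite -scaleN1r sip_sqrZ// sqrrN expr1n mul1r. Qed.

Lemma sip_sqrB_le x y : S x -> S y -> b (x - y) (x - y) <= 2 * b x x + 2 * b y y.
Proof.
move=> Sx Sy; have := sip_ge0 B (sipD Sx Sy).
by rewrite sip_sqrB// sip_sqrD//; lra.
Qed.

Lemma sip_CS2 x y : S x -> S y -> b x y ^+ 2 <= b x x * b y y.
Proof.
move=> Sx Sy; have bx := sip_ge0 B Sx; have by0 := sip_ge0 B Sy.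
have key s t : 0 <= s ^+ 2 * b x x + 2 * (s * t) * b x y + t ^+ 2 * b y y.
  have := sip_ge0 B (sipD (sipZ s Sx) (sipZ t Sy)).
  rewrite sip_sqrD; [|exact: sipZ..].
  rewrite !sip_sqrZ// sip_Zl// ?sip_Zr//; last exact: sipZ.
  by rewrite !mulrA; apply.
have [y0|y0] := eqVneq (b y y) 0.
  have [->|q0] := eqVneq (b x y) 0; first by rewrite expr0n/= mulr_ge0.
  (* In the degenerate case the form is affine in the second coefficient; this choice gives it the
     value -1. *)
  have := key 1 (- (b x x + 1) / (2 * b x y)); rewrite y0 !mulr0 addr0 expr1n mul1r.
  have -> : 2 * (1 * (- (b x x + 1) / (2 * b x y))) * b x y = - (b x x + 1) by field.
  by rewrite opprD addrA subrr sub0r oppr_ge0 leNgt ltr01.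
(* The minimizing combination, cleared of its denominator. *)
have := key (b y y) (- b x y).
have -> : b y y ^+ 2 * b x x + 2 * (b y y * - b x y) * b x y + (- b x y) ^+ 2 * b y y =
   b y y * (b x x * b y y - b x y ^+ 2) by ring.
by rewrite pmulr_rge0 ?lt0r ?y0// subr_ge0.
Qed.

Lemma sip_CS x y : S x -> S y -> `|b x y| <= nb x * nb y.
Proof.
move=> Sx Sy; rewrite -sqrtrM ?sip_ge0//; last exact: sip_ge0 B _ Sx.
by rewrite -sqrtr_sqr ler_wsqrtr// sip_CS2.
Qed.

Lemma nb_sqr x : S x -> nb x ^+ 2 = b x x.
Proof. by move=> Sx; rewrite sqr_sqrtr// (sip_ge0 B). Qed.

Lemma nb_triangle x y : S x -> S y -> nb (x + y) <= nb x + nb y.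
Proof.
move=> Sx Sy; rewrite -(@ler_pXn2r _ 2)// ?nnegrE ?addr_ge0 ?sqrtr_ge0//.
rewrite sqrrD !nb_sqr//; last exact: sipD.
rewrite sip_sqrD//.
have := le_trans (ler_norm _) (sip_CS Sx Sy).
by move: (nb x * nb y) => p; lra.
Qed.

Lemma nbZ a x : S x -> nb (a *: x) = `|a| * nb x.
Proof. by move=> Sx; rewrite sip_sqrZ// sqrtrM ?sqr_ge0// sqrtr_sqr. Qed.

Lemma nbN x : S x -> nb (- x) = nb x.
Proof. by move=> Sx; rewrite sip_sqrN. Qed.

Lemma nb_triangleB x y : S x -> S y -> nb (x - y) <= nb x + nb y.
Proof. by move=> Sx Sy; rewrite -[nb y]nbN// nb_triangle//; exact: sipN. Qed.

Lemma nb_dist x y : S x -> S y -> `|nb x - nb y| <= nb (x - y).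
Proof.
move=> Sx Sy; have Sxy := sipB Sx Sy; have Syx := sipB Sy Sx.
have h1 := nb_triangle Sxy Sy; have h2 := nb_triangle Syx Sx.
rewrite !subrK in h1 h2; rewrite -[y - x]opprB nbN// in h2.
by rewrite ler_norml; apply/andP; split; lra.
Qed.

End semi_inner_product.

(** * Weak derivatives, [H^1] and [H^1_0] *)

Section sobolev_facts.
Variables (R : realType) (n : nat) (Omega : smooth_domain R n).
Local Notation D := (domain_set Omega).
Local Notation V := (L2dom Omega).
Local Notation ei := (basis_vec R).
Implicit Types (h k g : V) (phi psi : 'rV[R]_n -> R^o).

Lemma dot_sip : semi_ip setT (@dot R n Omega).
Proof.
split => //.
- by move=> h k; exact: dotL2C.
- by move=> a h k l _ _ _; exact: dotL2_linear.
- by move=> h _; exact: dotL2_ge0.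
Qed.

Lemma dot_eq0 h : dot h h = 0 -> h = 0.
Proof. exact: dotL2_eq0. Qed.

Lemma normE h : norm h = Num.sqrt (dot h h).
Proof. by []. Qed.

Lemma norm_sqr h : norm h ^+ 2 = dot h h.
Proof. by rewrite normE (nb_sqr dot_sip). Qed.

Lemma pair_testE phi (t : testfun D phi) h : pair_test h phi = dot h (test_vec t).
Proof. by rewrite (sip_sym dot_sip) dot_test_vec. Qed.

Lemma dot_test_eq0 h : (forall phi (t : testfun D phi), dot h (test_vec t) = 0) -> h = 0.
Proof.
move=> h0; apply: dot_eq0; apply/eqP; rewrite eq_le dotL2_ge0 andbT leNgt.
(* A test vector at squared distance less than [dot h h]; orthogonality and Cauchy-Schwarz then
   force [dot h h] to be at most that distance. *)
apply/negP => hh; have [phi [t ht]] := test_vec_dense h hh.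
have := sip_CS2 dot_sip (x := h) (y := h - test_vec t) I I.
rewrite (sip_Br dot_sip)// h0 subr0 expr2 ler_pM2l//.
by move=> /le_lt_trans /(_ ht); rewrite ltxx.
Qed.

(** Two weak derivatives have the same pairing with every test function, and test functions are
    dense. This determines the element chosen in [partial]. *)
Lemma is_partial_unique i h g g' : is_partial i h g -> is_partial i h g' -> g = g'.
Proof.
move=> hg hg'; apply/eqP; rewrite -subr_eq0; apply/eqP/dot_test_eq0 => phi t.
rewrite (sip_Bl dot_sip)// -!pair_testE; apply/eqP; rewrite subr_eq0 -eqr_opp.
by rewrite -(hg phi t) -(hg' phi t).
Qed.

Lemma partialE i h g : is_partial i h g -> partial i h = g.
Proof.
move=> hg; apply: (is_partial_unique (i := i) (h := h)) => //.
by apply: (@xgetPex _ 0 [set g | is_partial i h g]); exists g.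
Qed.

Lemma partialP i h : H1_set h -> is_partial i h (partial i h).
Proof. by move=> /(_ i) [g hg]; rewrite (partialE hg). Qed.

Lemma is_partial_linear i (a : R) h k g l : is_partial i h g -> is_partial i k l ->
  is_partial i (a *: h + k) (a *: g + l).
Proof.
move=> hg kl phi t; have tD := testfunD1 (ei i) t.
rewrite !pair_testE !(sip_Dl dot_sip)// !(sip_Zl dot_sip)//.
by rewrite -!pair_testE hg// kl// opprD mulrN.
Qed.

Lemma H1_linear (a : R) h k : H1_set h -> H1_set k -> H1_set (a *: h + k).
Proof.
move=> Hh Hk i; exists (a *: partial i h + partial i k).
by apply: is_partial_linear; exact: partialP.
Qed.

Lemma partial_linear i (a : R) h k : H1_set h -> H1_set k ->
  partial i (a *: h + k) = a *: partial i h + partial i k.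
Proof.
by move=> Hh Hk; apply: partialE; apply: is_partial_linear; exact: partialP.
Qed.

Lemma H1_0 : H1_set (0 : V).
Proof.
move=> i; exists 0 => phi t; have tD := testfunD1 (ei i) t.
by rewrite !pair_testE !(sip_0l dot_sip)// oppr0.
Qed.

Lemma dot_grad_sip : semi_ip (@H1_set R n Omega) (@dot_grad R n Omega).
Proof.
split.
- exact: H1_0.
- by move=> a h k; exact: H1_linear.
- by move=> h k; apply: eq_bigr => i _; exact: (sip_sym dot_sip).
- move=> a h k l Hh Hk Hl; rewrite /dot_grad mulr_sumr -big_split/=.
  by apply: eq_bigr => i _; rewrite partial_linear// (sip_lin dot_sip).
- by move=> h _; apply: sumr_ge0 => i _; exact: dotL2_ge0.
Qed.

Lemma sqdist_gradE h k : H1_set h -> H1_set k ->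
  sqdist_grad h k = dot_grad (h - k) (h - k).
Proof.
move=> Hh Hk; apply: eq_bigr => i _; rewrite norm_sqr.
suff -> : partial i (h - k) = partial i h - partial i k by [].
by rewrite -scaleN1r addrC partial_linear// scaleN1r addrC.
Qed.

Lemma dot_test_test phi psi (t : testfun D phi) (s : testfun D psi) :
  dot (test_vec t) (test_vec s) = (\int[lebesgue_domain Omega]_x (phi x * psi x : R))%R.
Proof.
rewrite /dot dotL2_mk; have mphi := testfun_measurable t.
apply: eq_ae_Rintegral.
- by apply: measurable_funM => //; exact: measurable_funL2.
- by apply: measurable_funM => //; exact: testfun_measurable s.
- by apply: filterS (funL2_mk (testfun_Lfun s)) => x ->.
Qed.

(** Integration by parts: the derivative of [phi * psi], itself a test function, has integral 0. *)
Lemma testfun_partial phi i (t : testfun D phi) :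
  is_partial i (test_vec t) (test_vec (testfunD1 (ei i) t)).
Proof.
move=> psi s; rewrite (pair_testE (testfunD1 (ei i) s)) (pair_testE s) !dot_test_test.
have tM : testfun D (fun x => phi x * psi x : R^o) by apply: testfunM => //; case: s.
have := testfun_integral_derive i tM.
have E x : 'D_(ei i) (fun x => phi x * psi x : R^o) x =
    (phi x * 'D_(ei i) psi x : R) + ('D_(ei i) phi x * psi x : R).
  rewrite [RHS]addrC [X in X + _]mulrC [RHS]addrC.
  by apply: deriveM; [exact: testfun_derivable t|exact: testfun_derivable s].
under eq_integral do rewrite E.
move=> I0; apply/eqP; rewrite -addr_eq0 -RintegralD//.
- by rewrite /Rintegral I0.
- exact: integrable_mulL2 (testfun_Lfun t) (testfun_Lfun (testfunD1 (ei i) s)).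
- exact: integrable_mulL2 (testfun_Lfun (testfunD1 (ei i) t)) (testfun_Lfun s).
Qed.

Lemma test_vec_H1 phi (t : testfun D phi) : H1_set (test_vec t).
Proof. by move=> i; eexists; exact: testfun_partial. Qed.

Lemma partial_test_vec i phi (t : testfun D phi) :
  partial i (test_vec t) = test_vec (testfunD1 (ei i) t).
Proof. by apply: partialE; exact: testfun_partial. Qed.

Lemma dot_partial_test i h phi (t : testfun D phi) : H1_set h ->
  dot (partial i h) (test_vec t) = - dot h (test_vec (testfunD1 (ei i) t)).
Proof.
by move=> Hh; rewrite -!pair_testE (partialP i Hh t) opprK.
Qed.

Definition laplacian_fun phi : 'rV[R]_n -> R^o :=
  fun x => \sum_i 'D_(ei i) ('D_(ei i) phi) x.

Lemma testfun_sum (F : 'I_n -> 'rV[R]_n -> R^o) : (forall i, testfun D (F i)) ->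
  testfun D (fun x => \sum_i F i x).
Proof.
move=> tF; elim: (index_enum _) => [|i r IH].
  rewrite (_ : (fun x => _) = fun=> 0); first exact: testfun0.
  by apply/funext => x; rewrite big_nil.
rewrite (_ : (fun x => _) = fun x => F i x + \sum_(j <- r) F j x).
  exact: testfunD.
by apply/funext => x; rewrite big_cons.
Qed.

Lemma testfun_laplacian phi : testfun D phi -> testfun D (laplacian_fun phi).
Proof. by move=> t; apply: testfun_sum => i; do 2 apply: testfunD1. Qed.

Lemma test_vec_sum (F : 'I_n -> 'rV[R]_n -> R^o) (t : forall i, testfun D (F i))
    (s : testfun D (fun x => \sum_i F i x)) :
  test_vec s = \sum_i test_vec (t i).
Proof.
apply: eqL2P.
suff : forall r, \forall x \ae lebesgue_domain Omega,
    funL2 (\sum_(i <- r) test_vec (t i)) x = \sum_(i <- r) (F i x : R).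
  move=> /(_ (index_enum _)) h.
  by apply: filterS2 h (funL2_mk (testfun_Lfun s)) => x -> ->.
elim=> [|i r IH].
  have := funL2Z 0 (0 : V); rewrite scaler0; apply: filterS => x.
  by rewrite !big_nil mul0r.
rewrite big_cons.
apply: filterS3 IH (funL2_mk (testfun_Lfun (t i))) (funL2D (test_vec (t i)) (\sum_(i <- r) test_vec (t i))).
by move=> x Er Ei ->; rewrite big_cons Er Ei.
Qed.

(** With both derivatives on the test function only [L^2] pairings remain, and these are continuous
    in time even for [ut], which is continuous only with values in [L^2]. *)
Lemma dot_grad_test h phi (t : testfun D phi) : H1_set h ->
  dot_grad h (test_vec t) = - dot h (test_vec (testfun_laplacian t)).
Proof.
move=> Hh.
rewrite (test_vec_sum (fun i => testfunD1 (ei i) (testfunD1 (ei i) t))).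
have -> (r : seq 'I_n) : dot h (\sum_(i <- r) test_vec (testfunD1 (ei i) (testfunD1 (ei i) t))) =
    \sum_(i <- r) dot h (test_vec (testfunD1 (ei i) (testfunD1 (ei i) t))).
  elim: r => [|i r IH]; first by rewrite !big_nil (sip_sym dot_sip) (sip_0l dot_sip).
  by rewrite !big_cons (sip_Dr dot_sip)// IH.
rewrite -sumrN; apply: eq_bigr => i _.
by rewrite partial_test_vec dot_partial_test.
Qed.

Lemma is_laplacianE h g phi (t : testfun D phi) : is_laplacian h g ->
  dot h (test_vec (testfun_laplacian t)) = dot g (test_vec t).
Proof. by move=> hg; rewrite -!pair_testE; exact: hg. Qed.

(* [2 s (h, v) - s^2 c <= q h] for all [s] says that [(h, v) <= sqrt c * sqrt (q h)]. *)
Lemma dot_grad_dual h (e : R) : H1_set h -> 0 < e -> exists (v : V) (c : R),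
  [/\ 0 <= c, dot_grad h h <= 2 * dot h v - c + e &
   forall k, H1_set k -> forall s, 2 * s * dot k v - s ^+ 2 * c <= dot_grad k k].
Proof.
move=> Hh e0; have en0 : 0 < e / n.+1%:R by rewrite divr_gt0.
have /choice[phi hphi] (i : 'I_n) : exists phi, exists t : testfun D phi,
  dot (partial i h - test_vec t) (partial i h - test_vec t) < e / n.+1%:R.
  exact: test_vec_dense.
have [t ht] : {t : forall i, testfun D (phi i) & forall i,
    dot (partial i h - test_vec (t i)) (partial i h - test_vec (t i)) < e / n.+1%:R}.
  by exists (fun i => projT1 (cid (hphi i))) => i; exact: projT2 (cid (hphi i)).
(* For a test field [g] close to the gradient of [h], [c] is [|g|^2] and [v] is [- div g]. Then
   [2 (h, v) - c] is [|grad h|^2 - |grad h - g|^2]. *)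
pose c := \sum_i dot (test_vec (t i)) (test_vec (t i)).
pose v : V := - \sum_i test_vec (testfunD1 (ei i) (t i)).
have dv k : H1_set k -> dot k v = \sum_i dot (partial i k) (test_vec (t i)).
  move=> Hk; rewrite (sip_Nr dot_sip)//.
  have -> (r : seq 'I_n) : dot k (\sum_(i <- r) test_vec (testfunD1 (ei i) (t i))) =
      \sum_(i <- r) dot k (test_vec (testfunD1 (ei i) (t i))).
    elim: r => [|i r IH]; first by rewrite !big_nil (sip_sym dot_sip) (sip_0l dot_sip).
    by rewrite !big_cons (sip_Dr dot_sip)// IH.
  by rewrite -sumrN; apply: eq_bigr => i _; rewrite dot_partial_test.
exists v, c; split.
- by apply: sumr_ge0 => i _; exact: dotL2_ge0.
- rewrite dv//.
  have le1 : \sum_i dot (partial i h - test_vec (t i)) (partial i h - test_vec (t i)) <= e.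
    apply: (@le_trans _ _ (\sum_(i < n) e / n.+1%:R)).
      by apply: ler_sum => i _; exact/ltW/ht.
    rewrite sumr_const card_ord -[X in X <= _]mulr_natr -mulrA ler_piMr ?ltW//.
    by rewrite ltr_pdivrMl ?ltr0n// mulr1 ltr_nat.
  have E : \sum_i dot (partial i h - test_vec (t i)) (partial i h - test_vec (t i)) =
      dot_grad h h - 2 * (\sum_i dot (partial i h) (test_vec (t i))) + c.
    rewrite /dot_grad /c mulr_sumr -sumrB -big_split/=.
    by apply: eq_bigr => i _; rewrite (sip_sqrB dot_sip).
  by move: le1; rewrite E; lra.
- move=> k Hk s; rewrite dv// /c !mulr_sumr -sumrB; apply: ler_sum => i _.
have := dotL2_ge0 (partial i k - s *: test_vec (t i)).
rewrite -[dotL2 _ _]/(dot _ _) (sip_sqrB dot_sip)// (sip_sqrZ dot_sip)// (sip_Zr dot_sip)//.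
by lra.
Qed.

Lemma norm_H1_sqr h : H1_set h -> norm_H1 h ^+ 2 = dot h h + dot_grad h h.
Proof.
move=> Hh; rewrite /norm_H1 norm_sqr sqr_sqrtr// addr_ge0//; first exact: dotL2_ge0.
exact: (sip_ge0 dot_grad_sip).
Qed.

Lemma H10_P h : H10_set h <-> H1_set h /\ forall e : R, 0 < e ->
  exists phi (t : testfun D phi), norm_H1 (h - test_vec t) < e.
Proof.
split=> -[Hh He]; split => // e e0.
  have [g [phi [t gphi hg]]] := He _ e0; exists phi, t.
  suff -> : test_vec t = g by [].
  by apply: eqL2P; apply: filterS2 (funL2_mk (testfun_Lfun t)) gphi => x -> ->.
have [phi [t ht]] := He _ e0; exists (test_vec t), phi; split => //.
exact: (funL2_mk (testfun_Lfun t)).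
Qed.

Lemma norm_H1_sip : semi_ip (@H1_set R n Omega) (fun h k => dot h k + dot_grad h k).
Proof.
split.
- exact: H1_0.
- by move=> a h k; exact: H1_linear.
- by move=> h k; rewrite /= (sip_sym dot_sip) (sip_sym dot_grad_sip).
- move=> a h k l Hh Hk Hl.
  rewrite /= (sip_lin dot_sip a (x := h) (y := k) (z := l) I I I).
  by rewrite (sip_lin dot_grad_sip a Hh Hk Hl) mulrDr addrACA.
- move=> h Hh; apply: addr_ge0; first exact: dotL2_ge0.
  exact: (sip_ge0 dot_grad_sip).
Qed.

Lemma norm_H1E h : norm_H1 h = Num.sqrt (dot h h + dot_grad h h).
Proof. by rewrite /norm_H1 norm_sqr. Qed.

Lemma norm_H1_triangle h k : H1_set h -> H1_set k ->
  norm_H1 (h + k) <= norm_H1 h + norm_H1 k.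
Proof. by move=> Hh Hk; rewrite !norm_H1E; exact: (nb_triangle norm_H1_sip Hh Hk). Qed.

Lemma norm_H1Z (a : R) h : H1_set h -> norm_H1 (a *: h) = `|a| * norm_H1 h.
Proof. by move=> Hh; rewrite !norm_H1E; exact: (nbZ norm_H1_sip a Hh). Qed.

Lemma H10_H1 h : H10_set h -> H1_set h.
Proof. by case. Qed.

Lemma test_vec_linear (a : R) phi psi (t : testfun D phi) (s : testfun D psi)
    (r : testfun D (fun x => (a * phi x : R^o) + psi x)) :
  test_vec r = a *: test_vec t + test_vec s.
Proof.
apply: eqL2P.
have h1 := funL2_mk (testfun_Lfun r); have h2 := funL2_mk (testfun_Lfun s).
have h3 := funL2_mk (testfun_Lfun t).
have h4 := funL2D (a *: test_vec t) (test_vec s); have h5 := funL2Z a (test_vec t).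
have h6 : \forall x \ae lebesgue_domain Omega, funL2 (a *: test_vec t) x = a * (phi x : R).
  by apply: filterS2 h5 h3 => x -> ->.
have h7 : \forall x \ae lebesgue_domain Omega,
    funL2 (a *: test_vec t + test_vec s) x = a * (phi x : R) + (psi x : R).
  by apply: filterS3 h4 h6 h2 => x -> -> ->.
by apply: filterS2 h1 h7 => x -> ->.
Qed.

Lemma H10_linear (a : R) h k : H10_set h -> H10_set k -> H10_set (a *: h + k).
Proof.
move=> /H10_P[Hh Ah] /H10_P[Hk Ak]; apply/H10_P; split; first exact: H1_linear.
move=> e e0; have a1 : 0 < `|a| + 1 by rewrite ltr_wpDl.
have ea : 0 < e / 2 / (`|a| + 1) by rewrite !divr_gt0.
have e20 : 0 < e / 2 by rewrite divr_gt0.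
have [phi [t ht]] := Ah _ ea; have [psi [s hs]] := Ak _ e20.
exists (fun x => (a * phi x : R^o) + psi x), (testfunD (testfunZ a t) s).
rewrite (test_vec_linear t s).
have -> : a *: h + k - (a *: test_vec t + test_vec s) =
    a *: (h - test_vec t) + (k - test_vec s).
  by rewrite scalerBr opprD addrACA.
have St := sipB norm_H1_sip Hh (test_vec_H1 t).
have Ss := sipB norm_H1_sip Hk (test_vec_H1 s).
apply: le_lt_trans (norm_H1_triangle (sipZ norm_H1_sip a St) Ss) _.
rewrite norm_H1Z//.
rewrite (splitr e) ltr_leD ?(ltW hs)//.
apply: (@le_lt_trans _ _ ((`|a| + 1) * norm_H1 (h - test_vec t))).
  by rewrite ler_wpM2r ?lerDl ?sqrtr_ge0.
by rewrite mulrC -ltr_pdivlMr.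
Qed.

Lemma test_vec_H10 phi (t : testfun D phi) : H10_set (test_vec t).
Proof.
apply/H10_P; split; first exact: test_vec_H1.
move=> e e0; exists phi, t; rewrite subrr norm_H1E.
rewrite (sip_0l dot_sip)// (sip_0l dot_grad_sip) ?addr0 ?sqrtr0//.
exact: H1_0.
Qed.

Lemma H10_0 : H10_set (0 : V).
Proof.
have t := @testfun0 R n D; have := H10_linear (-1) (test_vec_H10 t) (test_vec_H10 t).
by rewrite scaleN1r addNr.
Qed.

Lemma H10_closed h : H1_set h ->
  (forall e : R, 0 < e -> exists2 k, H10_set k & norm_H1 (h - k) < e) -> H10_set h.
Proof.
move=> Hh He; apply/H10_P; split => // e e0; have e20 : 0 < e / 2 by rewrite divr_gt0.
have [k /H10_P[Hk Ak] hk] := He _ e20; have [phi [t ht]] := Ak _ e20.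
exists phi, t.
have -> : h - test_vec t = (h - k) + (k - test_vec t) by rewrite addrA subrK.
apply: le_lt_trans (norm_H1_triangle (sipB norm_H1_sip Hh Hk)
  (sipB norm_H1_sip Hk (test_vec_H1 t))) _.
by rewrite (splitr e); exact: (ltrD hk ht).
Qed.

End sobolev_facts.

(** * Lower integrals and strong measurability *)

(* The integral of a nonnegative function that is not measurable is a lower integral. *)
Section lower_integral.
Context d (T : measurableType d) (R : realType) (mu : {measure set T -> \bar R}).
Local Open Scope ereal_scope.
Implicit Types (D N : set T) (f g : T -> \bar R).

Lemma ge0_le_lower_integral D f g : (forall x, D x -> 0 <= f x) ->
  (forall x, D x -> f x <= g x) -> \int[mu]_(x in D) f x <= \int[mu]_(x in D) g x.
Proof.
move=> f0 fg.
rewrite !ge0_integralE//; last by move=> x Dx; exact: le_trans (f0 x Dx) (fg x Dx).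
apply: le_ereal_sup => _ [h hf <-]; exists h => // x.
by apply: le_trans (hf x) _; exact: lee_restrict.
Qed.

(** Only the smaller function is measurable: cutting it to 0 on the exceptional null set keeps its
    integral and makes the comparison hold everywhere. *)
Lemma ae_ge0_le_lower_integral D f g : measurable D -> measurable_fun D f ->
  (forall x, D x -> 0 <= f x) -> (forall x, D x -> 0 <= g x) ->
  (\forall x \ae mu, D x -> f x <= g x) ->
  \int[mu]_(x in D) f x <= \int[mu]_(x in D) g x.
Proof.
move=> mD mf f0 g0 [N [mN N0 sN]].
rewrite (ge0_negligible_integral mN)//.
have -> : \int[mu]_(x in D `\` N) f x = \int[mu]_(x in D) ((f \_ (~` N)) x).
  by rewrite setDE integral_mkcondr.
apply: ge0_le_lower_integral.
  by move=> x Dx; rewrite patchE; case: ifP => // _; exact: f0.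
move=> x Dx; rewrite patchE; case: ifPn => [|_]; last exact: g0.
by rewrite in_setC => /negP nx; apply: contrapT => fg; apply: nx; rewrite inE;
  apply: sN => /(_ Dx).
Qed.

(** Only the larger function is measurable: raising it to [+oo] on the exceptional null set keeps
    its integral and makes the comparison hold everywhere. *)
Lemma ae_ge0_lower_integral_le D f g : measurable D -> measurable_fun D g ->
  (forall x, D x -> 0 <= f x) -> (forall x, D x -> 0 <= g x) ->
  (\forall x \ae mu, D x -> f x <= g x) ->
  \int[mu]_(x in D) f x <= \int[mu]_(x in D) g x.
Proof.
move=> mD mg f0 g0 [N [mN N0 sN]].
pose h x := if x \in N then +oo else g x.
have mh : measurable_fun D h.
  apply: measurable_fun_if => //.
  - apply: (measurable_fun_bool true).
    rewrite (_ : _ @^-1` _ = N); first exact: measurableI.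
    by apply/seteqP; split => x /=; [move/set_mem|move/mem_set].
  - by apply: measurable_funS mg => //; exact: subIsetl.
apply: (@le_trans _ _ (\int[mu]_(x in D) h x)).
  apply: ge0_le_lower_integral => // x Dx; rewrite /h; case: ifPn => [_|].
    exact: leey.
  by rewrite notin_setE => nx; apply: contrapT => fg; apply: nx; apply: sN => /(_ Dx).
apply: ae_ge0_le_lower_integral => //.
  by move=> x Dx; rewrite /h; case: ifPn => // _; exact: g0.
exists N; split => // x /= nx; apply: contrapT => xN; apply: nx => _.
by rewrite /h memNset.
Qed.

Lemma ae_eq_lower_integral D f g : measurable D -> measurable_fun D g ->
  (\forall x \ae mu, D x -> f x = g x) ->
  \int[mu]_(x in D) f x = \int[mu]_(x in D) g x.
Proof.
move=> mD mg fg; rewrite integralE [RHS]integralE.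
have mgp : measurable_fun D g^\+ by exact: measurable_funepos.
have mgn : measurable_fun D g^\- by exact: measurable_funeneg.
congr (_ - _); apply/eqP; rewrite eq_le; apply/andP; split.
- apply: ae_ge0_lower_integral_le => //.
  by apply: filterS fg => x E Dx; rewrite !funeposE E.
- apply: ae_ge0_le_lower_integral => //.
  by apply: filterS fg => x E Dx; rewrite !funeposE E.
- apply: ae_ge0_lower_integral_le => //.
  by apply: filterS fg => x E Dx; rewrite !funenegE E.
- apply: ae_ge0_le_lower_integral => //.
  by apply: filterS fg => x E Dx; rewrite !funenegE E.
Qed.

End lower_integral.

Lemma ae_eq_lower_Rintegral d (T : measurableType d) (R : realType)
    (mu : {measure set T -> \bar R}) (D : set T) (f g : T -> R) :
  measurable D -> measurable_fun D g -> (\forall x \ae mu, D x -> f x = g x) ->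
  (\int[mu]_(x in D) f x = \int[mu]_(x in D) g x)%R.
Proof.
move=> mD mg fg; congr fine; apply: ae_eq_lower_integral => //.
- exact/measurable_EFinP.
- by apply: filterS fg => x /[apply] ->.
Qed.

#[global] Instance ae_lebesgue_filter (R : realType) :
  Filter (nbhs (almost_everywhere (@lebesgue_measure R))).
Proof. exact: ae_filter_ringOfSetsType. Qed.

(** * Strongly measurable functions and their Lebesgue points *)

Section bochner_measurability.
Variables (R : realType) (V : lmodType R) (X : nspace V) (T : R).
Local Notation leb := (@lebesgue_measure R).
Hypothesis nX : normed_subspace X.
Local Notation C := (carrier X).
Local Notation N := (nrm X).

Lemma nspaceD x y : C x -> C y -> C (x + y).
Proof. by case: nX => _ L _ _ _ Cx Cy; have := L 1 _ _ Cx Cy; rewrite scale1r. Qed.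

Lemma nspaceZ a x : C x -> C (a *: x).
Proof. by case: nX => C0 L _ _ _ Cx; have := L a _ _ Cx C0; rewrite addr0. Qed.

Lemma nspaceN x : C x -> C (- x).
Proof. by move=> Cx; rewrite -scaleN1r; exact: nspaceZ. Qed.

Lemma nspaceB x y : C x -> C y -> C (x - y).
Proof. by move=> Cx Cy; apply: nspaceD => //; rewrite -scaleN1r; exact: nspaceZ. Qed.

Lemma nspace_sum (I : Type) (r : seq I) (P : pred I) (F : I -> V) :
  (forall i, C (F i)) -> C (\sum_(i <- r | P i) F i).
Proof.
by move=> CF; apply: (big_ind C) => //; [case: nX|exact: nspaceD].
Qed.

Lemma nrm_ge0 x : C x -> 0 <= N x.
Proof. by case: nX => _ _ h _ _ /h[]. Qed.

Lemma nrmN x : C x -> N (- x) = N x.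
Proof. by case: nX => _ _ _ h _ Cx; rewrite -scaleN1r h// normrN1 mul1r. Qed.

Lemma nrm_triangle x y : C x -> C y -> N (x + y) <= N x + N y.
Proof. by case: nX => _ _ _ _ h; exact: h. Qed.

Lemma nrm_dist x y : C x -> C y -> `|N x - N y| <= N (x - y).
Proof.
move=> Cx Cy; have Cxy := nspaceB Cx Cy; have Cyx := nspaceB Cy Cx.
have h1 := nrm_triangle Cxy Cy; have h2 := nrm_triangle Cyx Cx.
rewrite !subrK in h1 h2; rewrite -[y - x]opprB nrmN// in h2.
by rewrite ler_norml; apply/andP; split; lra.
Qed.

(* A simple function takes its values among the subsums of its coefficients. *)
Lemma simple_valuedP (s : R -> V) : simple_valued X s ->
  exists (I : finType) (c : I -> V) (B : I -> set (measurableTypeR R)),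
    [/\ forall J, C (c J), forall J, measurable (B J),
        forall t, exists J, B J t /\ s t = c J &
        forall (F : V -> R) t, F (s t) = \sum_J (\1_(B J) t : R) * F (c J)].
Proof.
move=> [m [A [c [hA hs]]]].
exists {set 'I_m}, (fun J : {set 'I_m} => \sum_(k in J) c k),
  (fun J : {set 'I_m} => [set t | forall k, (t \in A k) = (k \in J)]).
have mem t (J : {set 'I_m}) : (forall k, (t \in A k) = (k \in J)) ->
    s t = \sum_(k in J) c k.
  move=> h; rewrite hs [RHS]big_mkcond/=; apply: eq_bigr => k _.
  by rewrite indicE h; case: (_ \in _); rewrite ?scale1r ?scale0r.
have ex t : forall k, (t \in A k) = (k \in [set k | t \in A k]%SET).
  by move=> k; rewrite inE.
split.
- by move=> J; apply: nspace_sum => k; exact: (hA k).2.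
- move=> J; rewrite (_ : mkset _ =
      \bigcap_(k in [set: 'I_m]) (if k \in J then A k else ~` A k)).
    apply: fin_bigcap_measurable => [|k _]; first exact: finite_finset.
    by case: ifP => _; [|apply: measurableC]; exact: (hA k).1.
  apply/seteqP; split=> t /= h k.
    by move=> _; have := h k; case: ifP => _; [move/set_mem|move/negbT; rewrite notin_setE].
  have := h k I; case: ifP => _ /=; first by move/mem_set.
  by move=> nA; apply/negbTE; rewrite notin_setE.
- move=> t; exists [set k | t \in A k]%SET; split; first exact: ex.
  exact/mem/ex.
- move=> F t; rewrite (bigD1 [set k | t \in A k]%SET)//= [X in _ + X]big1 => [|J nJ].
    by rewrite addr0 indicE mem_set ?mul1r ?(mem t _ (ex t))//=; exact: ex.
  rewrite indicE memNset ?mul0r// => h; move: nJ.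
  by apply/negP; rewrite negbK; apply/eqP/setP => k; rewrite inE -h.
Qed.

Lemma measurable_simple_valued (s : R -> V) (F : V -> R) : simple_valued X s ->
  measurable_fun setT (fun t : measurableTypeR R => F (s t)).
Proof.
move=> /simple_valuedP[I [c [B [_ mB _ hF]]]].
rewrite (_ : (fun t => _) = fun t => \sum_J (\1_(B J) t : R) * F (c J)); last first.
  by apply/funext => t.
by apply: measurable_sum => J; apply: measurable_funM => //; exact: measurable_indic.
Qed.

(** The norm of [f t - c] is the limit of the norms of [s k t - c] on a measurable set of full
    measure in []0, T[]. Cutting to 0 elsewhere discards the junk values of the norm. *)
Lemma nrm_ae_measurable (f : R -> V) c : (\forall t \ae leb, 0 < t < T -> C (f t)) ->
  strongly_measurable X T f -> C c -> exists g : measurableTypeR R -> R,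
  [/\ measurable_fun setT g, forall t, 0 <= g t, forall t, ~ (0 < t < T) -> g t = 0 &
      \forall t \ae leb, 0 < t < T -> g t = N (f t - c)].
Proof.
move=> Cf [s hs cvs] Cc.
have : \forall t \ae leb, (0 < t < T -> C (f t)) /\
    (0 < t < T -> N (s k t - f t) @[k --> \oo] --> (0 : R)) by apply: filterI.
move=> [E [mE E0 sE]].
pose D : set (measurableTypeR R) := `]0%R, T[%classic `\` E.
have mD : measurable D by apply: measurableD => //; exact: measurable_itv.
have good t : D t -> C (f t) /\ N (s k t - f t) @[k --> \oo] --> (0 : R).
  move=> [/= tT nE]; have t0T : 0 < t < T by move: tT; rewrite in_itv.
  have : ~ ~ ((0 < t < T -> C (f t)) /\
      (0 < t < T -> N (s k t - f t) @[k --> \oo] --> (0 : R))).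
    by move=> h; apply: nE; exact: sE.
  by move=> /contrapT[h1 h2]; split; [exact: h1|exact: h2].
have Cs k t : C (s k t).
  by have [I [b [B [Cb _ /(_ t)[J [_ ->]] _]]]] := simple_valuedP (hs k).
pose g (t : measurableTypeR R) : R := (\1_D t : R) * N (f t - c).
pose h k (t : measurableTypeR R) : R := (\1_D t : R) * N (s k t - c).
have mh k : measurable_fun setT (h k).
  apply: measurable_funM; first exact: measurable_indic.
  exact: (measurable_simple_valued (fun v => N (v - c)) (hs k)).
have gD t : D t -> g t = N (f t - c).
  by move=> Dt; rewrite /g indicE mem_set// mul1r.
have gnD t : ~ D t -> g t = 0 by move=> Dt; rewrite /g indicE memNset// mul0r.
exists g; split.
- apply: (measurable_fun_cvg mh) => t _.
  have [Dt|nD] := pselect (D t); last first.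
    rewrite gnD//; apply: cvg_near_cst; apply: nearW => k.
    by rewrite /h indicE memNset// mul0r.
  have [Cft cv] := good _ Dt.
  apply/cvgrPdist_le => e e0; have /cvgrPdist_le/(_ _ e0) := cv.
  apply: filterS => k; rewrite sub0r normrN gD// /h indicE mem_set// mul1r => hk.
  rewrite distrC (le_trans (nrm_dist _ _))//; [exact: nspaceB..|].
  by rewrite opprB addrA subrK (le_trans (ler_norm _)).
- move=> t; have [Dt|nD] := pselect (D t); last by rewrite gnD.
  by rewrite gD//; apply: nrm_ge0; apply: nspaceB => //; exact: (good _ Dt).1.
- by move=> t nt; apply: gnD => -[/=]; rewrite in_itv.
- exists E; split => // t /= nt; apply: contrapT => nE; apply: nt => tT.
  by apply: gD; split => //=; rewrite in_itv.
Qed.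

Lemma nrm_integrable (f : R -> V) c (g : measurableTypeR R -> R) :
  in_L2X X T f -> C c -> measurable_fun setT g -> (forall t, 0 <= g t) ->
  (forall t, ~ (0 < t < T) -> g t = 0) ->
  (\forall t \ae leb, 0 < t < T -> g t = N (f t - c)) ->
  leb.-integrable setT (EFin \o g).
Proof.
move=> [Cf sf fin] Cc mg g0 gout gae.
have C0 : C 0 by case: nX.
have [g1 [mg1 g10 g1out g1ae]] := nrm_ae_measurable Cf sf C0.
have mI : measurable (`]0%R, T[ : set (measurableTypeR R)) by exact: measurable_itv.
have msq : measurable_fun setT (fun t : measurableTypeR R => (g1 t ^+ 2)%:E).
  by apply/measurable_EFinP; exact: measurable_funX.
have i1 : (\int[leb]_(t in `]0%R, T[) (g1 t ^+ 2)%:E < +oo)%E.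
  apply: le_lt_trans fin; apply: ae_ge0_le_lower_integral => //.
  - exact: (measurable_funS measurableT (@subsetT _ _) msq).
  - by move=> t _; rewrite lee_fin sqr_ge0.
  - by move=> t _; rewrite lee_fin sqr_ge0.
  - by apply: filterS g1ae => t E /=; rewrite in_itv/= => /E ->; rewrite subr0.
have mEg : measurable_fun setT (EFin \o g) by exact/measurable_EFinP.
apply/integrableP; split => //.
have -> : (\int[leb]_t `|(EFin \o g) t| = \int[leb]_(t in `]0%R, T[) (g t)%:E)%E.
  rewrite [RHS]integral_mkcond; apply: eq_integral => t _.
  rewrite patchE /= ger0_norm//; case: ifPn => //; rewrite notin_setE /= in_itv/= => nt.
  by rewrite gout.
(* The inequality [x <= 1 + x^2] turns square integrability on a bounded interval into
   integrability. *)
apply: (@le_lt_trans _ _ (\int[leb]_(t in `]0%R, T[) ((1 + N c)%:E + (g1 t ^+ 2)%:E))%E).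
  apply: ae_ge0_le_lower_integral => //.
  - exact: (measurable_funS measurableT (@subsetT _ _) mEg).
  - by move=> t _; rewrite lee_fin.
  - by move=> t _; rewrite -EFinD lee_fin addr_ge0 ?sqr_ge0// addr_ge0// nrm_ge0.
  - have h : \forall t \ae leb, (0 < t < T -> C (f t)) /\ (0 < t < T -> g t = N (f t - c))
      by apply: filterI.
    apply: filterS2 h g1ae => t [hC hg] hg1 /=; rewrite in_itv/= => tT.
    rewrite -EFinD lee_fin hg// hg1// subr0.
    have := nrm_triangle (hC tT) (nspaceN Cc); rewrite nrmN// => h.
    apply: (le_trans h); have := sqr_ge0 (N (f t) - 1); rewrite !expr2; nra.
rewrite ge0_integralD//.
- have fi : (leb `]0%R, T[%classic < +oo)%E.
    by rewrite lebesgue_measure_itv/= lte_fin; case: ifP => // _; rewrite -EFinB ltry.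
  rewrite integral_cst// lte_add_pinfty// lte_mul_pinfty//.
  by rewrite lee_fin addr_ge0// nrm_ge0.
- by move=> t _; rewrite lee_fin addr_ge0// nrm_ge0.
- by move=> t _; rewrite lee_fin sqr_ge0.
- exact: (measurable_funS measurableT (@subsetT _ _) msq).
Qed.

(** A vector-valued form of the Lebesgue differentiation theorem. The scalar theorem is applied to
    the distance from [f] to each value of the approximating simple functions, which are countably
    many, so that one null set serves all of them; a centre [c] close to [f t] is then picked among
    these values. *)
Lemma ae_forward_average (f : R -> V) : in_L2X X T f ->
  \forall t \ae leb, 0 < t < T -> forall e : R, 0 < e ->
  exists (c : V) (g : measurableTypeR R -> R),
  [/\ C c /\ N (f t - c) < e, leb.-integrable setT (EFin \o g), forall s, 0 <= g s,
    \forall s \ae leb, 0 < s < T -> g s = N (f s - c) &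
    \forall h \near 0^'+, (\int[leb]_(s in `]t, t + h]) g s <= e * h)%R].
Proof.
move=> Lf; have [Cf sf fin] := Lf; have [s hs cvs] := sf.
pose G t c (g : measurableTypeR R -> R) :=
  [/\ leb.-integrable setT (EFin \o g), forall s, 0 <= g s,
    \forall s \ae leb, 0 < s < T -> g s = N (f s - c) &
    is_derive t (1 : R) (fun x => \int[leb]_(s in `]-oo, x]) g s)%R (N (f t - c))].
have avg c : C c -> \forall t \ae leb, 0 < t < T -> exists g, G t c g.
  move=> Cc; have [g [mg g0 gout gae]] := nrm_ae_measurable Cf sf Cc.
  have ig := nrm_integrable Lf Cc mg g0 gout gae.
  have ig' y : leb.-integrable `]-oo, y] (EFin \o g) by apply: integrableS ig.
  have lg : locally_integrable [set: R] g.
    by apply: open_integrable_locally => //; exact: openT.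
  have := FTC1Ny ig' lg; move=> /(filterI gae); apply: filterS => t [gt [dt1 dt2]] tT.
  exists g; split => //; apply: DeriveDef => //.
  by rewrite -derive1E dt2 gt.
have avgs : \forall t \ae leb, forall k, 0 < t < T -> C (s k t) /\ exists g, G t (s k t) g.
  apply: ae_foralln => k.
  have [I [b [B [Cb _ sb _]]]] := simple_valuedP (hs k).
  have : \forall t \ae leb, forall J, 0 < t < T -> exists g, G t (b J) g.
    by apply: filter_forall => J; exact: avg.
  by apply: filterS => t ht tT; have [J [_ ->]] := sb t; split => //; exact: ht.
apply: filterS3 Cf cvs avgs => t /[swap] ct /[swap] at_ Cft tT e e0.
have /cvgrPdist_lt/(_ _ e0) := ct tT; move=> [k _ /(_ k (leqnn k))] /=.
rewrite sub0r normrN => hk.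
have [Csk [g [ig g0 gae [dg Dg]]]] := at_ k tT.
have Ne : N (f t - s k t) < e.
  rewrite -[f t - s k t]opprB nrmN; last exact: nspaceB (Cft tT).
  exact: le_lt_trans (ler_norm _) hk.
exists (s k t), g; split => //.
have cv : h^-1 *: (((fun x => \int[leb]_(s in `]-oo, x]) g s)%R \o shift t) (h *: (1 : R)) -
    (\int[leb]_(s in `]-oo, t]) g s)%R) @[h --> 0^'] --> (N (f t - s k t) : R).
  by rewrite -Dg; exact: dg.
have /cvgr_le /(_ _ Ne) := cv.
rewrite !near_withinE; apply: filterS => h hle h0.
have := hle (lt0r_neq0 h0); rewrite /= /GRing.scale/= mulr1.
rewrite ler_pdivrMl// [h * e]mulrC [h + t]addrC.
rewrite Rintegral_itvB//; first by apply: integrableS ig.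
by rewrite bnd_simp lerDl ltW.
Qed.

End bochner_measurability.

(** * The energy estimate *)

(* [dt] and [a] are the inner products of L^2 and of the gradients, [Tp] relates
   a test function to its Laplacian; [gel_dual] is the weak lower semicontinuity of
   the gradient norm with respect to [dt]. *)
Record gelfand (R : realType) (V : lmodType R) (dt a : V -> V -> R) (H1 H10 : set V)
    (Tp : V -> V -> Prop) := Gelfand {
  gel_dt : semi_ip setT dt ;
  gel_def : forall h, dt h h = 0 -> h = 0 ;
  gel_a : semi_ip H1 a ;
  gel_sub : forall h, H10 h -> H1 h ;
  gel_0 : H10 0 ;
  gel_lin : forall (s : R) h k, H10 h -> H10 k -> H10 (s *: h + k) ;
  gel_closed : forall h, H1 h -> (forall e : R, 0 < e -> exists2 k, H10 k &
    dt (h - k) (h - k) + a (h - k) (h - k) < e) -> H10 h ;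
  gel_test : forall p q, Tp p q -> H10 p ;
  gel_lap : forall p q, Tp p q -> forall h, H1 h -> a h p = - dt h q ;
  gel_dense : forall h (e : R), H10 h -> 0 < e -> exists p q, Tp p q /\
    dt (h - p) (h - p) + a (h - p) (h - p) < e ;
  gel_dual : forall h (e : R), H1 h -> 0 < e -> exists v c,
    [/\ 0 <= c, a h h <= 2 * dt h v - c + e &
     forall k, H1 k -> forall s, 2 * s * dt k v - s ^+ 2 * c <= a k k] }.

Lemma quadratic_bound (R : realType) (p c Q : R) : 0 <= c ->
  (forall s, 2 * s * p - s ^+ 2 * c <= Q) -> p ^+ 2 <= c * Q.
Proof.
move=> c0 h; have [cz|cn] := eqVneq c 0.
  have [->|p0] := eqVneq p 0; first by rewrite cz mul0r expr0n.
  have := h ((Q + 1) / (2 * p)); rewrite cz mulr0 subr0.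
  have -> : 2 * ((Q + 1) / (2 * p)) * p = Q + 1 by field.
  by rewrite gerDl ler10.
have := h (p / c).
have -> : 2 * (p / c) * p - (p / c) ^+ 2 * c = p ^+ 2 / c by field.
by rewrite ler_pdivrMr ?lt0r ?cn// mulrC.
Qed.

Lemma ae_le_Rintegral d (T : measurableType d) (R : realType)
    (mu : {measure set T -> \bar R}) (D : set T) (f g : T -> R) :
  measurable D -> mu.-integrable D (EFin \o f) -> mu.-integrable D (EFin \o g) ->
  (\forall x \ae mu, D x -> f x <= g x) ->
  (\int[mu]_(x in D) f x <= \int[mu]_(x in D) g x)%R.
Proof.
move=> mD If Ig fg.
have mf : measurable_fun D f by apply/measurable_EFinP; exact: measurable_int If.
have mg : measurable_fun D g by apply/measurable_EFinP; exact: measurable_int Ig.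
pose m x := Num.max (f x) (g x).
have mm : measurable_fun D m by exact: measurable_maxr.
have Im : mu.-integrable D (EFin \o m).
  apply: (le_integrable mD _ _ (integrableD mD (integrable_abse If) (integrable_abse Ig))).
    exact/measurable_EFinP.
  move=> x _; rewrite /= lee_fin [leRHS]ger0_norm ?addr_ge0// /m.
  by case: (leP (f x) (g x)) => _; rewrite ?lerDl ?lerDr.
rewrite -(@ae_eq_lower_Rintegral _ _ _ mu D m g)//.
  by apply: le_Rintegral => // x _; rewrite /m le_max lexx.
by apply: filterS fg => x h Dx; rewrite /m max_r// h.
Qed.

Section gelfand_theory.
Variables (R : realType) (V : lmodType R) (dt a : V -> V -> R) (H1 H10 : set V)
  (Tp : V -> V -> Prop).
Hypothesis G : gelfand dt a H1 H10 Tp.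
Local Notation Dt := (gel_dt G).
Local Notation A := (gel_a G).
Local Notation leb := (@lebesgue_measure R).
Local Notation q h := (dt h h + a h h).
Local Notation nq h := (Num.sqrt (dt h h + a h h)).

Lemma gel_q : semi_ip H1 (fun h k => dt h k + a h k).
Proof.
split.
- exact: sip0 A.
- exact: sipL A.
- by move=> h k; rewrite /= (sip_sym Dt) (sip_sym A).
- move=> s h k l Hh Hk Hl; rewrite /= (sip_lin Dt s (x := h) (y := k) (z := l) I I I).
  by rewrite (sip_lin A s Hh Hk Hl) mulrDr addrACA.
- by move=> h Hh; apply: addr_ge0; [exact: (sip_ge0 Dt)|exact: (sip_ge0 A)].
Qed.

Lemma H10D h k : H10 h -> H10 k -> H10 (h + k).
Proof. by move=> Hh Hk; have := gel_lin G 1 Hh Hk; rewrite scale1r. Qed.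

Lemma H10Z (s : R) h : H10 h -> H10 (s *: h).
Proof. by move=> Hh; have := gel_lin G s Hh (gel_0 G); rewrite addr0. Qed.

Lemma H10B h k : H10 h -> H10 k -> H10 (h - k).
Proof. by move=> Hh Hk; apply: H10D => //; rewrite -scaleN1r; exact: H10Z. Qed.

(** Adding [h] to the dual vector of the gradient accounts for the [L^2] part: the whole [H^1] norm
    is recovered, up to [e], from the pairing with a single vector of [L^2]. *)
Lemma gel_dual_q h (e : R) : H1 h -> 0 < e -> exists v c,
  [/\ 0 <= c, q h <= 2 * dt h v - c + e &
   forall k, H1 k -> `|dt k v| <= Num.sqrt c * nq k].
Proof.
move=> Hh e0; have [v [c [c0 hv hk]]] := gel_dual G Hh e0.
have d0 : 0 <= dt h h by exact: (sip_ge0 Dt).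
exists (h + v), (dt h h + c); split.
- exact: addr_ge0.
- by rewrite (sip_Dr Dt)//; lra.
- move=> k Hk; rewrite -sqrtrM ?addr_ge0// -sqrtr_sqr ler_wsqrtr//.
  apply: quadratic_bound; first exact: addr_ge0.
  move=> s; rewrite (sip_Dr Dt)//.
  have := hk k Hk s; have := sip_ge0 Dt (x := k - s *: h) I.
  by rewrite (sip_sqrB Dt)// (sip_sqrZ Dt)// (sip_Zr Dt)//; lra.
Qed.

Definition spaceH1 : nspace V := NSpace H1 (fun h => nq h).

Lemma spaceH1_normed : normed_subspace spaceH1.
Proof.
split.
- exact: sip0 A.
- by move=> s x y; exact: sipL A s x y.
- move=> x Hx; split; first exact: sqrtr_ge0.
  move=> /eqP; rewrite /= sqrtr_eq0 => x0; apply: (gel_def G); apply/eqP.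
  rewrite eq_le (sip_ge0 Dt)// andbT (le_trans _ x0)// lerDl.
  exact: (sip_ge0 A).
- by move=> s x Hx; exact: (nbZ gel_q s Hx).
- by move=> x y Hx Hy; exact: (nb_triangle gel_q Hx Hy).
Qed.

(** * Membership of the time derivative in [H^1_0] *)

Section derivative_in_H10.
Variables (T : R) (y z : R -> V).
Hypotheses (Hy : forall t, 0 <= t <= T -> H10 (y t))
  (Hd : forall (v : V) (t : R), 0 < t < T -> is_derive t (1 : R) (fun s => dt (y s) v) (dt (z t) v))
  (Hc : forall v : V, continuous (fun s => dt (z s) v))
  (Hz : in_L2X spaceH1 T z).

(** The increment of [y - s c] would be the vector-valued integral of [z - c]. Pairing with a dual
    vector reduces the claim to the scalar fundamental theorem of calculus, and the duality of
    [gel_dual_q] brings the [H^1] norm back. *)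
Lemma difference_quotient_bound t h c (g : measurableTypeR R -> R) :
  0 < t -> 0 < h -> t + h < T -> H1 c ->
  leb.-integrable setT (EFin \o g) ->
  (\forall s \ae leb, 0 < s < T -> g s = nq (z s - c)) ->
  nq (y (t + h) - y t - h *: c) <= (\int[leb]_(s in `]t, (t + h)%R]) g s)%R.
Proof.
move=> t0 h0 thT Hcc Ig gae; set m := (X in _ <= X).
have Hyt : H10 (y t) by apply: Hy; apply/andP; split; lra.
have Hyth : H10 (y (t + h)) by apply: Hy; apply/andP; split; lra.
pose W := y (t + h) - y t - h *: c.
have HW : H1 W.
  apply: (sipB A); last exact: (sipZ A).
  by apply: (sipB A); exact: (gel_sub G).
have Dsub : `]t, (t + h)%R] `<=` [set: R] by [].
have Ig' : leb.-integrable `]t, (t + h)%R] (EFin \o g) by apply: integrableS Ig.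
have [Cz _ _] := Hz.
have mle v k : 0 <= k -> (forall x, H1 x -> `|dt x v| <= Num.sqrt k * nq x) ->
    dt W v <= Num.sqrt k * m.
  move=> k0 hv.
  have cz : continuous (fun s => dt (z s) v - dt c v).
    by apply: continuous_fctB; [exact: Hc|exact: continuous_fctC].
  have dF (s : R) : t <= s <= t + h ->
      is_derive s (1 : R) (fun s => dt (y s) v - dt c v * s) (dt (z s) v - dt c v).
    move=> /andP[ts sth]; have s0T : 0 < s < T by apply/andP; split; lra.
    have := is_derive_sub (Hd v s0T) (is_derive_scale (dt c v) (is_derive_id s (1 : R))).
    by rewrite mulr1.
  have th : t <= t + h by lra.
  have := Rintegral_derive th (continuous_subspaceT cz) dF.
  have -> : dt (y (t + h)) v - dt c v * (t + h) - (dt (y t) v - dt c v * t) = dt W v.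
    by rewrite /W !(sip_Bl Dt)// (sip_Zl Dt)//; ring.
  have Icz : leb.-integrable `[t, t + h] (EFin \o (fun s => dt (z s) v - dt c v)).
    exact: continuous_integrable_ccT.
  have Icz' : leb.-integrable `]t, (t + h)%R] (EFin \o (fun s => dt (z s) v - dt c v)).
    by apply: integrableS Icz => //; apply: subset_itvr; rewrite bnd_simp.
  rewrite -(Rintegral_itv_obnd_cbnd Icz') => <-.
  rewrite /m -RintegralZl//.
  apply: ae_le_Rintegral => //.
    rewrite (_ : EFin \o _ = fun s => ((Num.sqrt k)%:E * (EFin \o g) s)%E).
      exact: integrableZl.
    by apply/funext => s; rewrite /= EFinM.
  have Cz' : \forall s \ae leb, 0 < s < T -> H1 (z s) := Cz.
  apply: filterS2 Cz' gae => s Hs gs; rewrite /= in_itv/= => /andP[ts sth].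
  have s0T : 0 < s < T by apply/andP; split; lra.
  rewrite gs// -(sip_Bl Dt)//; apply: le_trans (ler_norm _) _.
  by apply: hv; apply: (sipB A) => //; exact: Hs.
have m0 : 0 <= m.
  rewrite /m -[leLHS](_ : \int[leb]_(s in `]t, (t + h)%R]) (0 : R) = 0)%R; last first.
    by rewrite Rintegral_cst// mul0r.
  apply: ae_le_Rintegral => //; first exact: integrable0.
  apply: filterS gae => s gs; rewrite /= in_itv/= => /andP[ts sth].
  by rewrite gs ?sqrtr_ge0//; apply/andP; split; lra.
rewrite -(@ler_pXn2r _ 2)// ?nnegrE ?sqrtr_ge0//.
rewrite sqr_sqrtr; last exact: (sip_ge0 gel_q HW).
apply/ler_addgt0Pl => e e0.
have [v [k [k0 hk hv]]] := gel_dual_q HW e0.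
have := mle v k k0 hv => h1; apply: (le_trans hk).
(* The dual bound reads [q W <= 2 sqrt k m - k + e], which is at most [m^2 + e]. *)
have := sqr_ge0 (m - Num.sqrt k); rewrite sqrrB sqr_sqrtr//.
rewrite [m * _]mulrC; move: h1; set w := Num.sqrt k * m; lra.
Qed.

Lemma derivative_in_H10 : \forall t \ae leb, 0 < t < T -> H10 (z t).
Proof.
have avg := ae_forward_average spaceH1_normed Hz.
have [Cz _ _] := Hz.
have Cz' : \forall s \ae leb, 0 < s < T -> H1 (z s) := Cz.
apply: filterS2 Cz' avg => t Hzt avgt t0T; have Hz1 := Hzt t0T.
apply: (gel_closed G) => // e e0.
(* Both [z t] and the difference quotient will be within [d] of the centre [c], hence within [2 d]
   of each other, and [(2 d)^2 = 4 e / 9]. *)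
pose d := Num.sqrt e / 3; have d0 : 0 < d by rewrite divr_gt0// sqrtr_gt0.
have [c [g [[Hcc Nc] Ig g0 gae gavg]]] := avgt t0T d d0.
have /andP[t0 tT] := t0T.
near (0 : R)^'+ => h.
have h0 : 0 < h by [].
have thT : t + h < T.
  by rewrite -ltrBrDl; near: h; apply: nbhs_right_lt; rewrite subr_gt0.
have hg : (\int[leb]_(s in `]t, (t + h)%R]) g s <= d * h)%R by near: h.
have bd := difference_quotient_bound t0 h0 thT Hcc Ig gae.
have Hyt : H10 (y t) by apply: Hy; apply/andP; split; lra.
have Hyth : H10 (y (t + h)) by apply: Hy; apply/andP; split; lra.
pose k := h^-1 *: (y (t + h) - y t).
have Hk : H10 k by apply: H10Z; exact: H10B.
have Hk1 := gel_sub G Hk.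
exists k => //.
have h1 : nq (k - c) <= d.
  have E : k - c = h^-1 *: (y (t + h) - y t - h *: c).
    by rewrite scalerBr scalerA mulVf ?gt_eqF// scale1r.
  have HW : H1 (y (t + h) - y t - h *: c).
    apply: (sipB A); last exact: (sipZ A).
    by apply: (sipB A); exact: (gel_sub G).
  rewrite E (nbZ gel_q h^-1 HW) gtr0_norm ?invr_gt0//.
  by rewrite ler_pdivrMl// mulrC; exact: le_trans bd hg.
have h2 : nq (z t - k) <= 2 * d.
  have Hkc := sipB A Hk1 Hcc; have Hzc := sipB A Hz1 Hcc.
  have := nb_triangleB gel_q Hzc Hkc.
  rewrite opprB addrA subrK => /le_trans; apply.
  by have := ltW Nc; rewrite /=; lra.
have HX := sipB A Hz1 Hk1.
rewrite -(nb_sqr gel_q HX).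
apply: (@le_lt_trans _ _ ((2 * d) ^+ 2)).
  have d20 : 0 <= 2 * d by rewrite mulr_ge0// ltW.
  by rewrite lerXn2r ?nnegrE ?sqrtr_ge0.
rewrite /d exprMn expr_div_n sqr_sqrtr ?ltW//.
by rewrite mulrA ltr_pdivrMr ?exprn_gt0// mulrC ltr_pM2l// -!natrX ltr_nat.
Unshelve. all: by end_near. Qed.

End derivative_in_H10.
End gelfand_theory.

(** * Differentiability in norm *)

Section norm_derivative.
Variables (R : realType) (V : lmodType R) (dt : V -> V -> R).
Hypothesis Dt : semi_ip setT dt.
Local Notation nd h := (Num.sqrt (dt h h)).
Implicit Types (f g : R -> V) (t : R) (u v d : V).

(** The module [V] carries no topology, so convergence of the difference quotients is expressed
    through the seminorm of [dt]. *)
Definition ndiff f t d : Prop :=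
  nd (h^-1 *: (f (h + t) - f t) - d) @[h --> (0 : R)^'] --> (0 : R).

Lemma ndiff_dist f t d : (forall e : R, 0 < e ->
    \forall h \near (0 : R)^', nd (h^-1 *: (f (h + t) - f t) - d) <= e) -> ndiff f t d.
Proof.
move=> H; apply/cvgr0Pnorm_le => e e0; apply: filterS (H e e0) => h.
by rewrite ger0_norm ?sqrtr_ge0.
Qed.

Lemma ndiffP f t d (e : R) : ndiff f t d -> 0 < e ->
  \forall h \near (0 : R)^', nd (h^-1 *: (f (h + t) - f t) - d) <= e.
Proof.
move=> /cvgr0Pnorm_le h e0; apply: filterS (h e e0) => k.
by rewrite ger0_norm ?sqrtr_ge0.
Qed.

Lemma linear_is_derive (l : V -> R) (B : R) f t d :
  (forall u v, l (u - v) = l u - l v) -> (forall (c : R) u, l (c *: u) = c * l u) ->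
  (forall u, `|l u| <= B * nd u) -> ndiff f t d ->
  is_derive t (1 : R) (fun s => l (f s)) (l d).
Proof.
move=> lB lZ lb fd.
have B0 : 0 <= `|B| by [].
suff cv : h^-1 *: (((fun s => l (f s)) \o shift t) (h *: (1 : R)) - l (f t))
    @[h --> 0^'] --> (l d).
  by apply: DeriveDef; [apply/cvg_ex; exists (l d)|exact: cvg_lim].
apply/cvgrPdist_le => e e0.
have e1 : 0 < e / (`|B| + 1) by rewrite divr_gt0// ltr_wpDl.
apply: filterS (ndiffP fd e1) => h hle.
have -> : h^-1 *: (((fun s => l (f s)) \o shift t) (h *: (1 : R)) - l (f t)) =
    l (h^-1 *: (f (h + t) - f t)).
  by rewrite lZ lB /= -[h *: 1]/(h * 1) mulr1.
rewrite distrC -lB (le_trans (lb _))//.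
apply: (@le_trans _ _ ((`|B| + 1) * nd (h^-1 *: (f (h + t) - f t) - d))).
  by rewrite ler_wpM2r ?sqrtr_ge0// (le_trans (ler_norm _))// lerDl.
by rewrite mulrC -ler_pdivlMr// ltr_wpDl.
Qed.

Lemma dt_CS u v : `|dt u v| <= nd u * nd v.
Proof. exact: (sip_CS Dt). Qed.

Lemma ndiffB f g t d e : ndiff f t d -> ndiff g t e ->
  ndiff (fun s => f s - g s) t (d - e).
Proof.
move=> fd ge; apply: ndiff_dist => eps eps0.
have e2 : 0 < eps / 2 by rewrite divr_gt0.
apply: filterS2 (ndiffP fd e2) (ndiffP ge e2) => h h1 h2.
have -> : h^-1 *: (f (h + t) - g (h + t) - (f t - g t)) - (d - e) =
    (h^-1 *: (f (h + t) - f t) - d) - (h^-1 *: (g (h + t) - g t) - e).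
  have E (x1 x2 x3 x4 : V) : x1 - x2 - (x3 - x4) = (x1 - x3) - (x2 - x4).
    by rewrite !opprD !opprK addrACA.
  by rewrite E scalerBr E.
rewrite (le_trans (nb_triangleB Dt _ _))//.
by rewrite (splitr eps) lerD.
Qed.

Lemma ndiffZ (c : R) f t d : ndiff f t d -> ndiff (fun s => c *: f s) t (c *: d).
Proof.
move=> fd; apply: ndiff_dist => e e0.
have e1 : 0 < e / (`|c| + 1) by rewrite divr_gt0// ltr_wpDl.
apply: filterS (ndiffP fd e1) => h hle.
have -> : h^-1 *: (c *: f (h + t) - c *: f t) - c *: d =
    c *: (h^-1 *: (f (h + t) - f t) - d).
  by rewrite [RHS]scalerBr -[c *: f (h + t) - c *: f t]scalerBr !scalerA mulrC.
rewrite (nbZ Dt)//.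
apply: (@le_trans _ _ ((`|c| + 1) * nd (h^-1 *: (f (h + t) - f t) - d))).
  by rewrite ler_wpM2r ?sqrtr_ge0// lerDl.
by rewrite mulrC -ler_pdivlMr// ltr_wpDl.
Qed.

Lemma ndiff_shift (k : R) f t d : ndiff f (t + k) d -> ndiff (fun s => f (s + k)) t d.
Proof.
by rewrite /ndiff; under [X in _ -> X @ _ --> _]eq_fun do rewrite -addrA.
Qed.

(** Writing [f (t + h) = f t + h Q] turns the difference quotient of the square into
    [2 (Q, f t) + h |Q|^2], where [Q] stays bounded. *)
Lemma ndiff_sqr f t d : ndiff f t d ->
  is_derive t (1 : R) (fun s => dt (f s) (f s)) (2 * dt d (f t)).
Proof.
move=> fd.
suff cv : h^-1 *: (((fun s => dt (f s) (f s)) \o shift t) (h *: (1 : R)) - dt (f t) (f t))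
    @[h --> 0^'] --> (2 * dt d (f t)).
  by apply: DeriveDef; [apply/cvg_ex; exists (2 * dt d (f t))|exact: cvg_lim].
pose Q h := h^-1 *: (f (h + t) - f t).
have E : \forall h \near (0 : R)^',
    h^-1 *: (((fun s => dt (f s) (f s)) \o shift t) (h *: (1 : R)) - dt (f t) (f t)) =
    2 * dt (Q h) (f t) + h * dt (Q h) (Q h).
  near=> h.
  have h0 : h != 0 by near: h; exact: nbhs_dnbhs_neq.
  rewrite /= -[h *: 1]/(h * 1) mulr1 /Q.
  have := sip_sqrD Dt (x := f (h + t) - f t) (y := f t) I I; rewrite subrK => ->.
  rewrite addrK (sip_sqrZ Dt)// (sip_Zl Dt)// /GRing.scale/=.
  by field.
have h1 : dt (Q h) (f t) @[h --> (0 : R)^'] --> dt d (f t).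
  apply/cvgrPdist_le => e e0.
  have e1 : 0 < e / (nd (f t) + 1) by rewrite divr_gt0// ltr_wpDl// sqrtr_ge0.
  apply: filterS (ndiffP fd e1) => h hle.
  rewrite distrC -(sip_Bl Dt)// (le_trans (dt_CS _ _))//.
  rewrite mulrC (le_trans (ler_wpM2l (sqrtr_ge0 _) hle))//.
  rewrite mulrCA ler_piMr ?(ltW e0)//.
  by rewrite ler_pdivrMr ?mul1r ?lerDl// ltr_wpDl// sqrtr_ge0.
have h2 : h * dt (Q h) (Q h) @[h --> (0 : R)^'] --> (0 : R).
  apply/cvgr0Pnorm_le => e e0; near=> h.
  have hle : nd (Q h - d) <= 1 by near: h; exact: (ndiffP fd ltr01).
  have b : dt (Q h) (Q h) <= (nd d + 1) ^+ 2.
    rewrite -(nb_sqr Dt)// lerXn2r ?nnegrE ?addr_ge0 ?sqrtr_ge0//.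
    by rewrite -[Q h](subrK d) (le_trans (nb_triangle Dt _ _))// addrC lerD2l.
  have p0 : 0 < (nd d + 1) ^+ 2 by rewrite exprn_gt0// ltr_wpDl// sqrtr_ge0.
  rewrite normrM [X in _ * X]ger0_norm ?(sip_ge0 Dt)//.
  apply: (@le_trans _ _ (`|h| * (nd d + 1) ^+ 2)); first by rewrite ler_wpM2l.
  rewrite -ler_pdivlMr//; near: h; apply: dnbhs0_le; exact: divr_gt0.
have h3 : 2 * dt (Q h) (f t) + h * dt (Q h) (Q h) @[h --> (0 : R)^'] --> (2 * dt d (f t)).
  rewrite -[X in _ --> X]addr0; apply: cvgD h2.
  by apply: cvgM h1; exact: cvg_cst.
apply: cvg_trans h3; apply: near_eq_cvg.
by apply: filterS E => h ->.
Unshelve. all: by end_near. Qed.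

End norm_derivative.

Section clamp.
Variables (R : realType) (T : R).
Hypothesis T0 : 0 < T.
Local Notation leb := (@lebesgue_measure R).

(** Composition with it extends a function that is continuous on [[0, T]] to the whole line, so that
    no one-sided continuity at the endpoints has to be handled. *)
Definition clamp (t : R) : R := Num.max 0 (Num.min t T).

Lemma clamp_itv t : 0 <= clamp t <= T.
Proof. by rewrite /clamp le_max lexx ge_max (ltW T0) ge_min lexx orbT. Qed.

Lemma clamp_id t : 0 <= t <= T -> clamp t = t.
Proof. by move=> /andP[t0 tT]; rewrite /clamp min_l// max_r. Qed.

Lemma clamp_continuous : continuous clamp.
Proof.
move=> t; apply: (@continuous_max _ _ (fun _ => 0) (fun t => Num.min t T) t).
  exact: cst_continuous.
by apply: (@continuous_min _ _ (fun t => t) (fun _ => T) t) => //; exact: cst_continuous.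
Qed.

Lemma clamp_within t : clamp @ t --> within `[0, T]%classic (nbhs (clamp t)).
Proof.
move=> P /= wP.
have H : \forall s \near t, `[0, T]%classic (clamp s) -> P (clamp s).
  exact: (clamp_continuous wP).
change (\forall s \near t, P (clamp s)); apply: filterS H => s; apply.
by rewrite /= in_itv/= clamp_itv.
Qed.

(** Through this primitive, an integrable source enters differential inequalities as difference
    quotients of a continuous function. *)
Lemma primitive_ge0 (f : measurableTypeR R -> R) : (forall t, 0 <= f t) ->
  leb.-integrable setT (EFin \o f) -> exists F : R -> R,
  [/\ continuous F, forall t, 0 <= F t <= (\int[leb]_s f s)%R &
   forall s t, 0 <= s -> s <= t -> t <= T ->
     (\int[leb]_(x in `]s, t]) f x)%R = F t - F s].
Proof.
move=> f0 If.
have If' (A : set (measurableTypeR R)) : measurable A ->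
    leb.-integrable A (EFin \o f) by move=> mA; exact: integrableS If.
pose F t := parameterized_integral leb 0 (clamp t) f.
have le A B : measurable A -> measurable B -> A `<=` B ->
    (\int[leb]_(x in A) f x <= \int[leb]_(x in B) f x)%R.
  move=> mA mB AB; apply: fine_le; [exact/integrable_fin_num/If'..|].
  by apply: ge0_subset_integral => //; [exact: measurable_int (If' _ mB)|move=> x _; rewrite lee_fin].
exists F; split.
- have /(parameterized_integral_continuous (ltW T0)) : leb.-integrable `[0, T] (EFin \o f).
    exact: If'.
  move=> /subspace_continuousP cF t.
  have H := cF (clamp t); rewrite /= in_itv/= clamp_itv in H.
  exact: (cvg_comp _ _ (@clamp_within t) (H isT)).
- move=> t; apply/andP; split; first by apply: Rintegral_ge0 => x _; exact: f0.
  exact: le.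
- move=> s t s0 st tT.
  have sT := le_trans st tT; have t0 := le_trans s0 st.
  rewrite /F !clamp_id ?s0 ?t0// /parameterized_integral.
  by rewrite Rintegral_itvB ?bnd_simp//; exact: If'.
Qed.

End clamp.

(** * Continuity with respect to a semi-inner product *)

Section sip_continuity.
Variables (R : realType) (V : lmodType R) (S : set V) (b : V -> V -> R).
Hypothesis B : semi_ip S b.
Local Notation nb h := (Num.sqrt (b h h)).
Implicit Types (f g : R -> V) (c : R -> R).

Definition sip_cont f : Prop :=
  (forall t, S (f t)) /\ forall t : R, nb (f s - f t) @[s --> t] --> (0 : R).

Lemma sip_contP f : (forall t, S (f t)) ->
  (forall (t e : R), 0 < e -> \forall s \near t, nb (f s - f t) <= e) -> sip_cont f.
Proof.
move=> Sf H; split => // t; apply/cvgr0Pnorm_le => e e0.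
by apply: filterS (H t e e0) => s; rewrite ger0_norm ?sqrtr_ge0.
Qed.

Lemma sip_cont_near f : sip_cont f ->
  forall (t e : R), 0 < e -> \forall s \near t, nb (f s - f t) <= e.
Proof.
move=> [Sf H] t e e0; have /cvgr0Pnorm_le/(_ e e0) := H t.
by apply: filterS => s; rewrite ger0_norm ?sqrtr_ge0.
Qed.

Lemma sip_contB f g : sip_cont f -> sip_cont g -> sip_cont (fun s => f s - g s).
Proof.
move=> cf cg; have [Sf _] := cf; have [Sg _] := cg.
apply: sip_contP => [t|t e e0]; first exact: (sipB B).
have e2 : 0 < e / 2 by rewrite divr_gt0.
apply: filterS2 (sip_cont_near cf t e2) (sip_cont_near cg t e2) => s h1 h2.
have -> : f s - g s - (f t - g t) = (f s - f t) - (g s - g t).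
  by rewrite !opprD !opprK addrACA.
rewrite (le_trans (nb_triangleB B (sipB B (Sf s) (Sf t)) (sipB B (Sg s) (Sg t))))//.
by rewrite (splitr e) lerD.
Qed.

Lemma sip_contZ (c : R) f : sip_cont f -> sip_cont (fun s => c *: f s).
Proof.
move=> cf; have [Sf _] := cf.
apply: sip_contP => [t|t e e0]; first exact: (sipZ B).
have c0 : 0 < `|c| + 1 by rewrite ltr_wpDl.
apply: filterS (sip_cont_near cf t (divr_gt0 e0 c0)) => s hs.
rewrite -scalerBr (nbZ B _ (sipB B (Sf s) (Sf t))).
apply: (@le_trans _ _ ((`|c| + 1) * nb (f s - f t))).
  by rewrite ler_wpM2r ?sqrtr_ge0// lerDl.
by rewrite mulrC -ler_pdivlMr.
Qed.

Lemma sip_cont_shift (k : R) f : sip_cont f -> sip_cont (fun s => f (s + k)).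
Proof.
move=> cf; have [Sf _] := cf; apply: sip_contP => // t e e0.
have /nbhs_ballP[d /= d0 hd] := sip_cont_near cf (t + k) e0.
apply/nbhs_ballP; exists d => // s ts; apply: hd.
by move: ts; rewrite /ball/= opprD addrACA subrr addr0.
Qed.

Lemma sip_cont_dot f v : sip_cont f -> S v -> continuous (fun s => b (f s) v).
Proof.
move=> cf Sv t; have [Sf _] := cf; apply/cvgrPdist_le => e e0.
have n0 : 0 < nb v + 1 by rewrite ltr_wpDl// sqrtr_ge0.
apply: filterS (sip_cont_near cf t (divr_gt0 e0 n0)) => s hs.
rewrite distrC -(sip_Bl B)// (le_trans (sip_CS B (sipB B (Sf s) (Sf t)) Sv))//.
rewrite (le_trans (ler_wpM2r (sqrtr_ge0 _) hs))//.
rewrite -mulrA ler_piMr ?(ltW e0)// mulrC ler_pdivrMr// mul1r lerDl//.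
Qed.

Lemma sip_cont_sqr f : sip_cont f -> continuous (fun s => b (f s) (f s)).
Proof.
move=> cf; have [Sf _] := cf.
have cn : continuous (fun s => nb (f s)).
  move=> t; apply/cvgrPdist_le => e e0.
  apply: filterS (sip_cont_near cf t e0) => s hs.
  by rewrite distrC (le_trans (nb_dist B (Sf s) (Sf t))).
rewrite (_ : (fun s => _) = fun s => nb (f s) * nb (f s)).
  exact: continuous_fctM.
by apply/funext => s; rewrite -expr2 (nb_sqr B).
Qed.

Lemma sip_contD f g : sip_cont f -> sip_cont g -> sip_cont (fun s => f s + g s).
Proof.
move=> cf cg; rewrite (_ : (fun s => _) = fun s => f s - (-1 *: g s)).
  by apply: sip_contB => //; exact: sip_contZ.
by apply/funext => s; rewrite scaleN1r opprK.
Qed.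

Lemma sip_contM c f : continuous c -> sip_cont f -> sip_cont (fun s => c s *: f s).
Proof.
move=> cc cf; have [Sf _] := cf.
apply: sip_contP => [t|t e e0]; first exact: (sipZ B).
have n0 := sqrtr_ge0 (b (f t) (f t)).
have m0 : 0 < `|c t| + 1 by rewrite ltr_wpDl.
have m1 : 0 < nb (f t) + 1 by rewrite ltr_wpDl.
have e1 : 0 < e / 2 / (nb (f t) + 1) by rewrite !divr_gt0.
have e2 : 0 < e / 2 / (`|c t| + 1) by rewrite !divr_gt0.
have /cvgrPdist_le/(_ _ e1) n1 := cc t.
have /cvgrPdist_le/(_ _ ltr01) n2 := cc t.
apply: filterS3 n1 n2 (sip_cont_near cf t e2) => s h1 h2 h3.
have -> : c s *: f s - c t *: f t = c s *: (f s - f t) + (c s - c t) *: f t.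
  by rewrite scalerBr scalerBl addrA subrK.
have S1 := sipB B (Sf s) (Sf t).
rewrite (le_trans (nb_triangle B (sipZ B _ S1) (sipZ B _ (Sf t))))//.
rewrite (nbZ B _ S1) (nbZ B _ (Sf t)) (splitr e) lerD//.
  apply: (@le_trans _ _ ((`|c t| + 1) * nb (f s - f t))).
    rewrite ler_wpM2r ?sqrtr_ge0// -lerBlDl; apply: le_trans h2.
    by rewrite distrC (le_trans _ (ler_dist_dist _ _))// ler_norm.
  by rewrite mulrC -ler_pdivlMr.
rewrite distrC; apply: (@le_trans _ _ (`|c t - c s| * (nb (f t) + 1))).
  by rewrite ler_wpM2l// lerDl.
by rewrite -ler_pdivlMr.
Qed.

Lemma sip_cont_clamp (T : R) f : 0 < T -> (forall t, 0 <= t <= T -> S (f t) /\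
    nb (f s - f t) @[s --> within `[0, T]%classic (nbhs t)] --> (0 : R)) ->
  sip_cont (fun s => f (clamp T s)).
Proof.
move=> T0 H; split => t; have [Sf cf] := H _ (clamp_itv T0 t); first exact: Sf.
exact: (cvg_comp _ _ (@clamp_within R T T0 t) cf).
Qed.

Lemma sip_cont_bounded (P : {linear V -> V}) (k : R) f : S = setT ->
  (forall h, nb (P h) <= k * nb h) -> sip_cont f -> sip_cont (fun s => P (f s)).
Proof.
move=> SE HP cf; have [Sf _] := cf.
apply: sip_contP => [t|t e e0]; first by rewrite SE.
have k0 : 0 < `|k| + 1 by rewrite ltr_wpDl.
apply: filterS (sip_cont_near cf t (divr_gt0 e0 k0)) => s hs.
rewrite -linearB (le_trans (HP _))//.
apply: (@le_trans _ _ ((`|k| + 1) * nb (f s - f t))).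
  by rewrite ler_wpM2r ?sqrtr_ge0// (le_trans (ler_norm _))// lerDl.
by rewrite mulrC -ler_pdivlMr.
Qed.

End sip_continuity.

Section derivative_tools.
Variable R : realType.
Implicit Types (f : R -> R) (m c x k d : R).

Lemma le_of_derive_ge0 f u v : u <= v -> {within `[u, v], continuous f} ->
  (forall x, u < x < v -> exists2 d, is_derive x (1 : R) f d & 0 <= d) -> f u <= f v.
Proof.
move=> uv cf df.
have mono := @ger0_derive1_le_cc R f u v _ _ cf.
apply: mono => //; rewrite ?in_itv/= ?lexx ?uv//.
- by move=> x; rewrite in_itv/= => /df [d []].
- by move=> x; rewrite in_itv/= => /df [d [_ <-]]; rewrite derive1E.
Qed.

Lemma is_derive_shiftr f k x d : is_derive (x + k) (1 : R) f d ->
  is_derive x (1 : R) (fun s => f (s + k)) d.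
Proof.
move=> df.
have ds : is_derive x (1 : R) (fun s : R => s + k) 1.
  have := is_derive_add (is_derive_id x (1 : R)) (is_derive_cst k x (1 : R)).
  by rewrite addr0.
by have := @is_derive1_comp R f (fun s => s + k) x d 1 df ds; rewrite mulr1.
Qed.

Lemma is_derive_exp_affine m c x :
  is_derive x (1 : R) (fun s => expR (m * (s - c))) (m * expR (m * (x - c))).
Proof.
have ds : is_derive x (1 : R) (fun s : R => m * (s - c)) m.
  have := is_derive_scale m (is_derive_sub (is_derive_id x (1 : R)) (is_derive_cst c x (1 : R))).
  by rewrite subr0 mulr1.
have := @is_derive1_comp R expR (fun s => m * (s - c)) x _ m (is_derive_expR _) ds.
by rewrite mulrC.
Qed.

Lemma exp_affine_continuous m c : continuous (fun s : R => expR (m * (s - c))).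
Proof. by move=> x; apply: is_derive_continuous; exact: is_derive_exp_affine. Qed.

End derivative_tools.

Section limn_einf_bounds.
Variable R : realType.
Implicit Types (u : (\bar R)^nat) (x : \bar R).

Lemma limn_einf_ge u x : (\forall k \near \oo, (x <= u k)%E) -> (x <= limn_einf u)%E.
Proof.
move=> [N _ hN]; rewrite limn_einf_lim; apply: lime_ge; first exact: is_cvg_einfs.
exists N => // n /= Nn; apply: le_ereal_inf_tmp => _ [m /= nm <-]; apply: hN.
exact: leq_trans Nn nm.
Qed.

Lemma limn_einf_le u x : (\forall k \near \oo, (u k <= x)%E) -> (limn_einf u <= x)%E.
Proof.
move=> [N _ hN]; rewrite limn_einf_lim; apply: lime_le; first exact: is_cvg_einfs.
exists N => // n /= Nn; apply: le_trans (hN n Nn).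
by apply: ereal_inf_lbound; exists n => /=.
Qed.

End limn_einf_bounds.

(** * The energy inequality for Steklov averages and its limit *)

Section energy.
Variables (R : realType) (V : lmodType R) (dt a : V -> V -> R) (H1 H10 : set V)
  (Tp : V -> V -> Prop).
Hypothesis G : gelfand dt a H1 H10 Tp.
Local Notation Dt := (gel_dt G).
Local Notation A := (gel_a G).
Local Notation leb := (@lebesgue_measure R).
Local Notation q h := (dt h h + a h h).
Local Notation nq h := (Num.sqrt (dt h h + a h h)).
Local Notation nd h := (Num.sqrt (dt h h)).

Variables (T : R) (y z : R -> V).
Hypotheses (T0 : 0 < T) (Hy : forall t, H10 (y t))
  (Hd : forall (v : V) (t : R), 0 < t < T ->
     is_derive t (1 : R) (fun s => dt (y s) v) (dt (z t) v))
  (cy : sip_cont H1 (fun h k => dt h k + a h k) y)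
  (cz : sip_cont setT dt z).

Let Hy1 t : H1 (y t). Proof. exact: (gel_sub G). Qed.

Lemma sip_cont_dt : sip_cont setT dt y.
Proof.
apply: sip_contP => // t e e0; apply: filterS (sip_cont_near cy t e0) => s.
apply: le_trans; rewrite ler_wsqrtr// lerDl.
by apply: (sip_ge0 A); exact: (sipB A).
Qed.

Lemma sip_cont_a : sip_cont H1 a y.
Proof.
apply: sip_contP => // t e e0; apply: filterS (sip_cont_near cy t e0) => s.
by apply: le_trans; rewrite ler_wsqrtr// lerDr (sip_ge0 Dt).
Qed.

(* [y] has no strong derivative a priori: pair the increment with itself and use the
   mean value theorem for that real function. *)
Lemma mean_bound s s' : 0 <= s <= T -> 0 <= s' <= T -> exists c : R,
  `|c - s| <= `|s' - s| /\ nd (y s' - y s - (s' - s) *: z s) <= `|s' - s| * nd (z c - z s).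
Proof.
move=> /andP[s0 sT] /andP[s'0 s'T].
pose X := y s' - y s - (s' - s) *: z s.
pose F r := dt (y r) X - dt (z s) X * r.
have cF : continuous F.
  apply: continuous_fctB; first exact: (sip_cont_dot Dt sip_cont_dt).
  by apply: continuous_fctM; [exact: continuous_fctC|move=> x; exact: cvg_id].
have dF (r : R) : 0 < r < T -> is_derive r (1 : R) F (dt (z r) X - dt (z s) X).
  move=> r0T.
  have := is_derive_sub (Hd X r0T) (is_derive_scale (dt (z s) X) (is_derive_id r (1 : R))).
  by rewrite mulr1.
have [c cs FE] : exists2 c : R, `|c - s| <= `|s' - s| &
    F s' - F s = (dt (z c) X - dt (z s) X) * (s' - s).
  have [ss'|s's] := leP s s'.
    have dF' (x : R) : x \in `]s, s'[ -> is_derive x (1 : R) F (dt (z x) X - dt (z s) X).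
      by rewrite in_itv/= => /andP[? ?]; apply: dF; apply/andP; split; lra.
    have [c + ->] := MVT_segment ss' dF' (continuous_subspaceT cF).
    rewrite in_itv/= => /andP[sc cs']; exists c => //.
    by rewrite !ger0_norm; lra.
  have dF' (x : R) : x \in `]s', s[ -> is_derive x (1 : R) F (dt (z x) X - dt (z s) X).
    by rewrite in_itv/= => /andP[? ?]; apply: dF; apply/andP; split; lra.
  have [c + E] := MVT_segment (ltW s's) dF' (continuous_subspaceT cF).
  rewrite in_itv/= => /andP[sc cs']; exists c.
    by rewrite !ler0_norm; lra.
  by rewrite -[F s' - _]opprB E -mulrN opprB.
exists c; split => //.
have E : dt X X = dt (z c - z s) X * (s' - s).
  rewrite (sip_Bl Dt)// -FE {1}/X !(sip_Bl Dt)// (sip_Zl Dt)// /F; ring.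
have [->|X0] := eqVneq (nd X) 0; first by rewrite mulr_ge0 ?sqrtr_ge0.
have Xp : 0 < nd X by rewrite lt0r X0 sqrtr_ge0.
rewrite -(ler_pM2r Xp) -expr2 (nb_sqr Dt)// {1}E.
apply: le_trans (ler_norm _) _; rewrite normrM mulrC -mulrA ler_wpM2l//.
exact: (sip_CS Dt).
Qed.

(** Continuity of [z] in norm upgrades the weak derivative: in [mean_bound] the remainder is [|h|]
    times an oscillation of [z]. *)
Lemma ndiff_y t : 0 < t < T -> ndiff dt y t (z t).
Proof.
move=> /andP[t0 tT]; apply: ndiff_dist => e e0.
have /nbhs_ballP[d /= d0 hd] := sip_cont_near cz t e0.
near=> h.
have h0 : h != 0 by near: h; exact: nbhs_dnbhs_neq.
have ht : `|h| < Num.min d (Num.min t (T - t)).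
  by near: h; apply: dnbhs0_lt; rewrite !lt_min d0 t0 subr_gt0.
move: ht; rewrite !lt_min => /andP[hdd /andP[]]; rewrite !ltr_norml => /andP[? ?] /andP[? ?].
have tt : 0 <= t <= T by apply/andP; split; lra.
have tt' : 0 <= h + t <= T by apply/andP; split; lra.
have [c [cle hle]] := mean_bound tt tt'.
rewrite addrK in cle hle.
have -> : h^-1 *: (y (h + t) - y t) - z t = h^-1 *: (y (h + t) - y t - h *: z t).
  by rewrite [RHS]scalerBr scalerA mulVf// scale1r.
rewrite (nbZ Dt)// normfV ler_pdivrMl ?normr_gt0//.
apply: (le_trans hle); rewrite ler_wpM2l//; apply: hd.
by rewrite /ball/= distrC (le_lt_trans cle).
Unshelve. all: by end_near. Qed.

(* Unlike [z], an admissible test function. *)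
Definition steklov h t := h^-1 *: (y (t + h) - y t).

Lemma steklov_H10 h t : H10 (steklov h t).
Proof. by apply: (H10Z G); exact: (H10B G). Qed.

Lemma steklov_conta h : sip_cont H1 a (steklov h).
Proof.
by apply: (sip_contZ A); apply: (sip_contB A); [apply: sip_cont_shift|]; exact: sip_cont_a.
Qed.

Lemma steklov_contd h : sip_cont setT dt (steklov h).
Proof.
by apply: (sip_contZ Dt); apply: (sip_contB Dt); [apply: sip_cont_shift|]; exact: sip_cont_dt.
Qed.

Lemma steklov_sqr_derive h t : 0 < h -> 0 < t -> t + h < T ->
  is_derive t (1 : R) (fun s => dt (steklov h s) (steklov h s))
    (2 * dt (h^-1 *: (z (t + h) - z t)) (steklov h t)).
Proof.
move=> h0 t0 thT; apply: (ndiff_sqr Dt); apply: (ndiffZ Dt); apply: (ndiffB Dt).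
- by apply: ndiff_shift; apply: ndiff_y; apply/andP; split; lra.
- by apply: ndiff_y; apply/andP; split; lra.
Qed.

Lemma steklov_dist h t : 0 < h -> 0 <= t -> t + h <= T -> forall e : R,
  (forall c : R, `|c - t| <= h -> nd (z c - z t) <= e) -> nd (steklov h t - z t) <= e.
Proof.
move=> h0 t0 thT e He.
have tt : 0 <= t <= T by apply/andP; split; lra.
have tt' : 0 <= t + h <= T by apply/andP; split; lra.
have [c [cle hle]] := mean_bound tt tt'; rewrite addrAC subrr add0r in cle hle.
rewrite /steklov.
have -> : h^-1 *: (y (t + h) - y t) - z t = h^-1 *: (y (t + h) - y t - h *: z t).
  by rewrite [RHS]scalerBr scalerA mulVf ?gt_eqF// scale1r.
rewrite (nbZ Dt)// normfV gtr0_norm// ler_pdivrMl//.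
apply: (le_trans hle); rewrite gtr0_norm// ler_wpM2l ?(ltW h0)//; apply: He.
by rewrite (le_trans cle)// gtr0_norm.
Qed.

(** The variant for the terminal time, where only the average over [[T - h, T]] lies within the
    interval. *)
Lemma steklov_dist_left h t : 0 < h -> 0 <= t - h -> t <= T -> forall e : R,
  (forall c : R, `|c - t| <= h -> nd (z c - z t) <= e) -> nd (steklov h (t - h) - z t) <= e.
Proof.
move=> h0 t0 thT e He.
have tt : 0 <= t <= T by apply/andP; split; lra.
have tt' : 0 <= t - h <= T by apply/andP; split; lra.
have [c [cle hle]] := mean_bound tt tt'; rewrite addrAC subrr add0r normrN in cle hle.
rewrite /steklov subrK.
have -> : h^-1 *: (y t - y (t - h)) - z t = - h^-1 *: (y (t - h) - y t - (- h) *: z t).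
  rewrite [RHS]scalerBr scaleNr -scalerN opprB scalerA mulrNN mulVf ?gt_eqF// scale1r.
  by [].
rewrite (nbZ Dt)// normrN normfV gtr0_norm// ler_pdivrMl//.
apply: (le_trans hle); rewrite gtr0_norm// ler_wpM2l ?(ltW h0)//; apply: He.
by rewrite (le_trans cle)// gtr0_norm.
Qed.

Variables (P : {linear V -> V}) (B : R) (N : measurableTypeR R -> R).
Hypotheses (B0 : 0 < B) (HP : forall h, nd (P h) <= B * nd h)
  (IN : leb.-integrable setT (EFin \o (fun s => N s ^+ 2)))
  (Heq : forall p p', Tp p p' -> exists r : R -> R, [/\ continuous r,
     forall t, 0 < t < T -> is_derive t (1 : R) (fun s => dt (z s) p)
       (dt (z t) p - dt (z t) p' + dt (P (z t)) p + r t) &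
     \forall t \ae leb, 0 < t < T -> `|r t| <= nd p * N t]).

Variable K : R.

Local Notation yh h t := (steklov h t).
Local Notation zq h t := (h^-1 *: (z (t + h) - z t)).
Local Notation E h t := (dt (yh h t) (yh h t)).
Local Notation ah h t := (a (yh h t) (yh h t)).

(** * Gronwall's lemma for Steklov averages *)

Section gronwall.
Variable Phi : R -> R.
Hypotheses (cPhi : continuous Phi) (PhiK : forall t, 0 <= Phi t <= K)
  (PhiE : forall s t, 0 <= s -> s <= t -> t <= T ->
     (\int[leb]_(x in `]s, t]) (N x ^+ 2))%R = Phi t - Phi s).

(* AM-GM, [|r| <= B / 2 |p|^2 + N^2 / (2 B)], makes the bound continuous in [p]. *)
Lemma steklov_test h t p p' : 0 < t -> 0 < h -> t + h < T -> Tp p p' ->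
  dt (yh h t) p + a (yh h t) p + dt (P (yh h t)) p - B / 2 * dt p p
    - (Phi (t + h) - Phi t) / (2 * B * h) <= dt (zq h t) p.
Proof.
move=> t0 h0 thT Tpp; have [r [cr dz rN]] := Heq Tpp.
have B1 : B != 0 by rewrite gt_eqF.
have h1 : h != 0 by rewrite gt_eqF.
have th : t <= t + h by lra.
have lin1 (s : R) : 0 < s < T ->
    is_derive s (1 : R) (fun s => dt (P (y s)) p) (dt (P (z s)) p).
  move=> s0T; apply: (@linear_is_derive _ _ dt (fun u => dt (P u) p) (B * nd p) y s).
  - by move=> u v; rewrite linearB (sip_Bl Dt).
  - by move=> c u; rewrite linearZ (sip_Zl Dt).
  - move=> u; apply: le_trans (sip_CS Dt I I) _.
    by rewrite mulrAC ler_wpM2r ?sqrtr_ge0.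
  - exact: ndiff_y.
(* As [y] is a primitive of [z], the bracket is a primitive of every term of the equation but [r],
   so [X] has derivative [r]. *)
pose X s := dt (z s) p - (dt (y s) p - dt (y s) p' + dt (P (y s)) p).
have dX (s : R) : t <= s <= t + h -> is_derive s (1 : R) X (r s).
  move=> /andP[ts sth]; have s0T : 0 < s < T by apply/andP; split; lra.
  have := is_derive_sub (dz s s0T) (is_derive_add (is_derive_sub (Hd p s0T) (Hd p' s0T)) (lin1 s s0T)).
  by rewrite addrAC subrr add0r.
have IX := Rintegral_derive th (continuous_subspaceT cr) dX.
have Ir : leb.-integrable `[t, t + h] (EFin \o r) by exact: continuous_integrable_ccT.
have Ir' : leb.-integrable `]t, (t + h)%R] (EFin \o r).
  by apply: integrableS Ir => //; apply: subset_itvr; rewrite bnd_simp.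
have IN' : leb.-integrable `]t, (t + h)%R] (EFin \o (fun s => N s ^+ 2)).
  exact: integrableS IN.
pose f1 (s : measurableTypeR R) : R := - (B / 2 * dt p p).
pose N2 (s : measurableTypeR R) : R := N s ^+ 2.
pose f2 (s : measurableTypeR R) : R := (2 * B)^-1 * N2 s.
pose g s := f1 s - f2 s.
have I1 : leb.-integrable `]t, (t + h)%R] (EFin \o f1).
  apply: integrableS (continuous_integrable_ccT t (t + h) (@continuous_fctC R _ (- (B / 2 * dt p p)))) => //.
  by apply: subset_itvr; rewrite bnd_simp.
have I2 : leb.-integrable `]t, (t + h)%R] (EFin \o f2).
  rewrite (_ : EFin \o _ = fun s => (((2 * B)^-1)%:E * (EFin \o N2) s)%E).
    exact: integrableZl.
  by apply/funext => s; rewrite /= EFinM.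
have Ig : leb.-integrable `]t, (t + h)%R] (EFin \o g).
  rewrite (_ : EFin \o _ = (EFin \o f1) \- (EFin \o f2))%E; first exact: integrableB.
  by apply/funext.
have dp0 : 0 <= dt p p by exact: (sip_ge0 Dt).
have gr : (\int[leb]_(s in `]t, (t + h)%R]) g s <= \int[leb]_(s in `]t, (t + h)%R]) r s)%R.
  apply: ae_le_Rintegral => //; apply: filterS rN => s hs.
  rewrite /= in_itv/= => /andP[ts sth].
  have s0T : 0 < s < T by apply/andP; split; lra.
  have := hs s0T; rewrite ler_norml => /andP[+ _]; apply: le_trans.
  rewrite /g /f1 /f2 /N2 lerBlDr lerNl opprD opprK lerBlDr.
  have := sqr_ge0 (B * nd p - N s); rewrite sqrrB exprMn (nb_sqr Dt)//.
  move=> hB; rewrite -(@ler_pM2l _ (2 * B)) ?mulr_gt0//.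
  have -> : 2 * B * (B / 2 * dt p p + (2 * B)^-1 * N s ^+ 2) =
    B ^+ 2 * dt p p + N s ^+ 2 by field.
  by move: hB; set x := nd p; set d := dt p p; lra.
rewrite RintegralB// Rintegral_cst//= RintegralZl// PhiE ?(ltW t0) ?(ltW thT)//= in gr.
rewrite lebesgue_measure_itv/= lte_fin ltrDl h0 -EFinB/= addrAC subrr add0r in gr.
rewrite (Rintegral_itv_obnd_cbnd Ir') IX in gr.
have apE : a (yh h t) p = - dt (yh h t) p'.
  by rewrite (gel_lap G Tpp)//; apply: (gel_sub G); exact: steklov_H10.
rewrite apE -(ler_pM2l h0).
have -> : h * dt (zq h t) p = dt (z (t + h)) p - dt (z t) p.
  by rewrite (sip_Zl Dt)// mulrA mulfV// mul1r (sip_Bl Dt).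
have -> : h * (dt (yh h t) p - dt (yh h t) p' + dt (P (yh h t)) p - B / 2 * dt p p -
    (Phi (t + h) - Phi t) / (2 * B * h)) =
    (dt (y (t + h)) p - dt (y t) p) - (dt (y (t + h)) p' - dt (y t) p')
     + (dt (P (y (t + h))) p - dt (P (y t)) p) - h * (B / 2 * dt p p)
     - (2 * B)^-1 * (Phi (t + h) - Phi t).
  have PE : P (yh h t) = h^-1 *: (P (y (t + h)) - P (y t)).
    by rewrite /steklov linearZ/= linearB.
  rewrite PE /steklov !(sip_Zl Dt)// !(sip_Bl Dt)//.
  by field; rewrite h1 B1.
move: gr; rewrite /X.
set d := dt p p; set k := (2 * B)^-1 * _.
lra.
Qed.

Lemma steklov_H10_test h t p : 0 < t -> 0 < h -> t + h < T -> H10 p ->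
  dt (yh h t) p + a (yh h t) p + dt (P (yh h t)) p - B / 2 * dt p p
    - (Phi (t + h) - Phi t) / (2 * B * h) <= dt (zq h t) p.
Proof.
move=> t0 h0 thT Hp.
have Hs := gel_sub G (steklov_H10 h t); have Hp1 := gel_sub G Hp.
(* The gradient at [p] of the [L^2] part of the inequality: passing from [p] to [p - x] costs
   exactly [dt c x + a (yh h t) x + B / 2 * dt x x], which is at most [(al + be + B) eta]. *)
pose c := yh h t + P (yh h t) - zq h t - B *: p.
pose al := Num.sqrt (a (yh h t) (yh h t)); pose be := nd c.
apply/ler_addgt0Pl => e e0.
have m0 : 0 < al + be + B + 1 by rewrite ltr_wpDl// !addr_ge0 ?sqrtr_ge0// ltW.
pose eta := Num.min 1 (e / (al + be + B + 1)).
have eta0 : 0 < eta by rewrite /eta lt_min ltr01 divr_gt0.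
have [k [k' [Tk qk]]] := gel_dense G Hp (exprn_gt0 2 eta0).
have Hk := gel_sub G (gel_test G Tk).
have Hpk := sipB A Hp1 Hk.
have := steklov_test t0 h0 thT Tk.
set D := (Phi (t + h) - Phi t) / (2 * B * h).
pose x := p - k.
have Ek : k = p - x by rewrite /x opprB addrC subrK.
have nx : nq x <= eta.
  rewrite -(@ler_pXn2r _ 2)// ?nnegrE ?sqrtr_ge0 ?(ltW eta0)//.
  rewrite sqr_sqrtr; first exact: ltW.
  exact: (sip_ge0 (gel_q G) Hpk).
have x1 : nd x <= eta.
  by apply: le_trans nx; rewrite ler_wsqrtr// lerDl (sip_ge0 A).
have x2 : Num.sqrt (a x x) <= eta.
  by apply: le_trans nx; rewrite ler_wsqrtr// lerDr (sip_ge0 Dt).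
have b1 : a (yh h t) x <= al * eta.
  apply: le_trans (ler_norm _) _; apply: le_trans (sip_CS A Hs Hpk) _.
  by rewrite ler_wpM2l ?sqrtr_ge0.
have b2 : dt c x <= be * eta.
  apply: le_trans (ler_norm _) _; apply: le_trans (sip_CS Dt I I) _.
  by rewrite ler_wpM2l ?sqrtr_ge0.
have b3 : B / 2 * dt x x <= B * eta.
  rewrite -(nb_sqr Dt)//.
  have n1 : nd x <= 1 by apply: le_trans x1 _; rewrite /eta ge_min lexx.
  apply: (@le_trans _ _ (B * nd x)); last by rewrite ler_pM2l.
  rewrite -mulrA ler_pM2l// expr2.
  have := ler_wpM2r (sqrtr_ge0 (dt x x)) n1; have := sqrtr_ge0 (dt x x).
  by move: (nd x) => w; lra.
have b4 : (al + be + B + 1) * eta <= e.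
  by rewrite mulrC -ler_pdivlMr// /eta ge_min lexx orbT.
move: b2; rewrite /c (sip_Bl Dt)// (sip_Bl Dt)// (sip_Dl Dt)// (sip_Zl Dt)// => b2.
have Hx : H1 x := Hpk.
clearbody x.
rewrite Ek (sip_sqrB Dt)// !(sip_Br Dt)// (sip_Br A)//.
move: b1 b2 b3 b4 eta0; set zqx := dt (zq h t) x; set zqp := dt (zq h t) p.
set px := dt p x; set xx := dt x x; set pp := dt p p.
move: (dt (P (yh h t)) x) (dt (P (yh h t)) p) (a (yh h t) x) (a (yh h t) p) (dt (yh h t) x) (dt (yh h t) p).
move=> u1 u2 u3 u4 u5 u6.
move: (al) (be) (eta) => v1 v2 v3.
by move: zqx zqp px xx pp D => w1 w2 w3 w4 w5 w6; lra.
Qed.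

(** The Steklov average is now its own test function. Of the coefficient [3 B], two parts come from
    [P] and one from the splitting of the source; the nonnegative term [2 E] produced by the
    exponential weight is dropped. *)
Lemma steklov_energy h t : 0 < t -> 0 < h -> t + h < T -> exists2 d : R,
  is_derive t (1 : R) (fun s => E h s) d &
  2 * ah h t - 3 * B * E h t - (Phi (t + h) - Phi t) / (B * h) <= d.
Proof.
move=> t0 h0 thT; have [B1 h1] : B != 0 /\ h != 0 by rewrite !gt_eqF.
exists (2 * dt (zq h t) (yh h t)); first exact: steklov_sqr_derive.
have := steklov_H10_test t0 h0 thT (steklov_H10 h t).
have e0 : 0 <= E h t by exact: (sip_ge0 Dt).
have : - (B * E h t) <= dt (P (yh h t)) (yh h t).
  have := sip_CS Dt (x := P (yh h t)) (y := yh h t) I I.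
  rewrite ler_norml => /andP[+ _]; apply: le_trans.
  rewrite lerN2 -[X in _ <= B * X](nb_sqr Dt)// expr2 mulrA.
  by rewrite ler_wpM2r ?sqrtr_ge0.
have -> : (Phi (t + h) - Phi t) / (2 * B * h) = 2^-1 * ((Phi (t + h) - Phi t) / (B * h)).
  by field; rewrite h1 B1.
move: e0; move: (E h t) (ah h t) (dt (P (yh h t)) (yh h t)) (dt (zq h t) (yh h t)).
by move: ((Phi (t + h) - Phi t) / (B * h)) => w1 w2 w3 w4 w5; lra.
Qed.

(** The functional [J] is nondecreasing on [[t, T - h]]: the integrating factor cancels [- 3 B E],
    being at least 1 it leaves at least [2 a] to compensate [- 2 F], and [c * L] pays for the
    source. *)
Lemma steklov_gronwall h t : 0 < h -> 0 <= t -> t + h <= T ->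
  E h t + 2 * (\int[leb]_(s in `[t, (T - h)%R]) ah h s)%R <=
  expR (3 * B * (T - t)) * (E h (T - h) + K / B).
Proof.
move=> h0 t0 thT; have [B1 h1] : B != 0 /\ h != 0 by rewrite !gt_eqF.
have tT : t <= T - h by lra.
have Bp : 0 <= 3 * B by rewrite mulr_ge0// ltW.
have ca : continuous (fun s => ah h s).
  by apply: (sip_cont_sqr A); exact: steklov_conta.
have cE : continuous (fun s => E h s).
  by apply: (sip_cont_sqr Dt); exact: steklov_contd.
(* Starting the primitives at -1 gives them two-sided derivatives at every point of [[0, T]],
   including 0. *)
pose F (s : R) : R := (\int[leb]_(x in `[-1, s]) ah h x)%R.
pose Psi (s : R) : R := (\int[leb]_(x in `[-1, s]) Phi x)%R.
have dF (x : R) : 0 <= x -> is_derive x (1 : R) F (ah h x).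
  by move=> x0; apply: is_derive_primitive => //; lra.
have dPsi (x : R) : 0 <= x -> is_derive x (1 : R) Psi (Phi x).
  by move=> x0; apply: is_derive_primitive => //; lra.
(* A moving average of [Phi]: its derivative is the difference quotient of [Phi] occurring as the
   source, and it inherits the bounds 0 and [K]. *)
pose L (s : R) : R := h^-1 * (Psi (s + h) - Psi s).
have dL (x : R) : 0 <= x -> is_derive x (1 : R) L (h^-1 * (Phi (x + h) - Phi x)).
  move=> x0; apply: is_derive_scale; apply: is_derive_sub; last exact: dPsi.
  by apply: is_derive_shiftr; apply: dPsi; lra.
have LE (s : R) : 0 <= s -> 0 <= L s <= K.
  move=> s0; have ssh : s <= s + h by lra.
  have dPsi' (x : R) : s <= x <= s + h -> is_derive x (1 : R) Psi (Phi x).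
    by move=> /andP[sx _]; apply: dPsi; lra.
  rewrite /L -(Rintegral_derive ssh (continuous_subspaceT cPhi) dPsi').
  have ic (c : R) : h^-1 * (\int[leb]_(x in `[s, (s + h)%R]) c)%R = c.
    rewrite Rintegral_cst//= lebesgue_measure_itv/= lte_fin ltrDl h0 -EFinB/=.
    by rewrite addrAC subrr add0r mulrCA mulVf// mulr1.
  rewrite -{1}(ic 0) -[X in _ && (_ <= X)](ic K) !ler_pM2l ?invr_gt0//.
  have cC (k : R) : continuous (fun _ : R => k) by exact: continuous_fctC.
  by apply/andP; split; apply: le_Rintegral_cc => // x _; have /andP[] := PhiK x.
(* The integrating factor is bounded by its value at [T], so this [c] dominates the source at all
   times. *)
pose c := expR (3 * B * (T - t)) / B.
pose J (s : R) : R := expR (3 * B * (s - t)) * E h s - 2 * F s + c * L s.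
have cJ : {within `[t, T - h], continuous J}.
  apply: continuous_in_subspaceT => x; rewrite inE/= in_itv/= => /andP[tx xT].
  have x0 : 0 <= x by lra.
  apply: (@continuousD _ _ _ (fun s => expR (3 * B * (s - t)) * E h s - 2 * F s) (fun s => c * L s)).
    apply: (@continuousB _ _ _ (fun s => expR (3 * B * (s - t)) * E h s) (fun s => 2 * F s)).
      exact: (continuous_fctM (@exp_affine_continuous _ (3 * B) t) cE).
    exact: (is_derive_continuous (is_derive_scale 2 (dF x x0))).
  exact: (is_derive_continuous (is_derive_scale c (dL x x0))).
have dJ (x : R) : t < x < T - h -> exists2 d : R, is_derive x (1 : R) J d & 0 <= d.
  move=> /andP[tx xT]; have x0 : 0 < x := le_lt_trans t0 tx.
  have xh : x + h < T by rewrite -ltrBrDr.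
  have [d dE hd] := steklov_energy x0 h0 xh.
  have := is_derive_add (is_derive_sub (is_derive_mul (is_derive_exp_affine (3 * B) t x) dE)
    (is_derive_scale 2 (dF x (ltW x0)))) (is_derive_scale c (dL x (ltW x0))).
  set D := (X in is_derive _ _ _ X) => dJx; exists D => //.
  have a0 : 0 <= ah h x.
    by apply: (sip_ge0 A); apply: (gel_sub G); exact: steklov_H10.
  have e1 : 1 <= expR (3 * B * (x - t)).
    by rewrite -[leLHS](expR0 R) ler_expR mulr_ge0// subr_ge0 ltW.
  have e2 : expR (3 * B * (x - t)) <= expR (3 * B * (T - t)).
    by rewrite ler_expR ler_wpM2l// lerB// (le_trans (ltW xT))// gerBl ltW.
  have dP : 0 <= (Phi (x + h) - Phi x) / (B * h).
    apply: divr_ge0; last by rewrite mulr_ge0 ?(ltW B0) ?(ltW h0).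
    rewrite -PhiE ?(ltW x0) ?(ltW xh)//; last by rewrite lerDl ltW.
    by apply: Rintegral_ge0 => s _; exact: sqr_ge0.
  have -> : D = expR (3 * B * (x - t)) * (3 * B * E h x + d) - 2 * ah h x +
      expR (3 * B * (T - t)) * ((Phi (x + h) - Phi x) / (B * h)).
    by rewrite /D /c; field; rewrite h1 B1.
  move: hd a0 e1 e2 dP; move: (ah h x) (E h x) ((Phi (x + h) - Phi x) / (B * h)).
  move: (expR (3 * B * (x - t))) (expR (3 * B * (T - t))) => w1 w2 w3 w4 w5 hd a0 e1 e2 dP.
  have h2 : w1 * (2 * w3 - 3 * B * w4 - w5) <= w1 * d by rewrite ler_wpM2l//; lra.
  have h3 : w1 * w5 <= w2 * w5 by rewrite ler_wpM2r.
  have h4 : 1 * w3 <= w1 * w3 by rewrite ler_wpM2r.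
  by lra.
have := le_of_derive_ge0 tT cJ dJ; rewrite /J subrr mulr0 expR0 mul1r => JJ.
have dF' (x : R) : t <= x <= T - h -> is_derive x (1 : R) F (ah h x).
  by move=> /andP[tx _]; apply: dF; lra.
rewrite (Rintegral_derive tT (continuous_subspaceT ca) dF').
have c0 : 0 <= c by rewrite divr_ge0 ?expR_ge0// ltW.
have /andP[L1 L2] := LE _ t0.
have Th : 0 <= T - h by lra.
have /andP[L3 L4] := LE _ Th.
have e2 : expR (3 * B * (T - h - t)) <= expR (3 * B * (T - t)).
  by rewrite ler_expR ler_wpM2l//; lra.
have E0 : 0 <= E h (T - h) by exact: (sip_ge0 Dt).
have h2 := ler_wpM2r E0 e2.
have h3 := ler_wpM2l c0 L4.
have h4 := mulr_ge0 c0 L1.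
have -> : expR (3 * B * (T - t)) * (E h (T - h) + K / B) =
  expR (3 * B * (T - t)) * E h (T - h) + c * K by rewrite /c; field.
move: JJ h2 h3 h4; move: (E h t) (E h (T - h)) (F t) (F (T - h)) (L t) (L (T - h)).
move: (expR (3 * B * (T - h - t))) (expR (3 * B * (T - t))) (c) => w1 w2 w3 w4 w5 w6 w7 w8 w9.
by lra.
Qed.

End gronwall.

(** * Passage to the limit in the Steklov averages *)

Hypothesis NK : (\int[leb]_s (N s ^+ 2) <= K)%R.

Definition energy_bound t := expR (3 * B * (T - t)) * (dt (z T) (z T) + K / B).

Lemma sqr_near v (e : R) : 0 < e -> exists2 d : R, 0 < d &
  forall u, nd (u - v) <= d -> `|dt u u - dt v v| <= e.
Proof.
move=> e0; pose m := 1 + 2 * nd v.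
have m0 : 0 < m by rewrite /m ltr_wpDr// mulr_ge0// sqrtr_ge0.
exists (Num.min 1 (e / m)); first by rewrite lt_min ltr01 divr_gt0.
move=> u; set d := Num.min _ _ => ud.
have d1 : d <= 1 by rewrite /d ge_min lexx.
have dm : d * m <= e by rewrite -ler_pdivlMr// /d ge_min lexx orbT.
have d0 : 0 <= d by apply: le_trans ud; exact: sqrtr_ge0.
have -> : dt u u - dt v v = dt (u - v) (u - v) + 2 * dt (u - v) v.
  have := sip_sqrD Dt (x := u - v) (y := v) I I; rewrite subrK => ->; ring.
apply: le_trans (ler_normD _ _) _; apply: le_trans dm.
rewrite [X in X + _]ger0_norm ?(sip_ge0 Dt)// normrM [`|2|]ger0_norm// /m mulrDr mulr1.
have h1 : dt (u - v) (u - v) <= d.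
  rewrite -(nb_sqr Dt)//; apply: (@le_trans _ _ (d ^+ 2)).
    by rewrite lerXn2r ?nnegrE ?sqrtr_ge0.
  by rewrite expr2 ler_piMr.
have h2 : `|dt (u - v) v| <= d * nd v.
  apply: le_trans (sip_CS Dt I I) _.
  by rewrite ler_wpM2r ?sqrtr_ge0.
rewrite lerD// mulrCA ler_pM2l//.
Qed.

(** Continuity of [z] in norm lets the two boundary terms converge; the Dirichlet integral is kept
    at positive [h], since [z] need not have a gradient at every time. *)
Lemma energy_limit t (e : R) : 0 <= t < T -> 0 < e -> exists2 d : R, 0 < d &
  forall h : R, 0 < h < d -> t + h <= T /\
    dt (z t) (z t) + 2 * (\int[leb]_(s in `[t, (T - h)%R]) ah h s)%R <= energy_bound t + e.
Proof.
move=> /andP[t0 tT] e0.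
have N2 s : 0 <= (N s ^+ 2 : R) by exact: sqr_ge0.
have [Phi [cPhi PhiK0 PhiE]] := primitive_ge0 T0 N2 IN.
have PhiK s : 0 <= Phi s <= K.
  by have /andP[-> h] := PhiK0 s; exact: le_trans NK.
pose M := expR (3 * B * (T - t)).
have M0 : 0 < M by exact: expR_gt0.
pose e1 := e / (1 + M).
have M1 : 0 < 1 + M by rewrite ltr_wpDl// ltW.
have e10 : 0 < e1 by rewrite divr_gt0.
have [d1 d10 near1] := sqr_near (z t) e10.
have [d2 d20 near2] := sqr_near (z T) e10.
have /nbhs_ballP[r1 /= r10 hr1] := sip_cont_near cz t d10.
have /nbhs_ballP[r2 /= r20 hr2] := sip_cont_near cz T d20.
exists (Num.min (T - t) (Num.min r1 r2)).
  by rewrite !lt_min subr_gt0 tT r10 r20.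
move=> h; rewrite !lt_min => /andP[h0 /and3P[hT hr hr']].
have thT : t + h <= T by lra.
split => //.
have := steklov_gronwall cPhi PhiK PhiE h0 t0 thT.
have k1 : nd (steklov h t - z t) <= d1.
  apply: (steklov_dist h0 t0 thT) => c cle; apply: hr1.
  by rewrite /ball/= distrC (le_lt_trans cle).
have hT0 : 0 <= T - h by lra.
have k2 : nd (steklov h (T - h) - z T) <= d2.
  apply: (steklov_dist_left h0 hT0 (lexx T)) => c cle; apply: hr2.
  by rewrite /ball/= distrC (le_lt_trans cle).
have := near1 _ k1; rewrite ler_norml => /andP[n1 _].
have := near2 _ k2; rewrite ler_norml => /andP[_ n2].
have n3 := ler_wpM2l (ltW M0) n2.
have ee : e1 * (1 + M) = e by rewrite /e1 divfK// gt_eqF.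
rewrite /energy_bound -/M !mulrDr; move: n1 n3 ee.
move: (E h t) (E h (T - h)) (dt (z t) (z t)) (dt (z T) (z T)) (M * (K / B)) (Rintegral _ _ _).
by move=> w1 w2 w3 w4 w5 w6; lra.
Qed.

Lemma steklov_a_ge0 h s : 0 <= ah h s.
Proof. by apply: (sip_ge0 A); apply: (gel_sub G); exact: steklov_H10. Qed.

Lemma steklov_a_continuous h : continuous (fun s => ah h s).
Proof. by apply: (sip_cont_sqr A); exact: steklov_conta. Qed.

Lemma noise_bound_ge0 : 0 <= K.
Proof. by apply: le_trans NK; apply: Rintegral_ge0 => s _; exact: sqr_ge0. Qed.

Lemma energy_bound_ge0 t : 0 <= energy_bound t.
Proof.
rewrite mulr_ge0 ?expR_ge0// addr_ge0 ?(sip_ge0 Dt)//.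
by rewrite divr_ge0 ?noise_bound_ge0 ?(ltW B0).
Qed.

Lemma energy_bound_le s t : s <= t -> energy_bound t <= energy_bound s.
Proof.
move=> st; rewrite ler_wpM2r//.
  by rewrite addr_ge0 ?(sip_ge0 Dt)// divr_ge0 ?noise_bound_ge0 ?(ltW B0).
by rewrite ler_expR ler_wpM2l ?mulr_ge0 ?(ltW B0)// lerB.
Qed.

Lemma energy_derivative t : 0 <= t <= T -> dt (z t) (z t) <= energy_bound t.
Proof.
move=> /andP[t0]; rewrite le_eqVlt => /predU1P[->|tT].
  by rewrite /energy_bound subrr mulr0 expR0 mul1r lerDl divr_ge0 ?noise_bound_ge0 ?(ltW B0).
apply/ler_addgt0Pl => e e0.
have tT' : 0 <= t < T by rewrite t0.
have [d d0 hd] := energy_limit tT' e0.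
have dd : 0 < d / 2 < d by rewrite divr_gt0//= ltr_pdivrMr// ltr_pMr// ltr1n.
have [_] := hd _ dd; rewrite [e + _]addrC; apply: le_trans.
by rewrite lerDl mulr_ge0//; apply: Rintegral_ge0 => s _; exact: steklov_a_ge0.
Qed.

(** The mean value theorem for the pairing of [y] with its own increment replaces a vector-valued
    integral of [z]. *)
Lemma energy_increment t : 0 <= t <= T ->
  dt (y T - y t) (y T - y t) <= T ^+ 2 * energy_bound t.
Proof.
move=> /andP[t0 tT]; pose W := y T - y t.
have dF (x : R) : x \in `]t, T[ -> is_derive x (1 : R) (fun s => dt (y s) W) (dt (z x) W).
  by rewrite in_itv/= => /andP[tx xT]; apply: Hd; rewrite xT (le_lt_trans t0).
have [c + E] := MVT_segment tT dF (continuous_subspaceT (sip_cont_dot Dt sip_cont_dt I)).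
rewrite in_itv/= => /andP[tc cT].
have cT' : 0 <= c <= T by rewrite cT (le_trans t0).
have WW : dt W W = dt (z c) W * (T - t) by rewrite {1}/W (sip_Bl Dt).
have zc : nd (z c) <= Num.sqrt (energy_bound t).
  rewrite ler_wsqrtr//; apply: le_trans (energy_derivative cT') _.
  exact: energy_bound_le.
have h : nd W <= T * Num.sqrt (energy_bound t).
  have [->|W0] := eqVneq (nd W) 0; first by rewrite mulr_ge0 ?sqrtr_ge0 ?(ltW T0).
  have Wp : 0 < nd W by rewrite lt0r W0 sqrtr_ge0.
  rewrite -(ler_pM2r Wp) -expr2 (nb_sqr Dt)// {1}WW.
  have tt : 0 <= T - t by rewrite subr_ge0.
  apply: (@le_trans _ _ (nd (z c) * nd W * (T - t))).
    rewrite ler_wpM2r//; apply: le_trans (ler_norm _) _; exact: (sip_CS Dt).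
  rewrite mulrC mulrA ler_wpM2r ?sqrtr_ge0//.
  by apply: ler_pM => //; rewrite ?sqrtr_ge0// gerBl.
rewrite -/W -(nb_sqr Dt)//.
apply: (@le_trans _ _ ((T * Num.sqrt (energy_bound t)) ^+ 2)).
  by rewrite lerXn2r ?nnegrE ?sqrtr_ge0 ?mulr_ge0 ?sqrtr_ge0 ?(ltW T0).
by rewrite exprMn sqr_sqrtr ?energy_bound_ge0.
Qed.

(** For the increment [W], the integral of [a (steklov h s) W] telescopes into the difference of two
    short averages of [a (y s) W] near [T] and [t], hence is close to [a W W]. Young's inequality
    [a x W <= T / 2 * a x x + a W W / (2 T)] absorbs half of it and leaves the Dirichlet integral of
    the averages. *)
Lemma energy_increment_a t : 0 <= t <= T ->
  a (y T - y t) (y T - y t) <= T / 2 * energy_bound t.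
Proof.
move=> /andP[t0]; rewrite le_eqVlt => /predU1P[->|tT].
  by rewrite subrr (sip_0l A (sip0 A)) mulr_ge0 ?energy_bound_ge0// divr_ge0// ltW.
have T1 : T != 0 by rewrite gt_eqF.
set Bd := energy_bound t; pose W := y T - y t.
have H1y s : H1 (y s) by exact: (gel_sub G).
have HW : H1 W by exact: (sipB A).
rewrite -/W; apply/ler_addgt0Pl => e e0.
have e1 : 0 < e / T by rewrite divr_gt0.
have e2 : 0 < e / 8 by rewrite divr_gt0.
have tT' : 0 <= t < T by rewrite t0.
have [d d0 hd] := energy_limit tT' e1.
pose Y (s : R) : R := a (y s) W.
have cY : continuous Y by exact: (sip_cont_dot A sip_cont_a HW).
have /cvgrPdist_le/(_ _ e2)/nbhs_ballP[r1 /= r10 hr1] := cY t.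
have /cvgrPdist_le/(_ _ e2)/nbhs_ballP[r2 /= r20 hr2] := cY T.
pose h := Num.min d (Num.min r1 r2) / 2.
have m0 : 0 < Num.min d (Num.min r1 r2) by rewrite !lt_min d0 r10 r20.
have h0 : 0 < h by rewrite divr_gt0.
have : h < Num.min d (Num.min r1 r2) by rewrite ltr_pdivrMr// ltr_pMr// ltr1n.
rewrite !lt_min => /and3P[hdd hr1' hr2'].
have h0d : 0 < h < d by rewrite h0.
have [thT HE] := hd h h0d.
have th : t <= t + h by rewrite lerDl ltW.
have hT : T - h <= T by rewrite gerBl ltW.
have tTh : t <= T - h by rewrite lerBrDr.
have h1 : h != 0 by rewrite gt_eqF.
pose Ups (s : R) : R := (\int[leb]_(x in `[-1, s]) Y x)%R.
have dU (x : R) : 0 <= x -> is_derive x (1 : R) Ups (Y x).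
  by move=> x0; apply: is_derive_primitive => //; exact: lt_le_trans x0.
have mvt (u v : R) : 0 <= u -> u <= v -> exists2 c : R, u <= c <= v & Ups v - Ups u = Y c * (v - u).
  move=> u0 uv.
  have dU' (x : R) : x \in `]u, v[ -> is_derive x (1 : R) Ups (Y x).
    by rewrite in_itv/= => /andP[ux _]; apply: dU; rewrite (le_trans u0)// ltW.
  have cU : {within `[u, v], continuous Ups}.
    apply: continuous_in_subspaceT => x; rewrite inE/= in_itv/= => /andP[ux xv].
    exact: (is_derive_continuous (dU x (le_trans u0 ux))).
  by have [c + ->] := MVT_segment uv dU' cU; rewrite in_itv/=; exists c.
have cSY : continuous (fun s => a (yh h s) W).
  by apply: (sip_cont_dot A) => //; exact: steklov_conta.
have dS (x : R) : t <= x <= T - h ->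
    is_derive x (1 : R) (fun s => h^-1 * (Ups (s + h) - Ups s)) (a (yh h x) W).
  move=> /andP[tx xT]; have x0 := le_trans t0 tx.
  have -> : a (yh h x) W = h^-1 * (Y (x + h) - Y x).
    by rewrite /steklov (sip_Zl A)// ?(sip_Bl A)//; exact: (sipB A).
  apply: is_derive_scale; apply: is_derive_sub; last exact: dU.
  by apply: is_derive_shiftr; apply: dU; rewrite addr_ge0// ltW.
have I1 := Rintegral_derive tTh (continuous_subspaceT cSY) dS; rewrite /= subrK in I1.
have [c1 /andP[c1t c1h] E1] := mvt t (t + h) t0 th.
have [c2 /andP[c2t c2h] E2] := mvt (T - h) T (le_trans t0 tTh) hT.
have b1 : `|Y t - Y c1| <= e / 8.
  apply: hr1; rewrite /ball/= ler0_norm ?subr_le0// opprB ltrBlDl (le_lt_trans c1h)//.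
  by rewrite ltrD2l.
have b2 : `|Y T - Y c2| <= e / 8.
  apply: hr2; rewrite /ball/= ger0_norm ?subr_ge0// ltrBlDl.
  by rewrite -ltrBlDr (lt_le_trans _ c2t)// ltrD2l ltrN2.
have WW : a W W = Y T - Y t by rewrite {1}/W (sip_Bl A).
have low : a W W - e / 4 <= (\int[leb]_(s in `[t, (T - h)%R]) a (yh h s) W)%R.
  rewrite I1.
  have -> : h^-1 * (Ups T - Ups (T - h)) - h^-1 * (Ups (t + h) - Ups t) = Y c2 - Y c1.
    rewrite E1 E2 opprB [T + _]addrC subrK [t + h]addrC addrK.
    by field.
  move: b1 b2; rewrite !ler_norml WW => /andP[b3 b4] /andP[b5 b6].
  by move: b3 b4 b5 b6; move: (Y t) (Y T) (Y c1) (Y c2) => w1 w2 w3 w4; lra.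
have aW0 : 0 <= a W W by exact: (sip_ge0 A).
have up : (\int[leb]_(s in `[t, (T - h)%R]) a (yh h s) W <=
    T / 2 * (\int[leb]_(s in `[t, (T - h)%R]) ah h s) + a W W / 2)%R.
  have cg : continuous (fun s => T / 2 * ah h s - - (a W W / (2 * T))).
    apply: continuous_fctB; last exact: continuous_fctC.
    by apply: continuous_fctM; [exact: continuous_fctC|exact: steklov_a_continuous].
  apply: (@le_trans _ _ (\int[leb]_(s in `[t, (T - h)%R]) (T / 2 * ah h s - - (a W W / (2 * T))))%R).
    apply: le_Rintegral_cc => // s _.
    have Hs : H1 (yh h s) by apply: (gel_sub G); exact: steklov_H10.
    have := sip_ge0 A (sipB A (sipZ A T Hs) HW).
    rewrite (sip_sqrB A)//; last exact: (sipZ A).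
    rewrite (sip_sqrZ A)// (sip_Zl A)// => h2.
    rewrite -(@ler_pM2l _ (2 * T)) ?mulr_gt0//.
    have -> : 2 * T * (T / 2 * ah h s - - (a W W / (2 * T))) = T ^+ 2 * ah h s + a W W by field.
    by move: h2; move: (ah h s) (a W W) (a (yh h s) W) => w1 w2 w3; lra.
  rewrite Rintegral_ccB//; last 2 first.
    by apply: continuous_fctM; [exact: continuous_fctC|exact: steklov_a_continuous].
    exact: continuous_fctC.
  rewrite Rintegral_ccZ; last exact: steklov_a_continuous.
  rewrite Rintegral_cst//= lebesgue_measure_itv/=.
  apply: (@le_trans _ _ (T / 2 * (\int[leb]_(s in `[t, (T - h)%R]) ah h s)%R + a W W / (2 * T) * (T - h - t))).
    rewrite lerD2l -mulNr opprK ler_wpM2l ?divr_ge0 ?mulr_ge0 ?(ltW T0)//.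
    rewrite lte_fin; case: ifP => //= _; rewrite subr_ge0//.
  rewrite lerD2l; apply: (@le_trans _ _ (a W W / (2 * T) * T)).
    rewrite ler_wpM2l ?divr_ge0 ?mulr_ge0 ?(ltW T0)//.
    by rewrite -addrA gerDl -opprD oppr_le0 addr_ge0// ltW.
  have -> : a W W / (2 * T) * T = a W W / 2 by field.
  exact: lexx.
have h3 : 2 * (\int[leb]_(s in `[t, (T - h)%R]) ah h s)%R <= Bd + e / T.
  by apply: le_trans HE; rewrite lerDr (sip_ge0 Dt).
have h4 : T * (2 * (\int[leb]_(s in `[t, (T - h)%R]) ah h s)%R) <= T * Bd + e.
  apply: le_trans (ler_wpM2l (ltW T0) h3) _.
  by rewrite mulrDr [T * (e / T)]mulrC divfK.
move: low up h4; move: (Rintegral _ _ _) (Rintegral _ _ _) (a W W) => w1 w2 w3.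
lra.
Qed.

(** The averages converge to [z s] only in [L^2]. A dual vector [v] expresses [a (z s) (z s)], up to
    [e / 2], through the [L^2] pairing with [v], and the same vector bounds the Dirichlet form of
    each average from below. *)
Lemma steklov_lsc (h : nat -> R) s (e : R) : 0 < s < T -> H1 (z s) -> 0 < e ->
  (forall k, 0 < h k) -> h @ \oo --> (0 : R) ->
  \forall k \near \oo, a (z s) (z s) <= ah (h k) s + e.
Proof.
move=> /andP[s0 sT] Hz e0 h0 hh.
have e2 : 0 < e / 2 by rewrite divr_gt0.
have [v [c [c0 hv hk]]] := gel_dual G Hz e2.
pose m := 4 * (nd v + 1).
have m0 : 0 < m by rewrite /m mulr_gt0// ltr_wpDl ?sqrtr_ge0.
have em : 0 < e / m by rewrite divr_gt0.
have /nbhs_ballP[r /= r0 hr] := sip_cont_near cz s em.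
have r1 : 0 < Num.min r (T - s) by rewrite lt_min r0 subr_gt0.
have /cvgr0Pnorm_lt/(_ _ r1) := hh; apply: filterS => k.
rewrite gtr0_norm ?h0// lt_min => /andP[hk1 hk2].
have shT : s + h k <= T by lra.
have d1 : nd (yh (h k) s - z s) <= e / m.
  apply: (steklov_dist (h0 k) (ltW s0) shT) => x xle; apply: hr.
  by rewrite /ball/= distrC (le_lt_trans xle).
have Hs : H1 (yh (h k) s) by apply: (gel_sub G); exact: steklov_H10.
have := hk _ Hs 1; rewrite expr1n mul1r mulr1 => h2.
have : `|dt (yh (h k) s - z s) v| <= e / 4.
  apply: le_trans (sip_CS Dt I I) _; apply: le_trans (ler_wpM2r (sqrtr_ge0 _) d1) _.
  rewrite /m; have n0 : 0 < nd v + 1 by rewrite ltr_wpDl ?sqrtr_ge0.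
  have -> : e / (4 * (nd v + 1)) * nd v = e / 4 * (nd v / (nd v + 1)).
    by field; rewrite gt_eqF.
  rewrite ler_piMr ?divr_ge0 ?(ltW e0)//.
  by rewrite ler_pdivrMr// mul1r lerDl.
rewrite (sip_Bl Dt)// ler_norml => /andP[h3 _].
by move: hv h2 h3; move: (dt (z s) v) (dt (yh (h k) s) v) (ah (h k) s) (a (z s) (z s)) => w1 w2 w3 w4; lra.
Qed.

(** [g] is the lower limit of the Dirichlet integrands of the averages, each cut off where its
    forward window would leave [[t, T]]. It is measurable as a limit of measurable functions,
    dominates the integrand by [steklov_lsc], and its integral is controlled by Fatou's lemma. *)
Lemma energy_gradient t : 0 <= t < T ->
  (\forall s \ae leb, 0 < s < T -> H1 (z s)) ->
  exists g : measurableTypeR R -> \bar R,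
    [/\ measurable_fun setT g, forall s, (0 <= g s)%E,
      \forall s \ae leb, t < s < T -> ((a (z s) (z s))%:E <= g s)%E &
      (\int[leb]_(s in `]t, T[) g s <= (energy_bound t / 2)%:E)%E].
Proof.
move=> /andP[t0 tT] Hz.
pose h (k : nat) : R := (T - t) / k.+2%:R.
have h0 k : 0 < h k by rewrite divr_gt0 ?subr_gt0.
have hh : h @ \oo --> (0 : R).
  apply/cvgr0Pnorm_lt => e e0.
  have e1 : 0 < e / (T - t) by rewrite divr_gt0 ?subr_gt0.
  have := near_infty_natSinv_lt (PosNum e1); apply: filterS => k /= hk.
  rewrite gtr0_norm// /h mulrC -ltr_pdivlMr ?subr_gt0//; apply: le_lt_trans hk.
  by rewrite lef_pV2 ?posrE// ler_nat.
pose D k : set (measurableTypeR R) := `[t, (T - h k)%R]%classic.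
have mD k : measurable (D k) by exact: measurable_itv.
pose f k (s : measurableTypeR R) : \bar R := (\1_(D k) s * ah (h k) s)%:E.
have f0 k s : (0 <= f k s)%E.
  by rewrite lee_fin mulr_ge0 ?steklov_a_ge0// indicE.
have mf k : measurable_fun setT (f k).
  apply/measurable_EFinP; apply: measurable_funM; first exact: measurable_indic.
  by apply: continuous_measurable_fun; exact: steklov_a_continuous.
pose g (s : measurableTypeR R) : \bar R := limn_einf (f^~ s).
have mg : measurable_fun setT g.
  apply: measurableT_comp => //.
  apply: (@measurable_fun_limn_esup _ _ _ _ (fun k s => (- f k s)%E)) => k.
  exact: measurableT_comp.
have g0 s : (0 <= g s)%E by apply: limn_einf_ge; near=> k; exact: f0.
exists g; split => //.
- apply: filterS Hz => s Hzs /andP[ts sT].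
  have s0T : 0 < s < T by rewrite sT (le_lt_trans t0).
  apply/lee_addgt0Pr => e e0.
  rewrite -leeBlDr//; apply: limn_einf_ge.
  have Ts : 0 < T - s by rewrite subr_gt0.
  have lsc := steklov_lsc s0T (Hzs s0T) e0 h0 hh.
  have /cvgr0Pnorm_lt/(_ _ Ts) := hh => hT.
  apply: filterS2 lsc hT => k le1; rewrite gtr0_norm// => lt1.
  rewrite /f indicE mem_set; last by rewrite /D/= in_itv/= (ltW ts)/= lerBrDr -lerBrDl ltW.
  by rewrite mul1r -EFinB lee_fin lerBlDr.
- have mtT : measurable (`]t, T[%classic : set (measurableTypeR R)) by exact: measurable_itv.
  have mf' k : measurable_fun (`]t, T[%classic : set (measurableTypeR R)) (f k).
    by apply: (measurable_funS measurableT (@subsetT _ _) (mf k)).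
  apply: (le_trans (@fatou _ _ _ leb _ mtT f mf' (fun k s _ => f0 k s))).
  apply/lee_addgt0Pr => e e0; rewrite -EFinD; apply: limn_einf_le.
  have tT' : 0 <= t < T by rewrite t0.
  have e2 : 0 < 2 * e by rewrite mulr_gt0.
  have [d d0 hd] := energy_limit tT' e2.
  have /cvgr0Pnorm_lt/(_ _ d0) := hh; apply: filterS => k; rewrite gtr0_norm// => hkd.
  have h0d : 0 < h k < d by rewrite h0.
  have [thT HE] := hd _ h0d.
  apply: (@le_trans _ _ (\int[leb]_(s in D k) (ah (h k) s)%:E)%E).
    have -> : f k = (fun s => (ah (h k) s)%:E) \_ (D k).
      by rewrite epatch_indic; apply/funext => s; rewrite /f EFinM muleC.
    rewrite -integral_mkcondr.
    apply: ge0_subset_integral => //.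
    - exact: measurableI.
    - apply/measurable_EFinP; apply: (measurable_funS measurableT (@subsetT _ _)).
      by apply: continuous_measurable_fun; exact: steklov_a_continuous.
    - by move=> s _; rewrite lee_fin; exact: steklov_a_ge0.
  have -> : (\int[leb]_(s in D k) (ah (h k) s)%:E = (\int[leb]_(s in D k) ah (h k) s)%R%:E)%E.
    rewrite /Rintegral fineK//; apply: integrable_fin_num => //.
    by apply: continuous_integrable_ccT; exact: steklov_a_continuous.
  rewrite lee_fin -(@ler_pM2l _ 2)// mulrDr mulrCA mulfV// mulr1.
  by apply: le_trans HE; rewrite lerDr (sip_ge0 Dt).
Unshelve. all: by end_near. Qed.

End energy.

(** * The error of the regularized solution *)

Section weak_time_derivative.
Variables (R : realType) (T : R).
Local Notation leb := (@lebesgue_measure R).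
Implicit Types f g : R -> R.

(** This replaces a second time derivative, known almost everywhere, by the continuous expression
    that the equation gives for it. *)
Lemma weak_dt_eq f f' g g' : (forall t, 0 < t < T -> f t = f' t) -> continuous g' ->
  (\forall t \ae leb, 0 < t < T -> g t = g' t) -> weak_dt T f g -> weak_dt T f' g'.
Proof.
move=> ff cg gg w psi tpsi; have := w psi tpsi.
have cpsi : continuous psi by have [/(_ 0%N)] := tpsi.
rewrite (@eq_Rintegral _ _ _ leb _ (fun t => f' t * derive1 psi t)); last first.
  by move=> t; rewrite inE/= in_itv/= => /ff ->.
rewrite (@ae_eq_lower_Rintegral _ _ _ leb `]0%R, T[%classic (fun t => g t * psi t) (fun t => g' t * psi t)).
- by move=> ->.
- exact: measurable_itv.
- have m : measurable_fun setT (fun t : R => g' t * psi t).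
    by apply: continuous_measurable_fun; exact: continuous_fctM.
  exact: (measurable_funS measurableT (@subsetT _ _) m).
- by apply: filterS gg => t h; rewrite /= in_itv/= => /h ->.
Qed.

End weak_time_derivative.

Section domain_gelfand.
Variables (R : realType) (n : nat) (Omega : smooth_domain R n).
Local Notation D := (domain_set Omega).
Local Notation V := (L2dom Omega).
Local Notation dt := (@dot R n Omega).
Local Notation a := (@dot_grad R n Omega).
Local Notation leb := (@lebesgue_measure R).

Definition test_pair (p q : V) : Prop :=
  exists phi (t : testfun D phi), p = test_vec t /\ q = test_vec (testfun_laplacian t).

Lemma domain_gelfand : gelfand dt a (@H1_set R n Omega) (@H10_set R n Omega) test_pair.
Proof.
have sq h (e : R) : 0 < e -> norm_H1 h < Num.sqrt e -> dt h h + a h h < e.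
  by rewrite norm_H1E => e0; rewrite ltr_sqrt.
have sq' h (e : R) : 0 < e -> dt h h + a h h < e ^+ 2 -> norm_H1 h < e.
  move=> e0; rewrite norm_H1E => he.
  by rewrite -[e in _ < e](gtr0_norm e0) -sqrtr_sqr ltr_sqrt// exprn_gt0.
split.
- exact: dot_sip.
- exact: dot_eq0.
- exact: dot_grad_sip.
- exact: H10_H1.
- exact: H10_0.
- by move=> s h k; exact: H10_linear.
- move=> h Hh He; apply: H10_closed => // e e0.
  by have [k Hk hk] := He _ (exprn_gt0 2 e0); exists k => //; exact: sq'.
- by move=> p q [phi [t [-> _]]]; exact: test_vec_H10.
- by move=> p q [phi [t [-> ->]]] h Hh; exact: dot_grad_test.
- move=> h e /H10_P[Hh He] e0.
  have [phi [t ht]] : exists phi (t : testfun D phi), norm_H1 (h - test_vec t) < Num.sqrt e.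
    by apply: He; rewrite sqrtr_gt0.
  by exists (test_vec t), (test_vec (testfun_laplacian t)); split; [exists phi, t|exact: sq].
- by move=> h e Hh e0; exact: dot_grad_dual.
Qed.

End domain_gelfand.

(** * Both systems as first-order equations holding at every time *)

Section classical_equations.
Variables (R : realType) (n : nat) (Omega : smooth_domain R n) (T : R).
Hypothesis T0 : 0 < T.
Local Notation V := (L2dom Omega).
Local Notation dt := (@dot R n Omega).
Local Notation a := (@dot_grad R n Omega).
Local Notation leb := (@lebesgue_measure R).
Local Notation q := (fun h k : V => dt h k + a h k).
Local Notation Dt := (dot_sip Omega).
Local Notation tp := (test_pair (Omega := Omega)).
Implicit Types (v u ut : R -> V).

Lemma H1_clamp v : in_CX (H10 Omega) T v -> sip_cont (@H1_set R n Omega) q (fun s => v (clamp T s)).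
Proof.
move=> cv; apply: (sip_cont_clamp (b := q) T0) => t /cv[Hv vc]; split; first exact: H10_H1.
by move: vc; rewrite /= (_ : @norm_H1 R n Omega = fun h => Num.sqrt (q h h))//;
  apply/funext => h; exact: norm_H1E.
Qed.

Lemma L2_clamp v : in_CX (L2_space Omega) T v -> sip_cont setT dt (fun s => v (clamp T s)).
Proof. by move=> cv; apply: (sip_cont_clamp (b := dt) T0) => t /cv[]. Qed.

Lemma H10_clamp v t : in_CX (H10 Omega) T v -> H10_set (v (clamp T t)).
Proof. by move=> cv; have [] := cv _ (clamp_itv T0 t). Qed.

Lemma clamp_in t : 0 < t < T -> clamp T t = t.
Proof. by move=> /andP[t0 tT]; rewrite clamp_id// !ltW. Qed.

Lemma clamp_derive v (v' : R -> V) (phi : V) t :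
  in_CX (H10 Omega) T v -> in_CX (L2_space Omega) T v' ->
  weak_dt T (fun t => dt (v t) phi) (fun t => dt (v' t) phi) -> 0 < t < T ->
  is_derive t (1 : R) (fun s => dt (v (clamp T s)) phi) (dt (v' (clamp T t)) phi).
Proof.
move=> cv cv' w t0T.
have c1 : continuous (fun s => dt (v (clamp T s)) phi).
  exact: (sip_cont_dot Dt (sip_cont_dt (domain_gelfand Omega) (fun t => H10_clamp t cv) (H1_clamp cv))).
have c2 : continuous (fun s => dt (v' (clamp T s)) phi) by exact: (sip_cont_dot Dt (L2_clamp cv')).
apply: (weak_dt_is_derive (T := T) c1 c2) => //.
apply: weak_dt_eq w => //; first by move=> s s0T; rewrite clamp_in.
by apply: nearW => s s0T; rewrite clamp_in.
Qed.

(** The equation identifies the weak derivative of the pairing of [ut] with [p] almost everywhere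
    with the continuous function [g], so it is a classical derivative. Adding the derivative of the
    pairing of [u] cancels the damping term. *)
Lemma original_equation (f0 f1 : V) u ut p p' t : original_solution T f0 f1 u ut ->
  tp p p' -> 0 < t < T ->
  is_derive t (1 : R) (fun s => dt (u (clamp T s) + ut (clamp T s)) p)
    (dt (u (clamp T t) + ut (clamp T t)) p').
Proof.
have key (w1 w2 w3 w4 : R) : w1 + w2 - w3 - w4 = 0 -> w1 = w3 + w4 - w2 by lra.
move=> [utt [[[_ [Hut _ _] _] cu cut wu wut] Heq _ _]] Tp t0T.
have G := domain_gelfand Omega.
have cU := sip_cont_dt G (fun t => H10_clamp t cu) (H1_clamp cu).
have cUt := L2_clamp cut.
have d1 := clamp_derive cu cut (wu p) t0T.
have Hp := gel_test G Tp.
pose g s := dt (u (clamp T s)) p' + dt (ut (clamp T s)) p' - dt (ut (clamp T s)) p.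
have cg : continuous g.
  apply: continuous_fctB; last exact: (sip_cont_dot Dt cUt).
  by apply: continuous_fctD; [exact: (sip_cont_dot Dt cU)|exact: (sip_cont_dot Dt cUt)].
have c2 : continuous (fun s => dt (ut (clamp T s)) p) by exact: (sip_cont_dot Dt cUt).
have w : weak_dt T (fun s => dt (ut (clamp T s)) p) g.
  apply: weak_dt_eq (wut p Hp) => //; first by move=> s s0T; rewrite clamp_in.
  have Hut' : \forall s \ae leb, 0 < s < T -> H1_set (ut s) := Hut.
  apply: filterS2 Hut' (Heq p Hp) => s Hs hs s0T; have := hs s0T.
  have [Hus _] : H10_set (u s) /\ True by have := H10_clamp s cu; rewrite clamp_in.
  rewrite (gel_lap G Tp (H10_H1 Hus)) (gel_lap G Tp (Hs s0T)) /g clamp_in//.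
  exact: key.
have d2 := weak_dt_is_derive c2 cg w t0T.
have := is_derive_add d1 d2.
have -> : dt (ut (clamp T t)) p + g t = dt (u (clamp T t) + ut (clamp T t)) p'.
  by rewrite (sip_Dl Dt)// /g; ring.
rewrite (_ : (fun s => _) = fun s => dt (u (clamp T s) + ut (clamp T s)) p)//.
by apply/funext => s; rewrite (sip_Dl Dt).
Qed.

(** [Z] is [e^(rho (t - T)) (u^eps + u^eps_t)] written through [v], whence the coefficient
    [1 - rho]. In this unknown the second-order equation factors into one of first order. *)
Lemma regularized_equation (rho : R) (P : {linear V -> V}) (k : R) v (v' : R -> V)
    (v'' : R -> V -> R^o) p p' t :
  (forall h, norm (P h) <= k * norm h) ->
  energy_class T v v' v'' ->
  (forall phi, H10_set phi -> \forall t \ae leb, 0 < t < T ->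
     v'' t phi + (1 - 2 * rho) * dt (v' t) phi + (rho ^+ 2 - rho) * dt (v t) phi
       + (rho - 1) * a (v t) phi - a (v' t) phi
     = (1 - rho) * dt (P (v t)) phi + dt (P (v' t)) phi) ->
  tp p p' -> 0 < t < T ->
  let Z s := v' (clamp T s) + (1 - rho) *: v (clamp T s) in
  is_derive t (1 : R) (fun s => dt (Z s) p)
    (rho * dt (Z t) p - dt (Z t) p' + dt (P (Z t)) p).
Proof.
have key (w1 w2 w3 w4 w5 w6 w7 : R) :
      w1 + (1 - 2 * rho) * w3 + (rho ^+ 2 - rho) * w2 + (rho - 1) * - w4 - - w5 =
        (1 - rho) * w6 + w7 ->
      w1 = - (1 - 2 * rho) * w3 - (rho ^+ 2 - rho) * w2 + (rho - 1) * w4 - w5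
        + (1 - rho) * w6 + w7 by lra.
move=> HP [[_ [Hv' _ _] _] cv cv' wv wv'] Heq Tp t0T Z.
have G := domain_gelfand Omega.
have cV := sip_cont_dt G (fun t => H10_clamp t cv) (H1_clamp cv).
have cV' := L2_clamp cv'.
have cPV := sip_cont_bounded (erefl _) HP cV.
have cPV' := sip_cont_bounded (erefl _) HP cV'.
have d1 := clamp_derive cv cv' (wv p) t0T.
have Hp := gel_test G Tp.
pose g s := - (1 - 2 * rho) * dt (v' (clamp T s)) p - (rho ^+ 2 - rho) * dt (v (clamp T s)) p
  + (rho - 1) * dt (v (clamp T s)) p' - dt (v' (clamp T s)) p'
  + (1 - rho) * dt (P (v (clamp T s))) p + dt (P (v' (clamp T s))) p.
have cs (c : R) (f : R -> R) : continuous f -> continuous (fun s => c * f s).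
  by move=> cf; apply: continuous_fctM => //; exact: continuous_fctC.
have cg : continuous g.
  apply: continuous_fctD; last exact: (sip_cont_dot Dt cPV').
  apply: continuous_fctD; last by apply: cs; exact: (sip_cont_dot Dt cPV).
  apply: continuous_fctB; last exact: (sip_cont_dot Dt cV').
  apply: continuous_fctD; last by apply: cs; exact: (sip_cont_dot Dt cV).
  by apply: continuous_fctB; apply: cs; [exact: (sip_cont_dot Dt cV')|exact: (sip_cont_dot Dt cV)].
have c2 : continuous (fun s => dt (v' (clamp T s)) p) by exact: (sip_cont_dot Dt cV').
have w : weak_dt T (fun s => dt (v' (clamp T s)) p) g.
  apply: weak_dt_eq (wv' p Hp) => //; first by move=> s s0T; rewrite clamp_in.
  have Hv'' : \forall s \ae leb, 0 < s < T -> H1_set (v' s) := Hv'.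
  apply: filterS2 Hv'' (Heq p Hp) => s Hs hs s0T; have := hs s0T.
  have [Hvs _] : H10_set (v s) /\ True by have := H10_clamp s cv; rewrite clamp_in.
  rewrite (gel_lap G Tp (H10_H1 Hvs)) (gel_lap G Tp (Hs s0T)) /g clamp_in//.
  exact: key.
have d2 := weak_dt_is_derive c2 cg w t0T.
have := is_derive_add d2 (is_derive_scale (1 - rho) d1).
have -> : g t + (1 - rho) * dt (v' (clamp T t)) p = rho * dt (Z t) p - dt (Z t) p' + dt (P (Z t)) p.
  have PE : P (Z t) = P (v' (clamp T t)) + (1 - rho) *: P (v (clamp T t)).
    by rewrite /Z linearD linearZ.
  rewrite PE /Z /g !(sip_Dl Dt)// !(sip_Zl Dt)//; ring.
rewrite (_ : (fun s => _) = fun s => dt (Z s) p)//.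
by apply/funext => s; rewrite /Z (sip_Dl Dt)// (sip_Zl Dt).
Qed.

End classical_equations.

Lemma ge0_le_integrable d (X : measurableType d) (R : realType)
    (mu : {measure set X -> \bar R}) (F : X -> R) (K : R) :
  measurable_fun setT F -> (forall x, 0 <= F x) -> (\int[mu]_x (F x)%:E <= K%:E)%E ->
  mu.-integrable setT (EFin \o F) /\ (\int[mu]_x F x <= K)%R.
Proof.
move=> mF F0 FK.
have I : mu.-integrable setT (EFin \o F).
  apply/integrableP; split; first exact/measurable_EFinP.
  apply: le_lt_trans (ltry K); apply: le_trans FK.
  rewrite le_eqVlt; apply/orP; left; apply/eqP; apply: eq_integral => x _.
  by rewrite /= ger0_norm.
split => //; rewrite -lee_fin /Rintegral fineK//.
by have := integrable_fin_num measurableT I.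
Qed.

(** * Norms in time of the exact solution *)

Section time_dependent_facts.
Variables (R : realType) (V : lmodType R) (X : nspace V) (T : R).
Hypotheses (T0 : 0 < T) (nX : normed_subspace X).
Local Notation leb := (@lebesgue_measure R).
Implicit Types f g : R -> V.

Lemma in_L2X_eq f g : (forall t, 0 < t < T -> f t = g t) -> in_L2X X T f -> in_L2X X T g.
Proof.
move=> fg [Cf [s hs cs] ff]; split.
- by apply: filterS Cf => t h tT; rewrite -fg//; exact: h.
- by exists s => //; apply: filterS cs => t h tT; rewrite -fg//; exact: h.
- have -> : sqnorm_L2X X T g = sqnorm_L2X X T f => //.
  by apply: eq_integral => t; rewrite inE/= in_itv/= => /fg ->.
Qed.

(** The supremum is an upper bound because the set of values is bounded: the norm is continuous in
    time on a compact interval. *)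
Lemma norm_CX_ub f t : in_CX X T f -> 0 <= t <= T -> nrm X (f t) <= norm_CX X T f.
Proof.
move=> cf tT.
pose nu s := nrm X (f (clamp T s)).
have Cf s : carrier X (f (clamp T s)) by have [] := cf _ (clamp_itv T0 s).
have cnu : continuous nu.
  move=> s; apply/cvgrPdist_le => e e0.
  have [_ h] := cf _ (clamp_itv T0 s).
  have /cvgr0Pnorm_le/(_ e e0) := cvg_comp _ _ (@clamp_within R T T0 s) h.
  apply: filterS => x; rewrite ger0_norm ?nrm_ge0//; last exact: nspaceB.
  by move=> hx; rewrite distrC (le_trans (nrm_dist nX (Cf x) (Cf s))).
have [c cT hc] := EVT_max (ltW T0) (continuous_subspaceT cnu).
apply: ub_le_sup; last by exists t; rewrite //= in_itv.
exists (nu c) => _ [s /= sT <-]; have := hc s sT.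
by rewrite /nu clamp_id//; move: sT; rewrite in_itv.
Qed.

(** [N] adds the constant [norm_CX X T f] to a measurable version of the norm of [g]. With
    [(S + n)^2 <= 2 S^2 + 2 n^2], the first part contributes at most [M T] and the second at most
    [M]. *)
Lemma noise_square f g M k : in_CX X T f -> in_L2X X T g ->
  ((norm_CX X T f ^+ 2)%:E + sqnorm_L2X X T g <= M%:E)%E -> 0 <= k ->
  exists N : measurableTypeR R -> R,
  [/\ leb.-integrable setT (EFin \o (fun t => N t ^+ 2)),
      (\int[leb]_t (N t ^+ 2) <= 2 * k ^+ 2 * (M * (T + 1)))%R &
      \forall t \ae leb, 0 < t < T -> k * nrm X (f t + g t) <= N t].
Proof.
move=> cf [Cg sg fin] hM k0.
have C0 : carrier X 0 by case: nX.
have [n [mn n0 nout nae]] := nrm_ae_measurable nX Cg sg C0.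
pose S := norm_CX X T f; pose D : set (measurableTypeR R) := `]0%R, T[%classic.
have mD : measurable D by exact: measurable_itv.
have S0 : 0 <= S.
  have T00 : 0 <= (0 : R) <= T by rewrite lexx ltW.
  apply: le_trans (norm_CX_ub cf T00); apply: nrm_ge0 => //.
  by have [] := cf _ T00.
pose N (t : measurableTypeR R) : R := k * (S * \1_D t + n t).
pose F (t : measurableTypeR R) : R := N t ^+ 2.
have mN : measurable_fun setT N.
  apply: measurable_funM => //; apply: measurable_funD => //.
  by apply: measurable_funM => //; exact: measurable_indic.
have mn2 : measurable_fun setT (fun t => (n t ^+ 2)%:E).
  by apply/measurable_EFinP; exact: measurable_funX.
have mi : measurable_fun setT (fun t => (S ^+ 2 * \1_D t)%:E).
  by apply/measurable_EFinP; apply: measurable_funM => //; exact: measurable_indic.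
have n2E : (\int[leb]_t (n t ^+ 2)%:E = sqnorm_L2X X T g)%E.
  have -> : sqnorm_L2X X T g = (\int[leb]_(t in D) (n t ^+ 2)%:E)%E.
    apply: ae_eq_lower_integral => //.
      exact: (measurable_funS measurableT (@subsetT _ _) mn2).
    by apply: filterS nae => t h; rewrite /D/= in_itv/= => /h ->; rewrite subr0.
  rewrite [RHS]integral_mkcond; apply: eq_integral => t _; rewrite patchE.
  case: ifPn => //; rewrite notin_setE /D/= in_itv/= => nt.
  by rewrite nout// expr0n.
have FK : (\int[leb]_t (F t)%:E <= (2 * k ^+ 2 * (M * (T + 1)))%:E)%E.
  apply: (@le_trans _ _ (\int[leb]_t ((2 * k ^+ 2)%:E * ((S ^+ 2 * \1_D t)%:E + (n t ^+ 2)%:E)))%E).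
    apply: ge0_le_integral => //.
    - by move=> t _; rewrite lee_fin sqr_ge0.
    - by apply/measurable_EFinP; exact: measurable_funX.
    - by apply: emeasurable_funM => //; exact: emeasurable_funD.
    - move=> t _; rewrite -EFinD -EFinM lee_fin /F /N exprMn.
      rewrite [2 * _]mulrC -[leRHS]mulrA ler_wpM2l ?sqr_ge0//.
      have iE : \1_D t ^+ 2 = \1_D t :> R by rewrite indicE; case: (_ \in _); rewrite ?expr1n ?expr0n.
      rewrite -[in leRHS]iE.
      by have := sqr_ge0 (S * \1_D t - n t); move: (\1_D t : R) => i; rewrite sqrrB sqrrD exprMn; lra.
  rewrite ge0_integralZl//; last 3 first.
  - exact: emeasurable_funD.
  - by move=> t _; rewrite -EFinD lee_fin addr_ge0 ?mulr_ge0 ?sqr_ge0// indicE.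
  - by rewrite lee_fin mulr_ge0 ?sqr_ge0.
  rewrite ge0_integralD//; last 2 first.
  - by move=> t _; rewrite lee_fin mulr_ge0 ?sqr_ge0// indicE.
  - by move=> t _; rewrite lee_fin sqr_ge0.
  rewrite [X in (_ <= X)%E]EFinM lee_wpmul2l ?lee_fin ?mulr_ge0 ?sqr_ge0// n2E.
  have -> : (\int[leb]_t (S ^+ 2 * \1_D t)%:E = (S ^+ 2 * T)%:E)%E.
    under eq_integral do rewrite EFinM.
    rewrite ge0_integralZl//; last 2 first.
    - by apply/measurable_EFinP; exact: measurable_indic.
    - by rewrite lee_fin sqr_ge0.
    have LD : leb `]0%R, T[%classic = T%:E.
      by rewrite lebesgue_measure_itv/= lte_fin T0 -EFinB subr0.
    by rewrite integral_indic// setIT [X in (_ * X)%E]LD -EFinM.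
  have sn0 : (0 <= sqnorm_L2X X T g)%E by apply: integral_ge0 => t _; rewrite lee_fin sqr_ge0.
  have sf : sqnorm_L2X X T g \is a fin_num by rewrite ge0_fin_numE.
  move: hM sn0; rewrite -/S -(fineK sf) -!EFinD !lee_fin; set s := fine _ => hM sn0.
  have SM : S ^+ 2 <= M by apply: le_trans hM; rewrite lerDl.
  have h1 : S ^+ 2 * T <= M * T by rewrite ler_wpM2r// ltW.
  have h2 : s <= M by apply: le_trans hM; rewrite lerDr sqr_ge0.
  by rewrite mulrDr mulr1 lerD.
have [I1 I2] := ge0_le_integrable (measurable_funX 2 mN) (fun t => sqr_ge0 (N t)) FK.
exists N; split => //.
have Cg' : \forall t \ae leb, 0 < t < T -> carrier X (g t) := Cg.
apply: filterS2 Cg' nae => t ht hn tT.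
have tT' : 0 <= t <= T by case/andP: tT => *; rewrite !ltW.
have [Cft _] := cf _ tT'.
rewrite /N ler_wpM2l// indicE mem_set; last by rewrite /D/= in_itv.
rewrite mulr1 hn// subr0; apply: le_trans (nrm_triangle nX Cft (ht tT)) _.
by rewrite lerD2r; exact: norm_CX_ub.
Qed.

End time_dependent_facts.

(** * The error between the two solutions *)

Section error_system.
Variables (R : realType) (n : nat) (Omega : smooth_domain R n) (T : R).
Local Notation V := (L2dom Omega).
Local Notation dt := (@dot R n Omega).
Local Notation a := (@dot_grad R n Omega).
Local Notation leb := (@lebesgue_measure R).
Local Notation q := (fun h k : V => dt h k + a h k).
Local Notation Dt := (dot_sip Omega).
Local Notation tp := (test_pair (Omega := Omega)).
Local Notation G := (domain_gelfand Omega).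
Variables (rho B C0 M gam : R) (W : nspace V) (P Q : {linear V -> V}).
Variables (f0 f1 : V) (u ut ue uet : R -> V).
Hypotheses (T0 : 0 < T) (B0 : 0 < B) (C00 : 0 < C0) (g0 : 0 < gam)
  (nW : normed_subspace W)
  (HQ : forall h, carrier W h -> norm (Q h) <= C0 * nrm W h / gam)
  (HP : forall h, norm (P h) <= B * norm h)
  (HL : two_laplacian_plus W P Q)
  (Hu : original_solution T f0 f1 u ut) (cu : in_CX W T u) (cut : in_L2X W T ut)
  (hM : ((norm_CX W T u ^+ 2)%:E + sqnorm_L2X W T ut <= M%:E)%E).

Lemma spaceH1_domain : spaceH1 dt a (@H1_set R n Omega) = H1 Omega.
Proof. by rewrite /spaceH1 /H1; congr NSpace; apply/funext => h; rewrite norm_H1E. Qed.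

Lemma original_derivative_in_H10 : \forall t \ae leb, 0 < t < T -> H10_set (ut t).
Proof.
have [utt [[[_ L2ut _] cuH cutL wu _] _ _ _]] := Hu.
have L2ut' : in_L2X (spaceH1 dt a (@H1_set R n Omega)) T (fun s => ut (clamp T s)).
  rewrite spaceH1_domain; apply: in_L2X_eq L2ut => t tT.
  by rewrite clamp_in.
have Hc (w : V) : continuous (fun s => dt (ut (clamp T s)) w).
  exact: (sip_cont_dot Dt (L2_clamp T0 cutL)).
have Hd (w : V) (t : R) : 0 < t < T ->
    is_derive t (1 : R) (fun s => dt (u (clamp T s)) w) (dt (ut (clamp T t)) w).
  by move=> t0T; exact: (clamp_derive T0 cuH cutL (wu w) t0T).
have := derivative_in_H10 G (fun t _ => H10_clamp T0 t cuH) Hd Hc L2ut'.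
by apply: filterS => t h tT; have := h tT; rewrite clamp_in.
Qed.

(** The tested source is the pairing of [Q (u + ut)] with [p]. Membership of [u t + ut t] in [H^1_0]
    and in [W] is settled before [p] is chosen, so a single null set serves all test functions. *)
Lemma noise_test : exists N : measurableTypeR R -> R,
  [/\ leb.-integrable setT (EFin \o (fun t => N t ^+ 2)),
      (\int[leb]_t (N t ^+ 2) <= 2 * (C0 / gam) ^+ 2 * (M * (T + 1)))%R &
      \forall t \ae leb, 0 < t < T -> forall p p', tp p p' ->
        `|dt (P (u t + ut t)) p - 2 * dt (u t + ut t) p'| <= Num.sqrt (dt p p) * N t].
Proof.
have k0 : 0 <= C0 / gam by rewrite divr_ge0// ltW.
have [N [I1 I2 I3]] := noise_square T0 nW cu cut hM k0.
exists N; split => //.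
have [Cut _ _] := cut.
have Cut' : \forall t \ae leb, 0 < t < T -> carrier W (ut t) := Cut.
have [utt [[_ cuH _ _ _] _ _ _]] := Hu.
apply: filterS3 original_derivative_in_H10 Cut' I3 => t h1 h2 h3 tT p p' [phi [tphi [-> ->]]].
have tT' : 0 <= t <= T by case/andP: tT => *; rewrite !ltW.
have [Hut _] := cuH _ tT'; have [Wu _] := cu tT'.
have HS : H10_set (u t + ut t) := H10D G Hut (h1 tT).
have WS : carrier W (u t + ut t) := nspaceD nW Wu (h2 tT).
have [g gS PS] := HL HS (or_introl WS).
rewrite (is_laplacianE tphi gS) PS (sip_Dl Dt)// (sip_Zl Dt)// addrAC subrr add0r.
apply: le_trans (sip_CS Dt I I) _; rewrite mulrC ler_wpM2l ?sqrtr_ge0//.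
apply: le_trans (HQ WS) _; apply: le_trans (h3 tT).
by rewrite mulrAC.
Qed.

Variables (v v' : R -> V) (v'' : R -> V -> R^o).
Hypotheses (Ev : energy_class T v v' v'')
  (Heqv : forall phi, H10_set phi -> \forall t \ae leb, 0 < t < T ->
     v'' t phi + (1 - 2 * rho) * dt (v' t) phi + (rho ^+ 2 - rho) * dt (v t) phi
       + (rho - 1) * a (v t) phi - a (v' t) phi
     = (1 - rho) * dt (P (v t)) phi + dt (P (v' t)) phi)
  (vE : forall t, 0 <= t <= T ->
     v t = expR (rho * (t - T)) *: ue t /\
     v' t = expR (rho * (t - T)) *: (uet t + rho *: ue t)).

(* [err'] is the time derivative of [err]. *)
Definition err t : V := expR (t - T) *: (ue t - u t).
Definition err' t : V := expR (t - T) *: ((ue t + uet t) - (u t + ut t)).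

(** On [[0, T]], [y] and [z] are [err] and [err']. They are written through [v], for which the
    regularity is assumed, and through [clamp], to be continuous on the whole line. *)
Let y s : V := expR ((1 - rho) * (s - T)) *: v (clamp T s) - expR (1 * (s - T)) *: u (clamp T s).
Let Z s : V := v' (clamp T s) + (1 - rho) *: v (clamp T s).
Let S s : V := u (clamp T s) + ut (clamp T s).
Let z s : V := expR ((1 - rho) * (s - T)) *: Z s - expR (1 * (s - T)) *: S s.

Let expM t : expR ((1 - rho) * (t - T)) * expR (rho * (t - T)) = expR (t - T).
Proof. by rewrite -expRD; congr expR; ring. Qed.

Let yE t : 0 <= t <= T -> y t = err t.
Proof.
move=> tT; have [E _] := vE tT.
by rewrite /y clamp_id// E scalerA expM mul1r -scalerBr.
Qed.

Let zE t : 0 <= t <= T -> z t = err' t.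
Proof.
move=> tT; have [E E'] := vE tT.
have key (e1 e2 : R) (x w : V) : e1 *: (e2 *: (x + rho *: w) + (1 - rho) *: (e2 *: w)) =
    (e1 * e2) *: (w + x).
  rewrite [(1 - rho) *: (e2 *: w)]scalerA [(1 - rho) * e2]mulrC -[(e2 * (1 - rho)) *: w]scalerA.
  rewrite -scalerDr scalerA; congr (_ *: _).
  by rewrite scalerBl scale1r [w - _]addrC addrA addrK addrC.
by rewrite /z /Z /S clamp_id// E E' key expM mul1r -scalerBr.
Qed.

Let Hy t : H10_set (y t).
Proof.
have [_ cv _ _ _] := Ev; have [utt [[_ cuH _ _ _] _ _ _]] := Hu.
by apply: (H10B G); apply: (H10Z G); exact: (H10_clamp T0).
Qed.

Let cy : sip_cont (@H1_set R n Omega) q y.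
Proof.
have [_ cv _ _ _] := Ev; have [utt [[_ cuH _ _ _] _ _ _]] := Hu.
by apply: (sip_contB (gel_q G)); apply: (sip_contM (gel_q G));
  (exact: exp_affine_continuous || exact: (H1_clamp T0)).
Qed.

Let cS : sip_cont setT dt S.
Proof.
have [utt [[_ cuH cutL _ _] _ _ _]] := Hu.
apply: (sip_contD Dt); last exact: (L2_clamp T0).
exact: (sip_cont_dt G (fun t => H10_clamp T0 t cuH) (H1_clamp T0 cuH)).
Qed.

Let cZ : sip_cont setT dt Z.
Proof.
have [_ cv cv' _ _] := Ev.
apply: (sip_contD Dt); first exact: (L2_clamp T0).
apply: (sip_contZ Dt).
exact: (sip_cont_dt G (fun t => H10_clamp T0 t cv) (H1_clamp T0 cv)).
Qed.

Let cz : sip_cont setT dt z.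
Proof.
by apply: (sip_contB Dt); apply: (sip_contM Dt) => //; exact: exp_affine_continuous.
Qed.

Let Hd (w : V) (t : R) : 0 < t < T ->
  is_derive t (1 : R) (fun s => dt (y s) w) (dt (z t) w).
Proof.
move=> tT.
have [_ cv cv' wv _] := Ev; have [utt [[_ cuH cutL wu _] _ _ _]] := Hu.
have d1 := is_derive_mul (is_derive_exp_affine (1 - rho) T t) (clamp_derive T0 cv cv' (wv w) tT).
have d2 := is_derive_mul (is_derive_exp_affine 1 T t) (clamp_derive T0 cuH cutL (wu w) tT).
have := is_derive_sub d1 d2.
set D := (X in is_derive _ _ _ X) => dD.
have -> : dt (z t) w = D.
  rewrite /z /Z /S /D (sip_Bl Dt)// !(sip_Zl Dt)// !(sip_Dl Dt)// (sip_Zl Dt)//; ring.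
rewrite (_ : (fun s => dt (y s) w) = fun s => expR ((1 - rho) * (s - T)) * dt (v (clamp T s)) w
  - expR (1 * (s - T)) * dt (u (clamp T s)) w)//.
by apply/funext => s; rewrite /y (sip_Bl Dt)// !(sip_Zl Dt).
Qed.

(** The original equation has [Delta] where the regularized one has [- Delta + P]. Writing the
    difference in terms of [z] therefore leaves [P - 2 Delta] applied to the original [u + ut], with
    the exponential weight, which is at most 1. *)
Let Heq (N : measurableTypeR R -> R) :
  (\forall t \ae leb, 0 < t < T -> forall p p', tp p p' ->
     `|dt (P (u t + ut t)) p - 2 * dt (u t + ut t) p'| <= Num.sqrt (dt p p) * N t) ->
  forall p p', tp p p' -> exists r : R -> R, [/\ continuous r,
     forall t, 0 < t < T -> is_derive t (1 : R) (fun s => dt (z s) p)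
       (dt (z t) p - dt (z t) p' + dt (P (z t)) p + r t) &
     \forall t \ae leb, 0 < t < T -> `|r t| <= Num.sqrt (dt p p) * N t].
Proof.
move=> HN p p' Tp.
exists (fun t => expR (1 * (t - T)) * (dt (P (S t)) p - 2 * dt (S t) p')); split.
- apply: continuous_fctM; first exact: exp_affine_continuous.
  apply: continuous_fctB.
    exact: (sip_cont_dot Dt (sip_cont_bounded (erefl _) HP cS)).
  by apply: continuous_fctM; [exact: continuous_fctC|exact: (sip_cont_dot Dt cS)].
- move=> t tT.
  have d1 := is_derive_mul (is_derive_exp_affine (1 - rho) T t) (regularized_equation T0 HP Ev Heqv Tp tT).
  have d2 := is_derive_mul (is_derive_exp_affine 1 T t) (original_equation T0 Hu Tp tT).
  have := is_derive_sub d1 d2.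
  set D := (X in is_derive _ _ _ X) => dD.
  have Pz : P (z t) = expR ((1 - rho) * (t - T)) *: P (Z t) - expR (1 * (t - T)) *: P (S t).
    by rewrite /z linearB !linearZ.
  have -> : dt (z t) p - dt (z t) p' + dt (P (z t)) p +
      expR (1 * (t - T)) * (dt (P (S t)) p - 2 * dt (S t) p') = D.
    rewrite Pz /z /D !(sip_Bl Dt)// !(sip_Zl Dt)// -/(Z t) -/(S t); ring.
  rewrite (_ : (fun s => dt (z s) p) = fun s => expR ((1 - rho) * (s - T)) * dt (Z s) p
    - expR (1 * (s - T)) * dt (S s) p)//.
  by apply/funext => s; rewrite /z (sip_Bl Dt)// !(sip_Zl Dt).
- apply: filterS HN => t h tT; rewrite normrM ger0_norm ?expR_ge0//.
  have e1 : expR (1 * (t - T)) <= 1.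
    rewrite -[leRHS](expR0 R) ler_expR mul1r subr_le0.
    by case/andP: tT => _ /ltW.
  apply: le_trans (h tT p p' Tp); rewrite /S clamp_in//.
  by apply: le_trans (ler_wpM2r (normr_ge0 _) e1) _; rewrite mul1r.
Qed.

Let K := 2 * (C0 / gam) ^+ 2 * (M * (T + 1)).
Definition error_bound t := energy_bound dt T err' B K t.

Let boundE t : energy_bound dt T z B K t = error_bound t.
Proof. by rewrite /error_bound /energy_bound zE// lexx ltW. Qed.

Lemma error_ae_H1 : \forall s \ae leb, 0 < s < T ->
  [/\ H1_set (uet s), H1_set (ut s) & H1_set (err' s)].
Proof.
have [[_ [Hv' _ _] _] cv _ _ _] := Ev; have [utt [[[_ [Hut _ _] _] cuH _ _ _] _ _ _]] := Hu.
have Hv'' : \forall s \ae leb, 0 < s < T -> H1_set (v' s) := Hv'.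
have Hut' : \forall s \ae leb, 0 < s < T -> H1_set (ut s) := Hut.
apply: filterS2 Hv'' Hut' => s hv hu sT.
have sT' : 0 <= s <= T by case/andP: sT => *; rewrite !ltW.
have A := gel_a G.
have [/H10_H1 Hv1 _] := cv _ sT'; have [/H10_H1 Hu1 _] := cuH _ sT'.
have [E E'] := vE sT'.
have Ei (c : V) : c = expR (- (rho * (s - T))) *: (expR (rho * (s - T)) *: c).
  by rewrite scalerA -expRD addNr expR0 scale1r.
have Hue1 : H1_set (ue s) by rewrite (Ei (ue s)) -E; exact: (sipZ A).
have Huet : H1_set (uet s).
  rewrite -[uet s](addrK (rho *: ue s)) (Ei (uet s + _)) -E'.
  by apply: (sipB A); apply: (sipZ A) => //; exact: hv.
split => //; first exact: hu.
by apply: (sipZ A); apply: (sipB A); apply: (sipD A) => //; exact: hu.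
Qed.

Lemma error_H1 t : 0 <= t <= T -> H1_set (ue t - u t).
Proof.
move=> tT; have := Hy t; rewrite yE// => /H10_H1 h.
rewrite -[ue t - u t]scale1r -(expR0 R) -(addNr (t - T)) expRD -scalerA.
exact: (sipZ (gel_a G)).
Qed.

Lemma error_estimates t : 0 <= t <= T ->
  [/\ dt (err' t) (err' t) <= error_bound t,
      dt (err T - err t) (err T - err t) <= T ^+ 2 * error_bound t &
      a (err T - err t) (err T - err t) <= T / 2 * error_bound t].
Proof.
move=> tT; have TT : 0 <= T <= T by rewrite lexx ltW.
have [N [I1 I2 I3]] := noise_test.
rewrite -!yE// -zE// -boundE; split.
- exact: (energy_derivative G T0 Hy Hd cy cz B0 HP I1 (Heq I3) I2 tT).
- exact: (energy_increment G T0 Hy Hd cy cz B0 HP I1 (Heq I3) I2 tT).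
- exact: (energy_increment_a G T0 Hy Hd cy cz B0 HP I1 (Heq I3) I2 tT).
Qed.

Lemma error_gradient t : 0 <= t < T -> exists g : measurableTypeR R -> \bar R,
  [/\ measurable_fun setT g, forall s, (0 <= g s)%E,
    \forall s \ae leb, t < s < T -> ((a (err' s) (err' s))%:E <= g s)%E &
    (\int[leb]_(s in `]t, T[) g s <= (error_bound t / 2)%:E)%E].
Proof.
move=> tT; have [N [I1 I2 I3]] := noise_test.
have Hz : \forall s \ae leb, 0 < s < T -> H1_set (z s).
  apply: filterS error_ae_H1 => s h sT; have [_ _] := h sT.
  by rewrite zE//; case/andP: sT => *; rewrite !ltW.
have := energy_gradient G T0 Hy Hd cy cz B0 HP I1 (Heq I3) I2 tT Hz.
rewrite boundE => -[g [mg gg0 gz Ig]]; exists g; split; [exact: mg|exact: gg0| |exact: Ig].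
apply: filterS gz => s h ts; have := h ts; rewrite zE//.
by case/andP: tT => t0 _; case/andP: ts => t1 /ltW->; rewrite (le_trans t0 (ltW t1)).
Qed.

Lemma error_bound_ge0 t : 0 <= error_bound t.
Proof. by have [N [_ I2 _]] := noise_test; exact: (energy_bound_ge0 G T err' B0 I2). Qed.

Lemma error_bound_le s t : s <= t -> error_bound t <= error_bound s.
Proof. by have [N [_ I2 _]] := noise_test; exact: (energy_bound_le G T err' B0 I2). Qed.

Let errE t : ue t - u t = expR (T - t) *: err t.
Proof. by rewrite /err scalerA -expRD addrA subrK subrr expR0 scale1r. Qed.

Let err'E t : uet t - ut t = expR (T - t) *: err' t - (ue t - u t).
Proof.
rewrite /err' scalerA -expRD addrA subrK subrr expR0 scale1r.
by rewrite opprD addrACA [RHS]addrAC subrr add0r.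
Qed.

Let exp2 t : expR (T - t) ^+ 2 = expR (2 * (T - t)).
Proof. by rewrite expr2 -expRD; congr expR; ring. Qed.

(** The increment from [T] and the terminal error are combined by [|x - y|^2 <= 2 |x|^2 + 2 |y|^2];
    the exponential factor undoes the weight in [err]. *)
Lemma displacement_estimate t (e : R) : 0 <= t <= T -> norm_H1 (ue T - u T) <= e ->
  dt (ue t - u t) (ue t - u t) <=
    expR (2 * (T - t)) * (2 * T ^+ 2 * error_bound t + 2 * e ^+ 2) /\
  a (ue t - u t) (ue t - u t) <= expR (2 * (T - t)) * (T * error_bound t + 2 * e ^+ 2).
Proof.
move=> tT he; have TT : 0 <= T <= T by rewrite lexx ltW.
have A := gel_a G.
have [_ h1 h2] := error_estimates tT.
have HT : H1_set (err T) by rewrite -yE//; apply: H10_H1; exact: Hy.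
have Ht : H1_set (err t) by rewrite -yE//; apply: H10_H1; exact: Hy.
have eT : err T = ue T - u T by rewrite errE subrr expR0 scale1r.
have := he; rewrite -eT => he'.
have e2 : dt (err T) (err T) + a (err T) (err T) <= e ^+ 2.
  rewrite -norm_H1_sqr// lerXn2r ?nnegrE//; first exact: sqrtr_ge0.
  by apply: le_trans he'; exact: sqrtr_ge0.
have d0 := sip_ge0 Dt (x := err T) I; have a0 := sip_ge0 A HT.
have E : err t = err T - (err T - err t) by rewrite opprB addrC subrK.
have k1 : dt (err t) (err t) <= 2 * T ^+ 2 * error_bound t + 2 * e ^+ 2.
  rewrite {1 2}E; apply: le_trans (sip_sqrB_le Dt I I) _.
  rewrite -[2 * T ^+ 2 * _]mulrA -!mulrDr ler_pM2l// addrC lerD//.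
  by rewrite (le_trans _ e2)// lerDl.
have k2 : a (err t) (err t) <= T * error_bound t + 2 * e ^+ 2.
  rewrite {1 2}E; apply: le_trans (sip_sqrB_le A HT (sipB A HT Ht)) _.
  have -> : T * error_bound t = 2 * (T / 2 * error_bound t).
    by rewrite [2 * _]mulrC mulrAC divfK.
  rewrite -!mulrDr ler_pM2l// addrC lerD//.
  by rewrite (le_trans _ e2)// lerDr.
by rewrite errE (sip_sqrZ Dt)// (sip_sqrZ A)// exp2 !ler_pM2l ?expR_gt0.
Qed.

Lemma velocity_estimate t : 0 <= t <= T ->
  dt (uet t - ut t) (uet t - ut t) <=
    2 * expR (2 * (T - t)) * error_bound t + 2 * dt (ue t - u t) (ue t - u t).
Proof.
move=> tT; have [h1 _ _] := error_estimates tT.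
rewrite err'E; apply: le_trans (sip_sqrB_le Dt I I) _.
by rewrite (sip_sqrZ Dt)// exp2 lerD2r -mulrA ler_pM2l// ler_pM2l ?expR_gt0.
Qed.

(** From [w_t = z - w], the integrand is at most [c g + 2 A] almost everywhere, with the measurable
    [g] of [error_gradient]. Comparison with a measurable majorant is what a lower integral
    allows. *)
Lemma velocity_gradient_estimate t (A : R) : 0 <= t <= T ->
  (forall s, t <= s <= T -> a (ue s - u s) (ue s - u s) <= A) ->
  (\int[leb]_(s in `]t, T[) (sqdist_grad (uet s) (ut s))%:E <=
    (expR (2 * (T - t)) * error_bound t + 2 * A * T)%:E)%E.
Proof.
move=> /andP[t0 tT] hA; have SA := gel_a G.
have A0 : 0 <= A.
  have TT : t <= T <= T by rewrite tT lexx.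
  by apply: le_trans (hA T TT); apply: (sip_ge0 SA); apply: error_H1; rewrite lexx ltW.
have e0 := expR_ge0 (2 * (T - t)).
move: tT; rewrite le_eqVlt => /predU1P[tT|tT].
  rewrite tT set_itv_ge ?bnd_simp// integral_set0 lee_fin.
  apply: addr_ge0; apply: mulr_ge0; rewrite ?expR_ge0 ?error_bound_ge0 ?(ltW T0)//.
  by rewrite mulr_ge0.
have tT' : 0 <= t < T by rewrite t0.
have [g [mg gg0 gz Ig]] := error_gradient tT'.
pose c := 2 * expR (2 * (T - t)).
have c0 : 0 <= c by rewrite mulr_ge0.
have mD : measurable (`]t, T[%classic : set (measurableTypeR R)) by exact: measurable_itv.
have mg' : measurable_fun (`]t, T[%classic : set (measurableTypeR R)) g.
  exact: (measurable_funS measurableT (@subsetT _ _) mg).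
have mcg : measurable_fun (`]t, T[%classic : set (measurableTypeR R)) (fun s => c%:E * g s)%E.
  by apply: emeasurable_funM.
have cg0 s : (0 <= c%:E * g s)%E by apply: mule_ge0.
apply: (@le_trans _ _ (\int[leb]_(s in `]t, T[) (c%:E * g s + (2 * A)%:E))%E).
  apply: ae_ge0_lower_integral_le => //.
  - exact: emeasurable_funD.
  - by move=> s _; rewrite lee_fin sumr_ge0// => i _; exact: sqr_ge0.
  - by move=> s _; rewrite adde_ge0// lee_fin mulr_ge0.
  apply: filterS2 error_ae_H1 gz => s hs hg; rewrite /= in_itv/= => ts.
  have sT : 0 < s < T by case/andP: ts => t1 ->; rewrite (le_lt_trans t0 t1).
  have sT' : 0 <= s <= T by case/andP: sT => *; rewrite !ltW.
  have [H1e H1u H1err] := hs sT.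
  rewrite sqdist_gradE// err'E.
  have Hw := error_H1 sT'.
  apply: (@le_trans _ _ (2 * expR (2 * (T - s)) * a (err' s) (err' s) + 2 * A)%:E).
    rewrite lee_fin; apply: le_trans (sip_sqrB_le SA (sipZ SA _ H1err) Hw) _.
    rewrite (sip_sqrZ SA)// exp2 mulrA lerD2l ler_pM2l//; apply: hA.
    by case/andP: ts => t1 t2; rewrite !ltW.
  rewrite EFinD leeD2r// EFinM.
  have a0 : 0 <= a (err' s) (err' s) by exact: (sip_ge0 SA).
  apply: (@le_trans _ _ (c%:E * (a (err' s) (err' s))%:E)%E).
    rewrite -!EFinM lee_fin ler_wpM2r// /c ler_pM2l// ler_expR ler_pM2l// lerB//.
    by case/andP: ts => /ltW.
  by rewrite lee_wpmul2l ?lee_fin//; exact: hg.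
rewrite ge0_integralD//; last by move=> s _; rewrite lee_fin mulr_ge0.
rewrite ge0_integralZl// integral_cst//.
have LD : leb `]t, T[%classic = (T - t)%:E by rewrite lebesgue_measure_itv/= lte_fin tT -EFinB.
rewrite [X in (_ + _ * X)%E]LD -EFinM EFinD; apply: leeD; last first.
  by rewrite lee_fin ler_wpM2l ?mulr_ge0// gerBl.
apply: (@le_trans _ _ (c%:E * (error_bound t / 2)%:E)%E).
  by rewrite lee_wpmul2l ?lee_fin.
have cE : c * (error_bound t / 2) = expR (2 * (T - t)) * error_bound t by rewrite /c; field.
by rewrite -EFinM cE.
Qed.

End error_system.

(** * Rates in terms of the noise level *)

Section rates.
Variable R : realType.
Implicit Types c tau k l p X : R.

(** The coefficients of the three estimates, added up. The factors [k] and [k ^+ 2] pay for the one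
    or two powers of the logarithm gained through [1 <= k * l]. *)
Definition rate_constant (E2 : R) c tau k : R :=
  (2 * E2 * tau ^+ 2 * c + 2 * E2) + (E2 * tau * c * k + 2 * E2 * k)
  + ((3 * E2 * c + 6 * E2 * tau ^+ 2 * c) * k ^+ 2 + (4 * E2 + 4 * E2 * tau) * k ^+ 2).

Lemma rate_constant_gt0 (E2 : R) c tau k : 0 < E2 -> 0 <= c -> 0 <= tau -> 0 <= k ->
  0 < rate_constant E2 c tau k.
Proof.
move=> E0 c0 t0 k0; have E1 := ltW E0; have t2 := sqr_ge0 tau; have k2 := sqr_ge0 k.
apply: ltr_wpDr.
  by rewrite addr_ge0// mulr_ge0// addr_ge0// !mulr_ge0.
apply: ltr_wpDr; first by rewrite addr_ge0// !mulr_ge0.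
by apply: ltr_wpDl; rewrite ?mulr_gt0// !mulr_ge0.
Qed.

Lemma rate_bounds (E2 : R) c tau k l p X : 0 <= E2 -> 0 <= c -> 0 <= tau -> 0 <= k ->
  0 < l -> 1 <= k * l -> 0 <= p -> 0 <= X ->
  [/\ E2 * (2 * tau ^+ 2 * (c * (l^-1 * X)) + 2 * p) <= rate_constant E2 c tau k * (p + l^-1 * X),
      E2 * (tau * (c * (l^-1 * X)) + 2 * p) <= rate_constant E2 c tau k * (l * p + X) &
      2 * E2 * (c * (l^-1 * X)) + 2 * (E2 * (2 * tau ^+ 2 * (c * (l^-1 * X)) + 2 * p))
      + (E2 * (c * (l^-1 * X)) + 2 * (E2 * (tau * (c * (l^-1 * X)) + 2 * p)) * tau)
      <= rate_constant E2 c tau k * (l ^+ 2 * p + l * X)].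
Proof.
move=> E0 c0 t0 k0 l0 kl p0 X0.
have split1 (u u' w w' x x' C : R) : 0 <= u' -> 0 <= w' -> x * u <= C * u' -> x' * w <= C * w' ->
    x * u + x' * w <= C * (u' + w').
  by move=> *; rewrite mulrDr lerD.
set Y := l^-1 * X.
have Y0 : 0 <= Y by rewrite mulr_ge0 ?invr_ge0 ?(ltW l0).
have XE : X = l * Y by rewrite /Y mulrA mulfV ?gt_eqF// mul1r.
set C := rate_constant _ _ _ _.
pose a1 := 2 * E2 * tau ^+ 2 * c; pose a2 := 2 * E2.
pose a3 := E2 * tau * c; pose a4 := 2 * E2.
pose a5 := 3 * E2 * c + 6 * E2 * tau ^+ 2 * c; pose a6 := 4 * E2 + 4 * E2 * tau.
have t2 : 0 <= tau ^+ 2 by exact: sqr_ge0.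
have p1 : 0 <= a1 by rewrite !mulr_ge0.
have p2 : 0 <= a2 by rewrite !mulr_ge0.
have p3 : 0 <= a3 by rewrite !mulr_ge0.
have p5 : 0 <= a5 by rewrite addr_ge0 ?mulr_ge0.
have p6 : 0 <= a6 by rewrite addr_ge0 ?mulr_ge0.
have CE : C = a1 + a2 + (a3 * k + a2 * k) + (a5 * k ^+ 2 + a6 * k ^+ 2) by [].
have q3 : 0 <= a3 * k by exact: mulr_ge0.
have q4 : 0 <= a2 * k by exact: mulr_ge0.
have q5 : 0 <= a5 * k ^+ 2 by rewrite mulr_ge0 ?sqr_ge0.
have q6 : 0 <= a6 * k ^+ 2 by rewrite mulr_ge0 ?sqr_ge0.
have u (w : R) : 0 <= w -> w <= k * (l * w).
  by move=> w0; rewrite mulrA; apply: le_trans (ler_wpM2r w0 kl); rewrite mul1r.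
have lw (w : R) : 0 <= w -> 0 <= l * w by move=> w0; rewrite mulr_ge0// ltW.
have u2 (w : R) : 0 <= w -> w <= k ^+ 2 * (l ^+ 2 * w).
  move=> w0; apply: le_trans (u w w0) _.
  rewrite !expr2 -!mulrA; apply: ler_wpM2l => //.
  by rewrite [l * (l * w)]mulrA; apply: le_trans (u _ (lw _ w0)) _; rewrite !mulrA.
have cmp (al be s : R) : 0 <= s -> al <= be -> al * s <= be * s.
  by move=> s0 ab; apply: ler_wpM2r.
split.
- have -> : E2 * (2 * tau ^+ 2 * (c * Y) + 2 * p) = a2 * p + a1 * Y by rewrite /a1 /a2; ring.
  by rewrite mulrDr; apply: lerD; apply: cmp => //; rewrite CE; lra.
- have -> : E2 * (tau * (c * Y) + 2 * p) = a2 * p + a3 * Y by rewrite /a2 /a3; ring.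
  rewrite mulrDr XE; apply: lerD.
    apply: le_trans (ler_wpM2l p2 (u p p0)) _; rewrite [a2 * _]mulrA.
    by apply: cmp; [exact: lw|rewrite CE; lra].
  apply: le_trans (ler_wpM2l p3 (u Y Y0)) _; rewrite [a3 * _]mulrA.
  by apply: cmp; [exact: lw|rewrite CE; lra].
- set lhs := (X in X <= _).
  have -> : lhs = a6 * p + a5 * Y by rewrite /lhs /a5 /a6; ring.
  have -> : l * X = l ^+ 2 * Y by rewrite XE expr2 mulrA.
  have l2 (w : R) : 0 <= w -> 0 <= l ^+ 2 * w by move=> w0; rewrite mulr_ge0 ?sqr_ge0.
  rewrite mulrDr; apply: lerD.
    apply: le_trans (ler_wpM2l p6 (u2 p p0)) _; rewrite [a6 * _]mulrA.
    by apply: cmp; [exact: l2|rewrite CE; lra].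
  apply: le_trans (ler_wpM2l p5 (u2 Y Y0)) _; rewrite [a5 * _]mulrA.
  by apply: cmp; [exact: l2|rewrite CE; lra].
Qed.

(** The bound on [eps * l] is [1 + x <= e^x] at [x = - ln eps], multiplied by [eps]. *)
Lemma noise_level (eps : R) : 0 < eps < 1 -> let l := ln (eps `^ (- 2^-1)) in
  [/\ 0 < l, (eps `^ (- 2^-1)) ^- 2 = eps, eps * l <= 2^-1 &
   forall x, eps `^ (1 - x / 2) = eps * expR (x * l)].
Proof.
move=> /andP[e0 e1]; rewrite /= ln_powR.
have eE : expR (ln eps) = eps by rewrite lnK ?posrE.
have le0 : ln eps < 0 by apply: ln_lt0; rewrite e0.
have en : eps != 0 by rewrite gt_eqF.
split.
- by rewrite mulNr oppr_gt0 pmulr_rlt0 ?invr_gt0.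
- rewrite /powR (negbTE en) -expRM_natl -expRN -[RHS]eE; congr expR.
  by field.
- have := expR_ge1Dx (- ln eps); rewrite expRN eE => h.
  have := ler_wpM2l (ltW e0) h; rewrite mulfV// => h2.
  by move: h2 e0; move: (ln eps) => w; lra.
- move=> x; rewrite /powR (negbTE en) -[in RHS]eE -expRD; congr expR.
  by rewrite eE; field.
Qed.

End rates.

Theorem corollary4p2 (R : realType) (M C0 C1 : R)
    (M_gt0 : 0 < M) (C0_gt0 : 0 < C0) (C1_gt0 : 0 < C1) :
  exists2 C : R, 0 < C &
  forall (d : nat) (Omega : smooth_domain R d) (T K rho : R) (gamma : R -> R)
    (W : nspace (L2dom Omega))
    (P Q : R -> {linear L2dom Omega -> L2dom Omega})
    (f0 f1 : L2dom Omega) (f0e f1e : R -> L2dom Omega)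
    (u ut : R -> L2dom Omega),
    (1 <= d <= 3)%N ->
    0 < T ->
    1 < rho ->
    (forall eps, 0 < eps < 1 -> 1 <= gamma eps) ->
    gamma @ 0^'+ --> +oo ->
    normed_subspace W ->
    perturbing gamma W C0 Q ->
    stabilized gamma C1 P ->
    (forall eps, 0 < eps < 1 -> two_laplacian_plus W (P eps) (Q eps)) ->
    H1_set f0 ->
    (forall eps, 0 < eps < 1 -> H1_set (f0e eps)) ->
    (forall eps, 0 < eps < 1 ->
      norm_H1 (f0e eps - f0) + norm (f1e eps - f1) <= eps) ->
    3 * C1 * T < 2 ->
    (exists2 l : R, gamma eps ^+ 2 * eps @[eps --> 0^'+] --> l & l <= K) ->
    original_solution T f0 f1 u ut ->
    in_CX W T u ->
    in_L2X W T ut ->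
    (forall w wt, original_solution T f0 f1 w wt ->
      in_CX W T w -> in_L2X W T wt -> forall t, 0 <= t <= T -> w t = u t) ->
    ((norm_CX W T u ^+ 2)%:E + sqnorm_L2X W T ut <= M%:E)%E ->
    (forall eps, 0 < eps < 1 -> gamma eps = eps `^ (- 2^-1)) ->
    forall eps, 0 < eps < 1 -> eps <= expR (- 4 / C1) ->
    forall ue uet : R -> L2dom Omega,
      regularized_solution rho T (P eps) (f0e eps) (f1e eps) ue uet ->
    forall t, 0 <= t <= T ->
    [/\ norm (ue t - u t) ^+ 2 <=
          C * (eps + (ln (eps `^ (- 2^-1)))^-1
                     * eps `^ (1 - 3 * C1 * (T - t) / 2)),
        sqdist_grad (ue t) (u t) <=
          C * (ln (eps `^ (- 2^-1)) * eps
               + eps `^ (1 - 3 * C1 * (T - t) / 2)) &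
        ((norm (uet t - ut t) ^+ 2)%:E
         + \int[lebesgue_measure]_(s in `]t, T[) (sqdist_grad (uet s) (ut s))%:E
         <= (C * (ln (eps `^ (- 2^-1)) ^+ 2 * eps
                  + ln (eps `^ (- 2^-1)) * eps `^ (1 - 3 * C1 * (T - t) / 2)))%:E)%E].
Proof.
(* [tau] stands in for [T] and [E2] for the exponential weights. In [c], the share [2^-1] is for the
   terminal error and the rest for the source; [k] is the inverse of the lower bound [2 / C1] of the
   logarithm. *)
pose tau := 2 / (3 * C1); pose E2 := expR (2 * tau).
pose c := 2^-1 + 2 * C0 ^+ 2 * M * (tau + 1) / C1; pose k := C1 / 2.
have tau0 : 0 < tau by rewrite divr_gt0// mulr_gt0.
have E20 : 0 < E2 by exact: expR_gt0.
have c0 : 0 < c.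
  by rewrite ltr_wpDr ?invr_gt0// divr_ge0 ?mulr_ge0 ?addr_ge0 ?sqr_ge0// ltW.
have k0 : 0 < k by rewrite divr_gt0.
exists (rate_constant E2 c tau k).
  by apply: rate_constant_gt0 => //; exact: ltW.
move=> d Omega T K rho gamma W P Q f0 f1 f0e f1e u ut _ T0 _ _ _ nW HQ HP HL Hf0 Hf0e hdata C1T
  _ Hu cu cut _ hM gammaE eps eps01 eps_small ue uet Hue t tT.
have /andP[e0 e1] := eps01.
have [l0 gam2 el XE] := noise_level eps01; rewrite -gammaE// in l0 gam2 el *.
set l := ln (gamma eps) in l0 el *.
have g0 : 0 < gamma eps by rewrite gammaE// powR_gt0.
have XE' x : eps `^ (1 - x / 2) = eps * expR (x * l) by rewrite XE /l gammaE.
have l2 : 2 / C1 <= l.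
  rewrite /l gammaE// ln_powR -lerN2 -mulNr opprK -(@ler_pM2l _ 2)// mulrA mulfV// mul1r.
  have -> : 2 * - (2 / C1) = - 4 / C1 by rewrite mulrN mulrA -natrM mulNr.
  by rewrite -[leRHS]expRK ler_ln ?posrE ?expR_gt0.
have kl : 1 <= k * l.
  by rewrite /k mulrAC ler_pdivlMr// mul1r -ler_pdivrMl// mulrC.
have B0 : 0 < C1 * l by rewrite mulr_gt0.
have Ttau : T <= tau by rewrite /tau ler_pdivlMr ?mulr_gt0// mulrC ltW.
have [v [v' [v'' [Ev Heqv vT v'T vE]]]] := Hue.
have TT : 0 <= T <= T by rewrite lexx ltW.
have [vT1 vT2] := vE T TT.
have ueT : ue T = f0e eps by rewrite -vT vT1 subrr mulr0 expR0 scale1r.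
have uetT : uet T = f1e eps.
  by have := vT2; rewrite v'T subrr mulr0 expR0 scale1r ueT [RHS]addrC => /addrI <-.
have [utt [_ _ uT utT]] := Hu.
have Hd := hdata eps eps01.
have HQe := HQ eps eps01; have HPe := HP eps eps01; have HLe := HL eps eps01.
have ueuT : norm_H1 (ue T - u T) <= eps.
  rewrite ueT uT; apply: le_trans Hd; rewrite lerDl; exact: sqrtr_ge0.
pose G := domain_gelfand Omega.
have zT : norm (err' T u ut ue uet T) <= eps.
  rewrite /err' subrr expR0 scale1r ueT uetT uT utT opprD addrACA.
  apply: le_trans Hd; apply: le_trans (nb_triangle (dot_sip Omega) I I) _.
  rewrite lerD2r norm_H1E ler_wsqrtr// lerDl; apply: (sip_ge0 (gel_a G)).
  by apply: (sipB (gel_a G)); [exact: Hf0e|exact: Hf0].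
set X := eps `^ (1 - 3 * C1 * (T - t) / 2).
have X0 : 0 <= X by exact: powR_ge0.
(* The Gronwall factor times [eps] is [X]. What remains is [eps ^+ 2], at most [eps / (2 l)], and
   the source, where [gamma^(-2) = eps] and the division by [B = C1 l] produces [l^-1]. *)
have bnd : error_bound T (C1 * l) C0 M (gamma eps) u ut ue uet t <= c * (l^-1 * X).
  have -> : c * (l^-1 * X) = expR (3 * (C1 * l) * (T - t)) * (c * (l^-1 * eps)).
    have -> : X = eps * expR (3 * (C1 * l) * (T - t)).
      by rewrite /X XE'; congr (_ * expR _); ring.
    by ring.
  rewrite ler_pM2l ?expR_gt0//.
  have -> : c * (l^-1 * eps) = 2^-1 * (l^-1 * eps) +
      2 * (C0 / gamma eps) ^+ 2 * (M * (tau + 1)) / (C1 * l).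
    rewrite expr_div_n gam2 /c; field; rewrite !gt_eqF//.
  apply: lerD.
    rewrite -norm_sqr; apply: (@le_trans _ _ (eps ^+ 2)).
      by rewrite lerXn2r ?nnegrE ?(ltW e0)//; exact: sqrtr_ge0.
    rewrite expr2 mulrA ler_pM2r// -(ler_pM2r l0) -mulrA mulVf ?gt_eqF//.
    by rewrite mulr1.
  rewrite ler_pM2r ?invr_gt0//; apply: ler_wpM2l; first by rewrite mulr_ge0 ?sqr_ge0.
  by rewrite ler_pM2l// lerD2r.
have bge0 s := error_bound_ge0 ue uet T0 B0 C0_gt0 g0 nW HQe HLe Hu cu cut hM s.
have ble := error_bound_le ue uet T0 B0 C0_gt0 g0 nW HQe HLe Hu cu cut hM.
have ees : eps ^+ 2 <= eps by rewrite expr2 ler_piMr ?(ltW e0) ?(ltW e1).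
have Ele (s : R) : 0 <= s <= T -> expR (2 * (T - s)) <= E2.
  move=> /andP[s0 sT]; rewrite ler_expR ler_pM2l//; apply: le_trans Ttau.
  by rewrite gerBl.
have [r1 r2 r3] := rate_bounds (ltW E20) (ltW c0) (ltW tau0) (ltW k0) l0 kl (ltW e0) X0.
move: r1 r2 r3; set D1 := E2 * _; set D2 := E2 * _; set C := rate_constant _ _ _ _.
set Y := c * (l^-1 * X) in D1 D2 bnd *.
have Y0 : 0 <= Y by apply: le_trans bnd.
move=> r1 r2 r3.
have T20 : 0 <= 2 * T ^+ 2 by rewrite mulr_ge0 ?sqr_ge0.
have tau2 : 2 * T ^+ 2 <= 2 * tau ^+ 2 by rewrite ler_pM2l// lerXn2r ?nnegrE ?(ltW T0) ?(ltW tau0).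
(* Bounds uniform on [[t, T]], since [error_bound] decreases in time; the time integral of the
   velocity gradient needs them at all later times. *)
have disp s : t <= s <= T ->
    dot (ue s - u s) (ue s - u s) <= D1 /\ dot_grad (ue s - u s) (ue s - u s) <= D2.
  move=> /andP[ts sT]; have /andP[t0 _] := tT.
  have sT' : 0 <= s <= T by rewrite sT (le_trans t0).
  have bs := le_trans (ble _ _ ts) bnd.
  have [h1 h2] := displacement_estimate T0 B0 C0_gt0 g0 nW HQe HPe HLe Hu cu cut hM Ev Heqv vE sT' ueuT.
  split.
    apply: le_trans h1 _; apply: ler_pM; rewrite ?expR_ge0 ?Ele//.
      by apply: addr_ge0; apply: mulr_ge0; rewrite ?sqr_ge0 ?bge0.
    by apply: lerD; [apply: ler_pM|rewrite ler_pM2l].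
  apply: le_trans h2 _; apply: ler_pM; rewrite ?expR_ge0 ?Ele//.
    by apply: addr_ge0; apply: mulr_ge0; rewrite ?sqr_ge0 ?bge0 ?(ltW T0).
  by apply: lerD; [apply: ler_pM; rewrite ?(ltW T0)|rewrite ler_pM2l].
have tt : t <= t <= T by case/andP: tT => _ ->; rewrite lexx.
have [d1 d2] := disp t tt.
have H1t : H1_set (ue t - u t) := error_H1 T0 Hu Ev vE tT.
have [_ cv _ _ _] := Ev; have [utt' [[_ cuH _ _ _] _ _ _]] := Hu.
split.
- by rewrite norm_sqr; exact: le_trans d1 r1.
- have [/H10_H1 Hut _] := cuH t tT.
  have Huet : H1_set (ue t) by rewrite -[ue t](subrK (u t)); exact: (sipD (gel_a G)).
  by rewrite sqdist_gradE//; exact: le_trans d2 r2.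
- have vel := velocity_estimate T0 B0 C0_gt0 g0 nW HQe HPe HLe Hu cu cut hM Ev Heqv vE tT.
  have gr := velocity_gradient_estimate T0 B0 C0_gt0 g0 nW HQe HPe HLe Hu cu cut hM Ev Heqv vE tT
    (fun s ts => (disp s ts).2).
  apply: le_trans (leeD (lexx _) gr) _; rewrite -EFinD lee_fin norm_sqr.
  apply: le_trans r3.
  have D20 : 0 <= D2.
    apply: mulr_ge0; first exact: ltW.
    by apply: addr_ge0; apply: mulr_ge0; rewrite ?(ltW tau0) ?(ltW e0).
  have Eb : expR (2 * (T - t)) * error_bound T (C1 * l) C0 M (gamma eps) u ut ue uet t <= E2 * Y.
    by apply: ler_pM; rewrite ?expR_ge0 ?Ele.
  apply: lerD; last by apply: lerD => //; rewrite ler_wpM2l// mulr_ge0.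
  apply: le_trans vel _; apply: lerD; last by rewrite ler_pM2l.
  by rewrite -!mulrA ler_pM2l.
Qed.
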